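(* Let $\varepsilon_n\downarrow0$ and $\delta_n=\varepsilon_n^2$ satisfy $\sqrt n\,\delta_n\to\tau\in(0,\infty)$. With the notation of the context (in particular after nuisance elimination), assume that for every compact interval $K\subset\mathbb R$ the predictive density ratios satisfy, for $\zeta\in K$, $$R_{k,\varepsilon_n,\zeta}=1+\delta_nH^\perp_{k,\zeta}+\delta_n r_{k,\varepsilon_n,\zeta},\qquad H^\perp_{k,\zeta}=\zeta J^\perp_{-,k}+\frac{\zeta^2}{2}J^\perp_{+,k},$$ with a remainder $r_{k,\varepsilon_n,\cdot}\in W^{1,2}(K)$ such that $$\frac1n\sum_{k=1}^n\mathbb E\bigl[\|r_{k,\varepsilon_n,\cdot}\|^2_{W^{1,2}(K)}\bigr]\longrightarrow0,$$ and assume the conditional Lindeberg condition for the two predictive jet coordinates. Suppose further that the efficient predictable Gram matrices converge, $$G_n^{\mathrm{pred,eff}}\xrightarrow{P}G_{\mathrm{pred}}^{\mathrm{eff}},\qquad G_{\mathrm{pred}}^{\mathrm{eff}}>0\ \text{(positive definite)}.$$ Then the log-likelihood ratio process, after nuisance elimination, satisfies on every compact interval $K$ (weak convergence in $C(K)$) $$\Lambda_n(\zeta)\Longrightarrow\tau Z_{\mathrm{pred}}(H_\zeta^\perp)-\frac{\tau^2}{2}\|H_\zeta^\perp\|^2_{\mathrm{pred}},\qquad \zeta\in K,\qquad H_\zeta^\perp=\zeta J_-^\perp+\frac{\zeta^2}{2}J_+^\perp,$$ where $Z_{\mathrm{pred}}$ is the isonormal Gaussian process on the two-dimensional Hilbert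 space spanned by $J_-^\perp,J_+^\perp$ with Gram matrix $G_{\mathrm{pred}}^{\mathrm{eff}}$. In particular, the limiting mean family $\zeta\mapsto\tau H_\zeta^\perp$ is a non-degenerate parabola.
   Context: $(Y_k)_{k\ge0}$ is a stationary observed process with natural filtration $\mathcal F^Y_k=\sigma(Y_j:j\le k)$ and parameters $(\varepsilon,\lambda)$; expectations, probabilities and limits in law are under the baseline law with parameters $(\varepsilon_n,0)$. The likelihood is factorized as $p_{\varepsilon,\lambda}(Y_{0:n})=p_{\varepsilon,\lambda}(Y_0)\prod_{k=1}^np_{\varepsilon,\lambda}(Y_k\mid\mathcal F^Y_{k-1})$, the initial term being suppressed. In the layer $\lambda=\varepsilon\zeta$, $$R_{k,\varepsilon,\zeta}=\frac{p_{\varepsilon,\varepsilon\zeta}(Y_k\mid\mathcal F^Y_{k-1})}{p_{\varepsilon,0}(Y_k\mid\mathcal F^Y_{k-1})},\qquad \Lambda_n(\zeta)=\sum_{k=1}^n\log R_{k,\varepsilon_n,\zeta},$$ and conditional normalization gives $\mathbb E[R_{k,\varepsilon,\zeta}\mid\mathcal F^Y_{k-1}]=1$. The jets $J_{\pm,k}$ are square-integrable martingale differences: $\mathbb E[J_{\pm,k}\mid\mathcal F^Y_{k-1}]=0$; hence also $\mathbb E[r_{k,\varepsilon,\zeta}\mid\mathcal F^Y_{k-1}]=0$. Nuisance elimination: if a nuisance score increment $Q_k\in\mathbb R^r$ is present, one works with the efficient Gaussian quotient of the joint predictive experiment (equivalently along a least-favourable local nuisance path), i.e. with efficient predictive martingale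 differences $J^\perp_{\pm,k}$ whose limiting Gram matrix is the Schur complement $G_{\mathrm{pred}}^{\mathrm{eff}}=G_{VV}-G_{VQ}G_{QQ}^{-1}G_{QV}$ of the joint limiting predictable Gram matrix of $(V_k,Q_k)$, $V_k=(J_{-,k},J_{+,k})^\top$, with $G_{QQ}$ invertible; without nuisances $J^\perp_{\pm,k}=J_{\pm,k}$. Put $V_k^\perp=(J_{-,k}^\perp,J_{+,k}^\perp)^\top$; then $G_n^{\mathrm{pred,eff}}=\frac1n\sum_{k=1}^n\mathbb E[V_k^\perp V_k^{\perp\top}\mid\mathcal F^Y_{k-1}]$. Conditional Lindeberg: $\frac1n\sum_{k=1}^n\mathbb E[\|V_k^\perp\|^2\mathbf 1_{\{\|V_k^\perp\|>\eta\sqrt n\}}\mid\mathcal F^Y_{k-1}]\xrightarrow{P}0$ for every $\eta>0$ (a conditional $L^{2+\eta'}$ bound is sufficient). Concretely, with $b(\zeta)=(\zeta,\zeta^2/2)^\top$ and $Z\sim N(0,G_{\mathrm{pred}}^{\mathrm{eff}})$, $Z_{\mathrm{pred}}(H_\zeta^\perp)=b(\zeta)^\top Z$ and $\|H_\zeta^\perp\|^2_{\mathrm{pred}}=b(\zeta)^\top G_{\mathrm{pred}}^{\mathrm{eff}}b(\zeta)$. *)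

(* Defs.v *)
From HB Require Import structures.
From mathcomp Require Import all_boot all_order all_algebra.
From mathcomp Require Import all_classical all_reals all_analysis.
Set Implicit Arguments.
Unset Strict Implicit.
Unset Printing Implicit Defensive.
Import Order.TTheory GRing.Theory Num.Theory.
Import numFieldNormedType.Exports.
Local Open Scope classical_set_scope.
Local Open Scope ring_scope.

Definition natural_filtration (d dT : measure_display)
    (Omega : measurableType d) (T : measurableType dT)
    (Y : nat -> Omega -> T) (k : nat) : set (set Omega) :=
  <<s \bigcup_(j in [set j | (j <= k)%N])
        preimage_set_system [set: Omega] (Y j) (@measurable _ T) >>.

(* Shift invariance on cylinders, i.e. of all finite-dimensional laws. *)
Definition stationary (d dT : measure_display) (Omega : measurableType d)
    (T : measurableType dT) (R : realType) (P : probability Omega R)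
    (Y : nat -> Omega -> T) : Prop :=
  forall (s m : nat) (B : nat -> set T), (forall j, measurable (B j)) ->
    P (\bigcap_(j in [set j | (j < m)%N]) Y (s + j)%N @^-1` B j) =
    P (\bigcap_(j in [set j | (j < m)%N]) Y j @^-1` B j).

Definition past (Omega T : Type) (Y : nat -> Omega -> T) (k : nat) (w : Omega) :
    k.-tuple T :=
  [tuple Y (j : nat) w | j < k].

(* [q] is a version of the density of [Y_k] given [Y_0, ..., Y_(k-1)] with
   respect to [mu].  The events [past Y k @^-1` A] are exactly the elements of
   [natural_filtration Y k.-1] when [0 < k]. *)
Definition predictive_density (d dT : measure_display)
    (Omega : measurableType d) (T : measurableType dT) (R : realType)
    (P : probability Omega R) (Y : nat -> Omega -> T)
    (mu : {sigma_finite_measure set T -> \bar R}) (k : nat)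
    (q : k.-tuple T * T -> R) : Prop :=
  [/\ measurable_fun [set: k.-tuple T * T] q,
      (forall x, 0 <= q x) &
      forall (A : set (k.-tuple T)) (B : set T), measurable A -> measurable B ->
        P ((past Y k @^-1` A) `&` (Y k @^-1` B)) =
        (\int[P]_(w in past Y k @^-1` A)
           \int[mu]_(y in B) (q (past Y k w, y))%:E)%E].

(* [dens e l th k] is the predictive density of [Y_k] at the parameters
   (epsilon, lambda) = (e, l) and nuisance parameter [th].  In the layer
   lambda = epsilon * zeta the nuisance parameter moves from [th0] to [th]. *)
Definition predictive_ratio (d dT : measure_display)
    (Omega : measurableType d) (T : measurableType dT) (R : realType) (m : nat)
    (dens : R -> R -> 'cV[R]_m -> forall k : nat, k.-tuple T * T -> R)
    (Y : nat -> Omega -> T) (e z : R) (th0 th : 'cV[R]_m) (k : nat)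
    (w : Omega) : R :=
  dens e (e * z) th k (past Y k w, Y k w) / dens e 0 th0 k (past Y k w, Y k w).

(* The initial factor (k = 0) is suppressed. *)
Definition log_likelihood_ratio (d dT : measure_display)
    (Omega : measurableType d) (T : measurableType dT) (R : realType) (m : nat)
    (dens : R -> R -> 'cV[R]_m -> forall k : nat, k.-tuple T * T -> R)
    (Y : nat -> Omega -> T) (e : R) (th0 : 'cV[R]_m) (path : R -> 'cV[R]_m)
    (n : nat) (w : Omega) (z : R) : R :=
  \sum_(1 <= k < n.+1) ln (predictive_ratio dens Y e z th0 (path z) k w).

Definition sub_measurable (Omega : Type) (R : realType)
    (G : set (set Omega)) (X : Omega -> R) : Prop :=
  forall B : set R, measurable B -> G (X @^-1` B).

Definition is_cond_exp (d : measure_display) (Omega : measurableType d)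
    (R : realType) (P : probability Omega R) (G : set (set Omega))
    (X Z : Omega -> R) : Prop :=
  [/\ sub_measurable G Z,
      P.-integrable [set: Omega] (EFin \o Z) &
      forall A, G A ->
        (\int[P]_(w in A) (Z w)%:E = \int[P]_(w in A) (X w)%:E)%E].

(* A version of E[X | G]; it is only used for integrable [X], where one exists
   by Radon-Nikodym. *)
Definition cond_exp (d : measure_display) (Omega : measurableType d)
    (R : realType) (P : probability Omega R) (G : set (set Omega))
    (X : Omega -> R) : Omega -> R :=
  xget (cst 0) [set Z | is_cond_exp P G X Z].

Definition sq_integrable_martingale_difference (d : measure_display)
    (Omega : measurableType d) (R : realType) (P : probability Omega R)
    (F : nat -> set (set Omega)) (k p : nat) (X : Omega -> 'cV[R]_p) : Prop :=
  forall i : 'I_p,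
    [/\ sub_measurable (F k) (fun w => X w i 0),
        P.-integrable [set: Omega] (fun w => ((X w i 0) ^+ 2)%:E) &
        is_cond_exp P (F k.-1) (fun w => X w i 0) (cst 0)].

Definition predictable_matrix (Omega : Type) (R : realType)
    (F : nat -> set (set Omega)) (k p q : nat) (A : Omega -> 'M[R]_(p, q)) :
    Prop :=
  forall i j, sub_measurable (F k.-1) (fun w => A w i j).

Definition cvg_in_prob (d : measure_display) (Omega : measurableType d)
    (R : realType) (P : nat -> probability Omega R) (X : nat -> Omega -> R)
    (c : R) : Prop :=
  forall eta : R, 0 < eta ->
    (fun n => P n [set w | eta < `|X n w - c|]) @ \oo --> 0%E.

(* (1/n) sum_(k = 1..n) E[X_k X_k^T | F_(k-1)] *)
Definition predictable_gram (d : measure_display) (Omega : measurableType d)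
    (R : realType) (P : probability Omega R) (F : nat -> set (set Omega))
    (p : nat) (X : nat -> Omega -> 'cV[R]_p) (n : nat) (w : Omega) : 'M[R]_p :=
  \matrix_(i, j) (n%:R^-1 * \sum_(1 <= k < n.+1)
    cond_exp P (F k.-1) (fun w' => X k w' i 0 * X k w' j 0) w).

Definition gram_cvg_in_prob (d : measure_display) (Omega : measurableType d)
    (R : realType) (P : nat -> probability Omega R)
    (F : nat -> set (set Omega)) (p : nat)
    (X : nat -> nat -> Omega -> 'cV[R]_p) (G : 'M[R]_p) : Prop :=
  forall i j : 'I_p,
    cvg_in_prob P (fun n w => predictable_gram (P n) F (X n) n w i j) (G i j).

Definition euclid_norm (R : realType) (p : nat) (v : 'cV[R]_p) : R :=
  Num.sqrt (\sum_i v i 0 ^+ 2).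

Definition conditional_lindeberg (d : measure_display)
    (Omega : measurableType d) (R : realType)
    (P : nat -> probability Omega R) (F : nat -> set (set Omega)) (p : nat)
    (X : nat -> nat -> Omega -> 'cV[R]_p) : Prop :=
  forall eta : R, 0 < eta ->
    cvg_in_prob P (fun n w => n%:R^-1 * \sum_(1 <= k < n.+1)
      cond_exp (P n) (F k.-1)
        (fun w' => euclid_norm (X n k w') ^+ 2 *
           \1_[set w'' | eta * Num.sqrt n%:R < euclid_norm (X n k w'')] w') w)
      0.

Definition jet_vector (R : realType) (jm jp : R) : 'cV[R]_2 :=
  \col_(i < 2) (if i == 0 then jm else jp).

Definition parabola_coord (R : realType) (z : R) : 'cV[R]_2 :=
  jet_vector z (z ^+ 2 / 2).

Definition jet_parabola (R : realType) (z : R) (v : 'cV[R]_2) : R :=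
  z * v 0 0 + z ^+ 2 / 2 * v 1 0.

(* The jets with their (predictable) regression on the nuisance scores removed.
   Efficiency is the requirement that the limiting Gram matrix be
   [schur_complement] below; the choice [A = G_VQ G_QQ^-1] is one instance.
   For [m = 0] this is [V]. *)
Definition efficient_increment (R : realType) (m : nat) (V : 'cV[R]_2)
    (A : 'M[R]_(2, m)) (Q : 'cV[R]_m) : 'cV[R]_2 :=
  V - A *m Q.

Definition schur_complement (R : realType) (m : nat) (G : 'M[R]_(2 + m)) :
    'M[R]_2 :=
  ulsubmx G - ursubmx G *m invmx (drsubmx G) *m dlsubmx G.

Definition C1c (R : realType) (a b : R) (phi : R -> R) : Prop :=
  [/\ forall x, derivable phi x 1,
      continuous (derive1 phi) &
      exists c d : R, [/\ a < c, d < b &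
        forall x, x \notin `[c, d] -> phi x = 0]].

Definition weak_L2_derivative (R : realType) (a b : R) (g D : R -> R) : Prop :=
  [/\ measurable_fun `[a, b] D,
      lebesgue_measure.-integrable `[a, b] (fun x => (D x ^+ 2)%:E) &
      forall phi, C1c a b phi ->
        \int[lebesgue_measure]_(x in `[a, b]) (g x * derive1 phi x) =
        - \int[lebesgue_measure]_(x in `[a, b]) (D x * phi x)].

(* The element of W^{1,2} is identified with its continuous representative. *)
Definition W12 (R : realType) (a b : R) (g : R -> R) : Prop :=
  {within `[a, b], continuous g} /\ exists D, weak_L2_derivative a b g D.

Definition weak_derivative (R : realType) (a b : R) (g : R -> R) : R -> R :=
  xget (cst 0) [set D | weak_L2_derivative a b g D].

Definition W12_normsq (R : realType) (a b : R) (g : R -> R) : \bar R :=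
  (\int[lebesgue_measure]_(x in `[a, b]) (g x ^+ 2)%:E +
   \int[lebesgue_measure]_(x in `[a, b]) (weak_derivative a b g x ^+ 2)%:E)%E.

Definition dotp (R : realType) (p : nat) (u v : 'cV[R]_p) : R :=
  (u^T *m v) 0 0.

(* Inner product on the span of J_-, J_+ in the coordinates of that basis. *)
Definition pred_inner (R : realType) (p : nat) (G : 'M[R]_p) (u v : 'cV[R]_p) :
    R :=
  (u^T *m G *m v) 0 0.

Definition pred_normsq (R : realType) (p : nat) (G : 'M[R]_p) (u : 'cV[R]_p) :
    R :=
  pred_inner G u u.

Definition positive_definite (R : realType) (p : nat) (G : 'M[R]_p) : Prop :=
  G^T = G /\ forall u : 'cV[R]_p, u != 0 -> 0 < pred_normsq G u.

(* Every linear form of [Z] is centred normal with the variance given by [G];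
   [normal_prob] is not a Dirac mass at standard deviation 0. *)
Definition gaussian_vector (d : measure_display) (Omega : measurableType d)
    (R : realType) (P : probability Omega R) (p : nat)
    (Z : Omega -> 'cV[R]_p) (G : 'M[R]_p) : Prop :=
  (forall i, measurable_fun [set: Omega] (fun w => Z w i 0)) /\
  forall (u : 'cV[R]_p) (B : set R), measurable B ->
    P [set w | B (dotp u (Z w))] =
    (if pred_normsq G u == 0 then \d_(0 : R) B
     else normal_prob 0 (Num.sqrt (pred_normsq G u)) B).

(* For [Z] Gaussian with covariance [G], [h |-> isonormal Z h] is the isonormal
   process on the Hilbert space with inner product [pred_inner G], in its
   version that is linear in [h]. *)
Definition isonormal (Omega : Type) (R : realType) (p : nat)
    (Z : Omega -> 'cV[R]_p) (h : 'cV[R]_p) (w : Omega) : R :=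
  dotp h (Z w).

Definition limit_process (Omega : Type) (R : realType) (tau : R)
    (G : 'M[R]_2) (Z : Omega -> 'cV[R]_2) (w : Omega) (z : R) : R :=
  tau * isonormal Z (parabola_coord z) w -
  tau ^+ 2 / 2 * pred_normsq G (parabola_coord z).

(* Linear independence of the two directions is taken in the Hilbert seminorm
   of [G]. *)
Definition nondegenerate_parabola (R : realType) (p : nat) (G : 'M[R]_p)
    (c : R -> 'cV[R]_p) : Prop :=
  exists p0 v1 v2 : 'cV[R]_p,
    (forall z, c z = p0 + z *: v1 + z ^+ 2 *: v2) /\
    (forall s t : R, pred_normsq G (s *: v1 + t *: v2) = 0 -> s = 0 /\ t = 0).

Definition Cab (R : realType) (a b : R) : set {uniform` `[a, b] -> R} :=
  [set g | {within `[a, b], continuous (g : R -> R)}].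
Arguments Cab {R} a b.

Definition outer_expectation (d : measure_display) (Omega : measurableType d)
    (R : realType) (P : probability Omega R) (X : Omega -> R) : \bar R :=
  ereal_inf [set ('E_P[U])%E | U in [set U : Omega -> R |
    [/\ measurable_fun [set: Omega] U,
        P.-integrable [set: Omega] (EFin \o U) &
        forall w, X w <= U w]]].

(* Weak convergence in the sense of Hoffmann-Jorgensen: the [X n] need not be
   measurable, and need be C([a, b])-valued only with (inner) probability
   tending to one.  For C([a, b])-valued random elements this is the usual weak
   convergence, the outer expectation being the expectation. *)
Definition weak_cvg_C (d d' : measure_display) (Omega : measurableType d)
    (Omega' : measurableType d') (R : realType) (a b : R)
    (P : nat -> probability Omega R) (X : nat -> Omega -> R -> R)
    (P' : probability Omega' R) (X' : Omega' -> R -> R) : Prop :=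
  [/\ (fun n => mu_ext (P n) [set w | ~ Cab a b (X n w)]) @ \oo --> 0%E,
      (forall w, Cab a b (X' w)) &
      forall f : {uniform` `[a, b] -> R} -> R,
        {within Cab a b, continuous f} ->
        (exists M : R, forall g, `|f g| <= M) ->
        (fun n => outer_expectation (P n) (fun w => f (X n w))) @ \oo -->
        ('E_P'[fun w => f (X' w)])%E].

(* Main.v *)
(* The normalised jet sums satisfy a martingale central limit theorem, obtained by
   telescoping exp(V_k/2) cos(S_k), with V_k the conditional variance of S_k, after
   stopping before V exceeds its limit plus one.  Expectations of bounded continuous
   functions of the pair of sums then converge by approximation with Bernstein
   polynomials in sin(x/L) and sin(y/L), so Levy's continuity theorem is not needed.
   The remainder is uniformly small in zeta because the W^{1,2} norm dominates
   dyadic energies that increase to control the supremum and whose expectations add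
   up over martingale differences.  Expanding the logarithm to second order puts the
   log-likelihood ratio uniformly close to a parabola whose coefficients are the jet
   sums; as those parabolas form a finite-dimensional family, weak convergence in
   C([a, b]) reduces to the convergence of the pair of sums. *)

(* The main obstacle is uniformity in zeta. Summing norms of the remainders by the triangle
   inequality loses a factor of order root n, so their conditional centring must be used.
   Orthogonality says nothing about a supremum, but it applies exactly to sums of squares of values
   and increments at fixed points; since such sums increase with the dyadic level, one exceptional
   event serves all levels. This also avoids conditional expectations of weak derivatives, and
   measurability of the W^{1,2} norm, whose integral is read as a lower integral. The likelihood
   process is not assumed measurable in omega, and its continuity is obtained only with probability
   tending to one. Comparisons are therefore made outside measurable sets of small probability, and
   only the two jet sums, which are measurable, enter the limit theorem. A product of two cosines is
   a half sum of cosines, so convergence of cosine transforms extends to trigonometric polynomials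
   of any period. With a long period these separate the points of a given box, and Bernstein's
   formula preserves bounds outside it. *)
Require Import Defs.
From HB Require Import structures.
From mathcomp Require Import all_boot all_order all_algebra.
From mathcomp Require Import all_classical all_reals all_analysis.
From mathcomp Require Import measurable_realfun.
From mathcomp Require Import ring lra.
Set Implicit Arguments.
Unset Strict Implicit.
Unset Printing Implicit Defensive.
Import Order.TTheory GRing.Theory Num.Theory.
Import numFieldNormedType.Exports.
Local Open Scope classical_set_scope.
Local Open Scope ring_scope.

(** * Expectations and conditional expectations *)

Section expectation.
Context d (Omega : measurableType d) (R : realType) (P : probability Omega R).
Implicit Types f g : Omega -> R.

Definition L1 f := P.-integrable [set: Omega] (EFin \o f).

Lemma L1_measurable f : L1 f -> measurable_fun setT f.
Proof. by move=> /measurable_int /measurable_EFinP. Qed.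

Lemma L1_le f g : measurable_fun setT f -> L1 g ->
  (forall w, `|f w| <= g w) -> L1 f.
Proof.
move=> mf ig h; apply: (le_integrable measurableT _ _ ig).
  exact/measurable_EFinP.
by move=> x _ /=; rewrite lee_fin (le_trans (h x))// ler_norm.
Qed.

Lemma L1_bounded f M : measurable_fun setT f -> (forall w, `|f w| <= M) -> L1 f.
Proof.
move=> mf h; apply: (@L1_le _ (cst M)) => //.
exact: finite_measure_integrable_cst.
Qed.

Lemma L1_cst c : L1 (cst c).
Proof. exact: finite_measure_integrable_cst. Qed.

Lemma L1_ext f g : f =1 g -> L1 f -> L1 g.
Proof. by move=> /funext ->. Qed.

Lemma L1D f g : L1 f -> L1 g -> L1 (fun w => f w + g w).
Proof. by move=> hf hg; apply: (integrableD measurableT hf hg). Qed.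

Lemma L1B f g : L1 f -> L1 g -> L1 (fun w => f w - g w).
Proof. by move=> hf hg; apply: (integrableB measurableT hf hg). Qed.

Lemma L1Z c f : L1 f -> L1 (fun w => c * f w).
Proof. by move=> hf; apply: (integrableZl measurableT c hf). Qed.

Lemma L1_sum (I : Type) (s : seq I) (Q : pred I) (F : I -> Omega -> R) :
  (forall i, Q i -> L1 (F i)) -> L1 (fun w => \sum_(i <- s | Q i) F i w).
Proof.
move=> h; elim: s => [|i s IH].
  by apply: (L1_ext (f := cst 0)) (L1_cst _) => w; rewrite big_nil.
apply: (L1_ext (f := fun w =>
  (if Q i then F i w else 0) + \sum_(j <- s | Q j) F j w)).
  by move=> w; rewrite big_cons; case: ifP => //; rewrite add0r.
apply: L1D => //; case: (boolP (Q i)) => [/h//|_]; exact: L1_cst.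
Qed.

Lemma L1_norm f : L1 f -> L1 (fun w => `|f w|).
Proof. by move=> /integrable_norm. Qed.

Lemma L1_mul f g : measurable_fun setT f -> measurable_fun setT g ->
  L1 (fun w => f w ^+ 2) -> L1 (fun w => g w ^+ 2) -> L1 (fun w => f w * g w).
Proof.
move=> mf mg hf hg; apply: (L1_le (g := fun w => f w ^+ 2 + g w ^+ 2)).
- exact: measurable_funM.
- exact: L1D.
- move=> w; rewrite ler_norml; apply/andP; split.
    by have := sqr_ge0 (f w + g w); have := sqr_ge0 (f w); have := sqr_ge0 (g w); nra.
  by have := sqr_ge0 (f w - g w); have := sqr_ge0 (f w); have := sqr_ge0 (g w); nra.
Qed.

Lemma L1_bmul M f g : measurable_fun setT f -> (forall w, `|f w| <= M) ->
  L1 g -> L1 (fun w => f w * g w).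
Proof.
move=> mf hM hg; apply: (L1_le (g := fun w => M * `|g w|)).
- by apply: measurable_funM => //; exact: L1_measurable.
- exact/L1Z/L1_norm.
- by move=> w; rewrite normrM ler_wpM2r.
Qed.

Lemma L1_sqrD f g : measurable_fun setT f -> measurable_fun setT g ->
  L1 (fun w => f w ^+ 2) -> L1 (fun w => g w ^+ 2) ->
  L1 (fun w => (f w + g w) ^+ 2).
Proof.
move=> mf mg hf hg.
apply: (L1_ext (f := fun w => f w ^+ 2 + 2 * (f w * g w) + g w ^+ 2)).
  by move=> w; ring.
by apply: L1D => //; apply: L1D => //; apply: L1Z; exact: L1_mul.
Qed.

Lemma L1_sqr f : measurable_fun setT f -> L1 (fun w => f w ^+ 2) -> L1 f.
Proof.
move=> mf hf; apply: (L1_ext (f := fun w => 1 * f w)) => [w|]; first by rewrite mul1r.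
apply: L1_mul => //; apply: (L1_ext (f := cst 1)) (L1_cst _) => w.
by rewrite /= expr1n.
Qed.

Lemma E_cst c : \int[P]_w (cst c w) = c.
Proof.
rewrite Rintegral_cst//= probability_setT/=.
by rewrite mulr1.
Qed.

Lemma E_D f g : L1 f -> L1 g ->
  \int[P]_w (f w + g w) = \int[P]_w f w + \int[P]_w g w.
Proof. by move=> hf hg; rewrite RintegralD. Qed.

Lemma E_B f g : L1 f -> L1 g ->
  \int[P]_w (f w - g w) = \int[P]_w f w - \int[P]_w g w.
Proof. by move=> hf hg; rewrite RintegralB. Qed.

Lemma E_Z c f : L1 f -> \int[P]_w (c * f w) = c * \int[P]_w f w.
Proof. by move=> hf; rewrite RintegralZl. Qed.

Lemma E_ext f g : f =1 g -> \int[P]_w f w = \int[P]_w g w.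
Proof. by move=> /funext ->. Qed.

Lemma E_sum (I : Type) (s : seq I) (Q : pred I) (F : I -> Omega -> R) :
  (forall i, Q i -> L1 (F i)) ->
  \int[P]_w (\sum_(i <- s | Q i) F i w) = \sum_(i <- s | Q i) \int[P]_w F i w.
Proof.
move=> h; elim: s => [|i s IH].
  by rewrite big_nil -[RHS](E_cst 0); apply: E_ext => w; rewrite big_nil.
rewrite big_cons -IH; case: ifP => Qi.
  rewrite -E_D; [|exact: h|exact: L1_sum].
  by apply: E_ext => w; rewrite big_cons Qi.
by apply: E_ext => w; rewrite big_cons Qi.
Qed.

Lemma E_le f g : L1 f -> L1 g -> (forall w, f w <= g w) ->
  \int[P]_w f w <= \int[P]_w g w.
Proof. by move=> hf hg h; apply: le_Rintegral. Qed.

Lemma E_norm f : L1 f -> `|\int[P]_w f w| <= \int[P]_w `|f w|.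
Proof. by move=> hf; apply: le_normr_Rintegral. Qed.

Lemma E_ge0 f : (forall w, 0 <= f w) -> 0 <= \int[P]_w f w.
Proof. by move=> h; apply: Rintegral_ge0. Qed.

Lemma E_fin f : L1 f -> (\int[P]_w (f w)%:E = (\int[P]_w f w)%:E)%E.
Proof.
by move=> hf; rewrite /Rintegral fineK//; apply: integrable_fin_num.
Qed.

Lemma E_ae f g : measurable_fun setT f -> measurable_fun setT g ->
  {ae P, forall w, f w = g w} ->
  \int[P]_w f w = \int[P]_w g w.
Proof.
move=> mf mg h; rewrite /Rintegral; congr fine; apply: ae_eq_integral => //.
- exact/measurable_EFinP.
- exact/measurable_EFinP.
- by apply: filterS h => w /= ->.
Qed.

Lemma E_markov f e : 0 < e -> L1 f -> (forall w, 0 <= f w) ->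
  (P [set w | (e < f w)%R] <= (\int[P]_w f w / e)%:E)%E.
Proof.
move=> e0 hf f0.
have mf := L1_measurable hf.
have mA : measurable [set w | e < f w].
  have -> : [set w | e < f w] = setT `&` f @^-1` `]e, +oo[%classic.
    by rewrite setTI; apply/seteqP; split => w /=; rewrite in_itv/= andbT.
  exact: mf.
have h1 : L1 (fun w => e * \1_[set w | e < f w] w).
  by apply: L1Z; exact: integrable_indic.
have : \int[P]_w (e * \1_[set w | e < f w] w) <= \int[P]_w f w.
  apply: E_le => // w; rewrite indicE.
  by case: (boolP (w \in _)) => [/set_mem/= /ltW|]; rewrite ?mulr1 ?mulr0.
have -> : P [set w | e < f w] = (\int[P]_w \1_[set w | e < f w] w)%:E.
  rewrite -E_fin; last exact: integrable_indic.
  by rewrite integral_indic// setIT.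
rewrite E_Z; last exact: integrable_indic.
by rewrite lee_fin ler_pdivlMr// mulrC.
Qed.

Lemma E_indic (A : set Omega) : measurable A ->
  (\int[P]_w \1_A w)%:E = P A.
Proof.
move=> mA; rewrite -E_fin; last exact: integrable_indic.
by rewrite integral_indic// setIT.
Qed.

Lemma E_setI f (A : set Omega) : measurable A ->
  \int[P]_(w in A) f w = \int[P]_w (\1_A w * f w).
Proof.
move=> mA; rewrite Rintegral_mkcond; apply: E_ext => w.
by rewrite /patch indicE; case: ifP => _ /=; rewrite ?mul1r ?mul0r.
Qed.

Lemma L1_ae f g : measurable_fun setT g -> {ae P, forall w, f w = g w} ->
  L1 f -> L1 g.
Proof.
move=> mg h hf; have mf := L1_measurable hf.
apply/integrableP; split; first exact/measurable_EFinP.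
move/integrableP : hf => [_]; apply: le_lt_trans.
rewrite (ae_eq_integral (fun w => `|(f w)%:E|)%E)//.
- by apply: measurableT_comp => //; exact/measurable_EFinP.
- by apply: measurableT_comp => //; exact/measurable_EFinP.
- by apply: filterS h => w /= ->.
Qed.

Lemma E_dct (f_ : nat -> Omega -> R) f g :
  (forall n, measurable_fun setT (f_ n)) -> measurable_fun setT f ->
  (forall w, (fun n => f_ n w) @ \oo --> f w) ->
  L1 g -> (forall n w, `|f_ n w| <= g w) ->
  (fun n => \int[P]_w f_ n w) @ \oo --> \int[P]_w f w.
Proof.
move=> mf_ mf cf ig hg.
have if_ n : L1 (f_ n) by exact: L1_le ig _.
have h1 : {ae P, forall w, setT w ->
    ((fun n => (f_ n w)%:E) @ \oo --> (f w)%:E)%E}.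
  by apply: aeW => w _; apply: cvg_EFin; [exact: nearW|exact: cf].
have h2 : {ae P, forall w, forall n, setT w -> (`|(f_ n w)%:E| <= (EFin \o g) w)%E}.
  by apply: aeW => w n _ /=; rewrite lee_fin.
have [i_f _ h3] := dominated_convergence measurableT
  (fun n => iffRL (measurable_EFinP _ _) (mf_ n)) (iffRL (measurable_EFinP _ _) mf)
  h1 ig h2.
by apply: fine_cvg; rewrite -E_fin.
Qed.

End expectation.
Arguments L1 {d Omega R} P f.

(** * Measurability with respect to a sub-sigma-algebra *)

Section sub_sigma_algebra.
Context d (Omega : measurableType d) (R : realType).
Implicit Types (G H : set (set Omega)) (f g : Omega -> R).

Definition sub_algebra G := sigma_algebra setT G /\ G `<=` measurable.

(** Gives access, for [sub_measurable], to the closure properties of measurable functions on [Omega]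
    equipped with [G]. *)
Lemma sub_measurableP G f : sigma_algebra setT G ->
  sub_measurable G f <->
  measurable_fun [set: g_sigma_algebraType G] (f : g_sigma_algebraType G -> R).
Proof.
move=> sG; split=> h.
  move=> _ B mB; rewrite setTI; apply: sub_sigma_algebra; exact: h.
move=> B mB; have := h measurableT B mB.
by rewrite setTI /measurable/= sigma_algebra_id.
Qed.

Lemma sub_measurable_fun G f : sub_algebra G -> sub_measurable G f ->
  measurable_fun setT f.
Proof. by move=> [_ GM] h _ B mB; rewrite setTI; exact/GM/h. Qed.

Lemma sub_measurable_mono G H f : G `<=` H -> sub_measurable G f ->
  sub_measurable H f.
Proof. by move=> GH h B mB; exact/GH/h. Qed.

Lemma sub_measurable_cst G c : sub_algebra G -> sub_measurable G (cst c : Omega -> R).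
Proof. by move=> [sG _]; apply/sub_measurableP. Qed.

Lemma sub_measurableD G f g : sub_algebra G -> sub_measurable G f ->
  sub_measurable G g -> sub_measurable G (fun w => f w + g w).
Proof.
move=> [sG _] /(sub_measurableP _ sG) hf /(sub_measurableP _ sG) hg.
by apply/sub_measurableP => //; exact: measurable_funD.
Qed.

Lemma sub_measurableB G f g : sub_algebra G -> sub_measurable G f ->
  sub_measurable G g -> sub_measurable G (fun w => f w - g w).
Proof.
move=> [sG _] /(sub_measurableP _ sG) hf /(sub_measurableP _ sG) hg.
by apply/sub_measurableP => //; exact: measurable_funB.
Qed.

Lemma sub_measurableM G f g : sub_algebra G -> sub_measurable G f ->
  sub_measurable G g -> sub_measurable G (fun w => f w * g w).
Proof.
move=> [sG _] /(sub_measurableP _ sG) hf /(sub_measurableP _ sG) hg.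
by apply/sub_measurableP => //; exact: measurable_funM.
Qed.

Lemma sub_measurableZ G c f : sub_algebra G -> sub_measurable G f ->
  sub_measurable G (fun w => c * f w).
Proof. by move=> sG hf; apply: sub_measurableM => //; exact: sub_measurable_cst. Qed.

Lemma sub_measurable_comp G (phi : R -> R) f : measurable_fun setT phi ->
  sub_measurable G f -> sub_measurable G (fun w => phi (f w)).
Proof.
move=> mphi hf B mB; apply: (hf (phi @^-1` B)).
by rewrite -[X in measurable X]setTI; exact: mphi.
Qed.

Lemma sub_measurable_sum G (I : Type) (s : seq I) (Q : pred I) (F : I -> Omega -> R) :
  sub_algebra G -> (forall i, Q i -> sub_measurable G (F i)) ->
  sub_measurable G (fun w => \sum_(i <- s | Q i) F i w).
Proof.
move=> sG h; elim: s => [|i s IH].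
  have -> : (fun w => \sum_(i <- [::] | Q i) F i w) = cst 0.
    by apply/funext => w; rewrite big_nil.
  exact: sub_measurable_cst.
have -> : (fun w => \sum_(i <- i :: s | Q i) F i w) = (fun w =>
  (if Q i then F i w else 0) + \sum_(j <- s | Q j) F j w).
  by apply/funext => w; rewrite big_cons; case: ifP => //; rewrite add0r.
apply: sub_measurableD => //; case: (boolP (Q i)) => [/h//|_].
exact: sub_measurable_cst.
Qed.

Lemma sub_measurable_indic G (A : set Omega) : sub_algebra G -> G A ->
  sub_measurable G (\1_A : Omega -> R).
Proof.
move=> [sG _] GA; apply/sub_measurableP => //.
apply: (@measurable_indic _ (g_sigma_algebraType G) R setT A).
exact: sub_sigma_algebra.
Qed.

Lemma sub_measurable_lt G f g : sub_algebra G -> sub_measurable G f ->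
  sub_measurable G g -> G [set w | f w < g w].
Proof.
move=> [sG _] /(sub_measurableP _ sG) hf /(sub_measurableP _ sG) hg.
have -> : [set w | f w < g w] = setT `&` (fun w => f w < g w) @^-1` [set true].
  by rewrite setTI; apply/seteqP; split => w.
have := measurable_fun_ltr hf hg measurableT (Y := [set true]).
by rewrite /measurable/= sigma_algebra_id//; apply.
Qed.

Lemma sub_measurable_le G f g : sub_algebra G -> sub_measurable G f ->
  sub_measurable G g -> G [set w | f w <= g w].
Proof.
move=> [sG _] /(sub_measurableP _ sG) hf /(sub_measurableP _ sG) hg.
have -> : [set w | f w <= g w] = setT `&` (fun w => f w <= g w) @^-1` [set true].
  by rewrite setTI; apply/seteqP; split => w.
have := measurable_fun_ler hf hg measurableT (Y := [set true]).
by rewrite /measurable/= sigma_algebra_id//; apply.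
Qed.

Lemma sub_measurable_max G f g : sub_algebra G -> sub_measurable G f ->
  sub_measurable G g -> sub_measurable G (fun w => Num.max (f w) (g w)).
Proof.
move=> [sG _] /(sub_measurableP _ sG) hf /(sub_measurableP _ sG) hg.
by apply/sub_measurableP => //; exact: measurable_maxr.
Qed.

Lemma sub_measurable_min G f g : sub_algebra G -> sub_measurable G f ->
  sub_measurable G g -> sub_measurable G (fun w => Num.min (f w) (g w)).
Proof.
move=> [sG _] /(sub_measurableP _ sG) hf /(sub_measurableP _ sG) hg.
by apply/sub_measurableP => //; exact: measurable_minr.
Qed.

End sub_sigma_algebra.

(** * Existence, positivity and pull-out for conditional expectations *)

Section conditional_expectation.
Context d (Omega : measurableType d) (R : realType) (P : probability Omega R).
Implicit Types (G H : set (set Omega)) (X Y Z f g : Omega -> R).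

(** Seen as a map between two measurable spaces, the identity makes the restriction of [P] to [G] an
    image measure. *)
Definition coarsen G : Omega -> g_sigma_algebraType G := id.

Lemma measurable_coarsen G : sub_algebra G -> measurable_fun setT (@coarsen G).
Proof.
move=> [sG GM] _ B; rewrite /measurable/= sigma_algebra_id// => GB.
by rewrite setTI; exact: GM.
Qed.

(** The charge [A |-> E[X; A]], pushed to the coarsened space, is dominated by the restriction of
    [P]; its Radon-Nikodym derivative is the required version. *)
Lemma is_cond_exp_exists G X : sub_algebra G -> L1 P X ->
  exists Z, is_cond_exp P G X Z.
Proof.
move=> sG iX; have mc := measurable_coarsen sG.
pose cf : {mfun Omega >-> g_sigma_algebraType G} :=
  HB.pack (@coarsen G) (isMeasurableFun.Build _ _ _ _ (@coarsen G) mc).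
pose nu1 : {charge set _ -> \bar R} := pushforward (induced_charge iX) cf.
pose nu := nu1 mc.
pose mu : probability _ R := distribution P cf.
have numu : nu `<< mu.
  apply/null_content_dominatesP => A mA.
  have mA' : measurable (cf @^-1` A).
    by case: sG => [sG0 GM]; apply: GM; move: mA; rewrite /measurable/= sigma_algebra_id.
  move=> muA; have mX := measurable_int _ iX.
  apply: (null_set_integral mA' _ muA); exact: measurable_funTS.
pose Z := fine \o Radon_Nikodym nu mu.
exists Z.
have iZ : mu.-integrable setT (EFin \o Z).
  apply: eq_integrable (Radon_Nikodym_integrable numu) => //.
  by move=> x _; rewrite /= fineK//; exact: Radon_Nikodym_fin_num.
have mZ : measurable_fun setT (EFin \o Z : g_sigma_algebraType G -> _).
  exact: measurable_int iZ.
have sZ : sub_measurable G Z.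
  by apply/sub_measurableP; [case: sG|exact/measurable_EFinP].
have iZ' : P.-integrable setT (EFin \o Z).
  move/integrableP : iZ => [_].
  rewrite ge0_integral_distribution//; last exact/measurableT_comp.
  move=> h; apply/integrableP; split => //.
  exact/measurable_EFinP/(sub_measurable_fun sG).
split => // A GA.
  have mA : measurable (A : set (g_sigma_algebraType G)) by exact: sub_sigma_algebra.
  have := Radon_Nikodym_integral numu mA.
  rewrite {1}/nu/= /pushforward/= /induced_charge => ->.
  transitivity (\int[mu]_(x in A) (Z x)%:E)%E; last first.
    apply: eq_integral => x _; rewrite fineK//; exact: Radon_Nikodym_fin_num.
  rewrite integral_pushforward//.
  have sA : measurable (cf @^-1` A) by case: sG => _; apply.
  have -> : cf @^-1` A = A by [].
  exact: (integrableS measurableT).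
Qed.

Lemma cond_expP G X : sub_algebra G -> L1 P X ->
  is_cond_exp P G X (cond_exp P G X).
Proof.
move=> sG iX; have [Z hZ] := is_cond_exp_exists sG iX.
by rewrite /cond_exp; case: xgetP => [Y _ hY//|/(_ Z)].
Qed.

Lemma is_cond_exp_L1 G X Z : is_cond_exp P G X Z -> L1 P Z.
Proof. by case. Qed.

Lemma is_cond_exp_indic G X Z A : sub_algebra G -> is_cond_exp P G X Z -> G A ->
  \int[P]_w (\1_A w * X w) = \int[P]_w (\1_A w * Z w).
Proof.
move=> [_ GM] [_ _ h] GA.
by rewrite -!E_setI; [rewrite /Rintegral h|exact: GM|exact: GM].
Qed.

(** The sum counts the thresholds [h, 2h, ..., Kh] that [y] reaches, so it rounds [y] down to a
    multiple of [h], capped at [K h]. It serves to approximate a bounded function uniformly by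
    indicators of its level sets. *)
Lemma staircase (h y : R) K : 0 <= h -> 0 <= y ->
  let S := \sum_(i < K) h * ((i.+1%:R * h <= y)%R)%:R in
  (K%:R * h <= y -> S = K%:R * h) /\ (y < K%:R * h -> y - h <= S <= y).
Proof.
move=> h0 y0; elim: K => [|K [IH1 IH2]] /=.
  by rewrite big_ord0; split; rewrite ?mul0r// => /(le_lt_trans y0); rewrite ltxx.
rewrite big_ord_recr/=; have [hK|hK] := leP (K.+1%:R * h) y.
  split; last by [].
  move=> _; rewrite mulr1 IH1; first by rewrite -natr1; ring.
  by apply: le_trans hK; rewrite ler_wpM2r// ler_nat.
split=> [//|_]; rewrite mulr0 addr0.
have [h1|h1] := leP (K%:R * h) y; last exact: IH2.
rewrite IH1// h1 andbT lerBlDr; apply: ltW; apply: lt_le_trans hK _.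
by rewrite -natr1 mulrDl mul1r.
Qed.

Lemma eq0_of_le_invn (e C : R) :
  (forall N, `|e| <= N.+1%:R^-1 * C) -> e = 0.
Proof.
move=> h; apply/eqP; rewrite -normr_eq0 eq_le normr_ge0 andbT leNgt; apply/negP => e0.
have C0 : 0 <= C by have := h 0%N; rewrite invr1 mul1r; apply: le_trans.
have := archi_boundP (divr_ge0 C0 (normr_ge0 e)).
have := h (Num.bound (C / `|e|)); set N := Num.bound _.
rewrite ltr_pdivrMr// mulrC ler_pdivlMr ?ltr0Sn// -natr1 mulrDr mulr1 mulrC.
by move=> h1 h2; lra.
Qed.

(** [Y] is within [h] of a combination of indicators of its upper level sets. These lie in [G],
    where the identity is the definition of conditional expectation. The error is at most
    [h E|X - Z|], for every [h = 1 / (N + 1)]. *)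
Lemma pull_out (M : R) G X Y Z : sub_algebra G -> L1 P X -> is_cond_exp P G X Z ->
  sub_measurable G Y -> (forall w, `|Y w| <= M) ->
  \int[P]_w (Y w * X w) = \int[P]_w (Y w * Z w).
Proof.
move=> sG iX cXZ sY hY; have iZ := is_cond_exp_L1 cXZ.
have mY := sub_measurable_fun sG sY.
have M0 : 0 <= M by apply: le_trans (hY point).
pose D w := X w - Z w.
have iD : L1 P D by exact: L1B.
apply/eqP; rewrite -subr_eq0 -E_B; [|exact: L1_bmul hY _|exact: L1_bmul hY _].
rewrite (_ : (fun w => _) = (fun w => Y w * D w)); last first.
  by apply/funext => w; rewrite mulrBr.
have ED A : G A -> \int[P]_w (\1_A w * D w) = 0.
  move=> GA; rewrite (_ : (fun w => _) = (fun w => \1_A w * X w - \1_A w * Z w)); last first.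
    by apply/funext => w; rewrite mulrBr.
  have mA : measurable A by case: sG => _; apply.
  have b1 w : `|\1_A w| <= 1 :> R.
    by rewrite indicE; case: (_ \in _); rewrite ?normr1 ?normr0.
  rewrite E_B; [|exact: L1_bmul b1 _|exact: L1_bmul b1 _].
  by rewrite (is_cond_exp_indic sG cXZ)// subrr.
set e := \int[P]_w _.
have key N : `|e| <= N.+1%:R^-1 * \int[P]_w `|D w|.
  pose h : R := N.+1%:R^-1.
  have h0 : 0 < h by rewrite invr_gt0.
  (* [Y + M] takes its values in [0, 2M], so [K] levels of height [h] must reach beyond [2 * M]. *)
  pose K := Num.bound (2 * M / h).
  have KM : 2 * M < K%:R * h.
    rewrite -ltr_pdivrMr//.
    by apply: archi_boundP; rewrite divr_ge0// ?mulr_ge0// ltW.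
  pose A (i : nat) := [set w | i.+1%:R * h <= Y w + M].
  have GA i : G (A i).
    apply: (sub_measurable_le sG (f := cst (i.+1%:R * h))).
      exact: sub_measurable_cst.
    by apply: sub_measurableD => //; exact: sub_measurable_cst.
  have mA i : measurable (A i) by case: sG => _; apply; exact: GA.
  pose S w := \sum_(i < K) h * \1_(A i) w - M.
  have hS w : `|Y w - S w| <= h.
    have y0 : 0 <= Y w + M by rewrite -lerBlDr sub0r; have := hY w; rewrite ler_norml =>
      /andP[].
    have yK : Y w + M < K%:R * h.
      by apply: le_lt_trans KM; have := hY w; rewrite ler_norml => /andP[_]; lra.
    have [_ /(_ yK)] := staircase K (ltW h0) y0.
    rewrite (_ : \sum_(i < K) _ = S w + M); last first.
      rewrite /S subrK; apply: eq_bigr => i _; rewrite indicE; congr (_ * _%:R).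
      by congr nat_of_bool; apply/idP/idP => [hi|/set_mem//]; apply/mem_set.
    by move=> /andP[? ?]; rewrite ler_norml; apply/andP; split; lra.
  have mS : measurable_fun setT S.
    apply: measurable_funB => //; apply: measurable_sum => i.
    by apply: measurable_funM => //; exact: measurable_indic.
  have bS w : `|S w| <= M + h.
    by have := hS w; have := hY w; rewrite !ler_norml => /andP[? ?] /andP[? ?];
       apply/andP; split; lra.
  have ES : \int[P]_w (S w * D w) = 0.
    rewrite (_ : (fun w => _) =
      (fun w => \sum_(i < K) h * (\1_(A i) w * D w) - M * D w)); last first.
      apply/funext => w; rewrite mulrBl mulr_suml; congr (_ - _).
      by apply: eq_bigr => i _; rewrite mulrA.
    have b1 i w : `|\1_(A i) w| <= 1 :> R.
      by rewrite indicE; case: (_ \in _); rewrite ?normr1 ?normr0.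
    have iA i : L1 P (fun w => \1_(A i) w * D w) by exact: L1_bmul (b1 i) _.
    rewrite E_B; last 2 first.
    - by apply: L1_sum => i _; exact: L1Z.
    - exact: L1Z.
    rewrite E_sum; last by move=> i _; exact: L1Z.
    rewrite big1; last by move=> i _; rewrite E_Z// ED// mulr0.
    rewrite E_Z// (_ : \int[P]_w D w = 0) ?mulr0 ?subrr//.
    rewrite -(ED setT); last by have [[? h1 ?] _] := sG; rewrite -(setD0 setT); apply: h1.
    by apply: E_ext => w; rewrite indicT mul1r.
  rewrite -[e]subr0 -ES -E_B; [|exact: L1_bmul hY _|exact: L1_bmul bS _].
  apply: le_trans (E_norm _) _.
    by apply: L1B; [exact: L1_bmul hY _|exact: L1_bmul bS _].
  rewrite -E_Z; last exact: L1_norm.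
  apply: E_le.
  - by apply/L1_norm/L1B; [exact: L1_bmul hY _|exact: L1_bmul bS _].
  - exact/L1Z/L1_norm.
  - by move=> w; rewrite -mulrBl normrM ler_wpM2r.
exact/eqP/(eq0_of_le_invn key).
Qed.

(** The set [A = {Z < 0}] lies in [G], so the integral of [Z] over it equals that of [X] and is
    nonnegative. Hence [- Z], positive on [A], has integral 0 there, and [A] is null. *)
Lemma is_cond_exp_ge0 G X Z : sub_algebra G -> L1 P X -> is_cond_exp P G X Z ->
  (forall w, 0 <= X w) -> {ae P, forall w, 0 <= Z w}.
Proof.
move=> sG iX cXZ X0; have iZ := is_cond_exp_L1 cXZ.
have [sZ _ _] := cXZ.
pose A := [set w | Z w < 0].
have GA : G A.
  by apply: (sub_measurable_lt sG sZ (g := cst 0)); exact: sub_measurable_cst.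
have mA : measurable A by case: sG => _; apply.
pose f w := \1_A w * - Z w.
have f0 w : 0 <= f w.
  rewrite /f indicE; have [/set_mem/= h|_] := boolP (w \in A); last by rewrite mul0r.
  by rewrite mul1r oppr_ge0 ltW.
have b1 w : `|\1_A w| <= 1 :> R.
  by rewrite indicE; case: (_ \in _); rewrite ?normr1 ?normr0.
have if_ : L1 P f.
  apply: L1_bmul b1 _; first exact: measurable_indic.
  by apply: (L1_ext (f := fun w => -1 * Z w)) (L1Z _ iZ) => w; rewrite mulN1r.
have Ef : \int[P]_w f w = 0.
  apply/eqP; rewrite eq_le; apply/andP; split; last exact: E_ge0.
  rewrite (_ : f = fun w => -1 * (\1_A w * Z w)); last first.
    by apply/funext => w; rewrite /f mulN1r mulrN.
  rewrite E_Z; last exact: L1_bmul b1 _.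
  rewrite -(is_cond_exp_indic sG cXZ)// mulN1r oppr_le0.
  by apply: E_ge0 => w; rewrite mulr_ge0// indicE.
have mf := L1_measurable if_.
have h : {ae P, forall w, setT w -> (f w)%:E = 0%E}.
  apply/(ae_eq_integral_abs P measurableT (f := EFin \o f)).
    exact/measurable_EFinP.
  rewrite (eq_integral (fun w => (f w)%:E)); last first.
    by move=> w _ /=; rewrite ger0_norm.
  by rewrite E_fin// Ef.
apply: filterS h => w /(_ I) [hw].
rewrite leNgt; apply/negP => Zw.
move: hw; rewrite /f indicE mem_set// mul1r => /eqP; rewrite oppr_eq0 => /eqP Z0.
by move: Zw; rewrite Z0 ltxx.
Qed.

Lemma is_cond_exp_ae G X Z Z' : sub_algebra G -> is_cond_exp P G X Z ->
  sub_measurable G Z' -> {ae P, forall w, Z w = Z' w} -> is_cond_exp P G X Z'.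
Proof.
move=> sG [sZ iZ h] sZ' ae.
have mZ := sub_measurable_fun sG sZ; have mZ' := sub_measurable_fun sG sZ'.
split=> // [|A GA].
  exact: (L1_ae mZ' ae iZ).
rewrite -h//; apply: ae_eq_integral => //.
- by case: sG => _; apply.
- exact/measurable_funTS/measurable_EFinP.
- exact/measurable_funTS/measurable_EFinP.
- by apply: filterS ae => w /= ->.
Qed.

Lemma is_cond_expD G X X' Z Z' : sub_algebra G -> L1 P X -> L1 P X' ->
  is_cond_exp P G X Z -> is_cond_exp P G X' Z' ->
  is_cond_exp P G (fun w => X w + X' w) (fun w => Z w + Z' w).
Proof.
move=> sG iX iX' [sZ iZ h] [sZ' iZ' h'].
have mA A : G A -> measurable A by case: sG => _; apply.
split; [exact: sub_measurableD|exact: L1D|move=> A GA].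
under eq_integral do rewrite EFinD.
under [RHS]eq_integral do rewrite EFinD.
by rewrite !integralD ?h ?h'//; try exact: mA;
   apply: (integrableS measurableT) => //; exact: mA.
Qed.

Lemma is_cond_exp_bmul (M : R) G X Y Z : sub_algebra G -> L1 P X ->
  is_cond_exp P G X Z -> sub_measurable G Y -> (forall w, `|Y w| <= M) ->
  is_cond_exp P G (fun w => Y w * X w) (fun w => Y w * Z w).
Proof.
move=> sG iX cXZ sY hY; have [sZ iZ _] := cXZ.
have mY := sub_measurable_fun sG sY.
split; [exact: sub_measurableM|exact: L1_bmul hY _|move=> A GA].
have mA : measurable A by case: sG => _; apply.
have b1 w : `|\1_A w| <= 1 :> R.
  by rewrite indicE; case: (_ \in _); rewrite ?normr1 ?normr0.
have b2 w : `|\1_A w * Y w| <= M.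
  by rewrite normrM -[M]mul1r; apply: ler_pM.
have fin f : L1 P f -> (\int[P]_(w in A) (f w)%:E)%E = (\int[P]_w (\1_A w * f w))%:E.
  move=> if_; rewrite -E_setI// /Rintegral fineK//; apply: integrable_fin_num => //.
  exact: (integrableS measurableT).
rewrite !fin; [|exact: L1_bmul hY _|exact: L1_bmul hY _].
congr EFin; under E_ext do rewrite mulrA; under [RHS]E_ext do rewrite mulrA.
by symmetry; apply: (pull_out sG iX cXZ) b2; apply: sub_measurableM => //;
  exact: sub_measurable_indic.
Qed.

Lemma is_cond_expZ (c : R) G X Z : sub_algebra G -> L1 P X ->
  is_cond_exp P G X Z -> is_cond_exp P G (fun w => c * X w) (fun w => c * Z w).
Proof.
move=> sG iX cXZ; apply: (is_cond_exp_bmul (M := `|c|) sG iX cXZ) => //.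
exact: sub_measurable_cst.
Qed.

(** [Y] is truncated to [|Y| <= n], where [pull_out] applies, and dominated convergence with [|Y X|]
    removes the truncation. This is the source of the orthogonality of martingale increments. *)
Lemma pull_out0_L2 G X Y : sub_algebra G -> measurable_fun setT X ->
  L1 P (fun w => X w ^+ 2) -> is_cond_exp P G X (cst 0) ->
  sub_measurable G Y -> L1 P (fun w => Y w ^+ 2) ->
  \int[P]_w (Y w * X w) = 0.
Proof.
move=> sG mX iX2 cX sY iY2.
have mY := sub_measurable_fun sG sY.
have iX : L1 P X by exact: L1_sqr.
pose A (n : nat) := [set w | `|Y w| <= n%:R].
have GA n : G (A n).
  apply: (sub_measurable_le sG (g := cst n%:R)); last exact: sub_measurable_cst.
  exact: (sub_measurable_comp (phi := Num.norm)).
have mA n : measurable (A n) by case: sG => _; apply; exact: GA.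
pose f n w := (\1_(A n) w * Y w) * X w.
have Ef n : \int[P]_w f n w = 0.
  rewrite (pull_out (M := n%:R) sG iX cX); last 2 first.
  - by apply: sub_measurableM => //; exact: sub_measurable_indic.
  - move=> w; rewrite indicE; have [/set_mem/=|] := boolP (w \in A n).
      by rewrite mul1r.
    by rewrite mul0r normr0.
  by rewrite -[RHS](E_cst P 0); apply: E_ext => w; rewrite mulr0.
have mf n : measurable_fun setT (f n).
  by do 2 apply: measurable_funM => //; exact: measurable_indic.
have iYX : L1 P (fun w => Y w * X w) by exact: L1_mul.
have h : (fun n => \int[P]_w f n w) @ \oo --> \int[P]_w (Y w * X w).
  apply: (E_dct mf (L1_measurable iYX) _ (L1_norm iYX)).
    move=> w; apply: cvg_near_cst.
    exists (Num.bound `|Y w|) => // n /= hn.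
    rewrite /f indicE mem_set ?mul1r//=.
    by apply/ltW/(lt_le_trans (archi_boundP (normr_ge0 _))); rewrite ler_nat.
  move=> n w; rewrite /f indicE; case: (_ \in _); first by rewrite mul1r.
  by rewrite !mul0r normr0.
rewrite -(cvg_lim (@Rhausdorff R) h); apply/lim_near_cst => //.
by apply: nearW.
Qed.

End conditional_expectation.

(** * The martingale central limit theorem *)

Section trigonometric_bounds.
Context (R : realType).
Implicit Types x a s : R.

(** Starting from [1 - cos >= 0], repeated use yields the alternating Taylor bounds of sine and
    cosine up to order 4: each difference is the derivative of the next one. *)
Lemma ge0_of_derive_ge0 (f f' : R -> R) x : f 0 = 0 -> 0 <= x ->
  (forall t, is_derive t (1 : R) f (f' t)) -> (forall t, 0 <= t -> 0 <= f' t) ->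
  0 <= f x.
Proof.
move=> f0 x0 df h; rewrite -f0.
have [->//|xn0] := eqVneq x 0.
have x0' : 0 < x by rewrite lt_neqAle eq_sym xn0.
have cf : {within `[0, x], continuous f}.
  apply: continuous_subspaceT => t; apply: differentiable_continuous.
  exact/derivable1_diffP/(@ex_derive _ _ _ _ _ _ _ (df t)).
have [c] := MVT x0' (fun t _ => df t) cf.
rewrite in_itv/= => /andP[c0 _] e.
by rewrite -subr_ge0 e mulr_ge0 ?h// ?subr0// ltW.
Qed.

Lemma sin_le x : 0 <= x -> sin x <= x.
Proof.
move=> x0; rewrite -subr_ge0.
apply: (ge0_of_derive_ge0 (f := fun t => t - sin t) (f' := fun t => 1 - cos t)) => //.
- by rewrite sin0 subr0.
Qed.

Lemma cos_ge x : 0 <= x -> 0 <= cos x - 1 + x ^+ 2 / 2.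
Proof.
move=> x0.
apply: (ge0_of_derive_ge0 (f := fun t => cos t - 1 + t ^+ 2 / 2)
  (f' := fun t => t - sin t)) => //.
- by rewrite cos0 expr0n/= mul0r addr0 subrr.
- move=> t; apply: is_derive_eq; by rewrite /GRing.scale/=; field.
- by move=> t t0; rewrite subr_ge0 sin_le.
Qed.

Lemma sin_ge x : 0 <= x -> 0 <= sin x - x + x ^+ 3 / 6.
Proof.
move=> x0.
apply: (ge0_of_derive_ge0 (f := fun t => sin t - t + t ^+ 3 / 6)
  (f' := fun t => cos t - 1 + t ^+ 2 / 2)) => //.
- by rewrite sin0 expr0n/= mul0r addr0 subrr.
- move=> t; apply: is_derive_eq; by rewrite /GRing.scale/=; field.
- by move=> t t0; exact: cos_ge.
Qed.

Lemma cos_le x : 0 <= x -> 0 <= 1 - x ^+ 2 / 2 + x ^+ 4 / 24 - cos x.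
Proof.
move=> x0.
apply: (ge0_of_derive_ge0 (f := fun t => 1 - t ^+ 2 / 2 + t ^+ 4 / 24 - cos t)
  (f' := fun t => sin t - t + t ^+ 3 / 6)) => //.
- by rewrite cos0 !expr0n/= !mul0r addr0 subr0 subrr.
- move=> t; apply: is_derive_eq; by rewrite /GRing.scale/=; field.
- by move=> t t0; exact: sin_ge.
Qed.

(** The cubic bound serves for small increments, the quadratic one for large increments, where only
    second moments are available. *)
Lemma cos_taylor x : `|cos x - 1 + x ^+ 2 / 2| <= `|x| ^+ 3 /\
  `|cos x - 1 + x ^+ 2 / 2| <= x ^+ 2.
Proof.
wlog x0 : x / 0 <= x => [h|].
  have [/h//|/ltW] := leP 0 x; rewrite -oppr_ge0 => /h.
  by rewrite cosN sqrrN normrN.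
have h1 := cos_ge x0; have h2 := cos_le x0; have h3 := cos_le1 x.
rewrite !ger0_norm//; split; last by have := sqr_ge0 x; lra.
have [x1|x1] := leP x 1.
  have x3 : 0 <= x ^+ 3 by exact: exprn_ge0.
  have : x ^+ 4 <= x ^+ 3 by apply: ler_wiXn2l.
  by lra.
have : x ^+ 2 <= x ^+ 3 by apply: ler_weXn2l => //; exact: ltW.
by have := sqr_ge0 x; lra.
Qed.

Lemma sin_taylor x : `|sin x - x| <= `|x| ^+ 3 /\ `|sin x - x| <= 2 * x ^+ 2.
Proof.
wlog x0 : x / 0 <= x => [h|].
  have [/h//|/ltW] := leP 0 x; rewrite -oppr_ge0 => /h.
  by rewrite sinN -opprD !normrN sqrrN.
have h1 := sin_ge x0; have h2 := sin_le x0.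
rewrite distrC !ger0_norm ?subr_ge0//.
have x3 : 0 <= x ^+ 3 by exact: exprn_ge0.
split; first by lra.
have [x1|x1] := leP x 1.
  have : x ^+ 3 <= x ^+ 2 by apply: ler_wiXn2l.
  by have := sqr_ge0 x; lra.
have : x <= x ^+ 2 by rewrite expr2 ler_peMl// ltW.
have := sin_geN1 x; lra.
Qed.

(** Increments of size at most [e] leave a cubic error, hence a multiple of [e * x ^+ 2]. Larger
    ones leave a multiple of the truncated square, which is what a Lindeberg condition controls. *)
Lemma cosD_taylor e a x : 0 <= e ->
  `|cos (a + x) - cos a + x * sin a + x ^+ 2 / 2 * cos a| <=
    2 * e * x ^+ 2 + 3 * (x ^+ 2 * (e < `|x|)%R%:R).
Proof.
move=> e0.
rewrite (_ : _ + _ * cos a =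
  cos a * (cos x - 1 + x ^+ 2 / 2) - sin a * (sin x - x)); last first.
  by rewrite cosD; field.
apply: le_trans (ler_normB _ _) _; rewrite !normrM.
have [c1 c2] := cos_taylor x; have [s1 s2] := sin_taylor x.
have ca : `|cos a| <= 1 by rewrite ler_norml cos_geN1 cos_le1.
have sa : `|sin a| <= 1 by rewrite ler_norml sin_geN1 sin_le1.
have H1 : `|cos a| * `|cos x - 1 + x ^+ 2 / 2| <= `|cos x - 1 + x ^+ 2 / 2|.
  by rewrite ler_piMl.
have H2 : `|sin a| * `|sin x - x| <= `|sin x - x| by rewrite ler_piMl.
have x2 := sqr_ge0 x.
have [xe|xe] := ltP e `|x|.
  rewrite mulr1; have : 0 <= 2 * e * x ^+ 2 by rewrite mulr_ge0// mulr_ge0.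
  by lra.
have : `|x| ^+ 3 <= e * x ^+ 2.
  by rewrite exprS real_normK ?num_real// ler_wpM2r.
by rewrite mulr0 mulr0 addr0; lra.
Qed.

Lemma expRN_taylor s : 0 <= s -> `|expR (- (s / 2)) - 1 + s / 2| <= s ^+ 2.
Proof.
move=> s0; have h1 := expR_ge1Dx (- (s / 2)); have h2 := expR_ge1Dx (s / 2).
have p : 0 < 1 + s / 2 by lra.
have h3 : expR (- (s / 2)) <= (1 + s / 2)^-1.
  by rewrite expRN lef_pV2 ?posrE ?expR_gt0.
have h4 : (1 + s / 2)^-1 <= 1 - s / 2 + s ^+ 2 / 4.
  rewrite -[leLHS]mul1r ler_pdivrMr//.
  have : 0 <= s ^+ 3 by exact: exprn_ge0.
  rewrite (_ : (1 - _ + _) * _ = 1 + s ^+ 3 / 8); last by field.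
  by lra.
have := sqr_ge0 s.
by rewrite ger0_norm; lra.
Qed.

End trigonometric_bounds.

Definition tail_sqr (R : realType) (e x : R) : R := x ^+ 2 * (e < `|x|)%R%:R.

Lemma tail_sqr_ge0 (R : realType) (e x : R) : 0 <= tail_sqr e x.
Proof. by rewrite mulr_ge0// sqr_ge0. Qed.

Lemma tail_sqr_le (R : realType) (e x : R) : tail_sqr e x <= x ^+ 2.
Proof. by rewrite ler_piMr ?sqr_ge0//; case: (_ < _). Qed.

Lemma measurable_tail_sqr d (Omega : measurableType d) (R : realType) (e : R)
  (X : Omega -> R) : measurable_fun setT X ->
  measurable_fun setT (fun w => tail_sqr e (X w)).
Proof.
move=> mX; apply: measurable_funM; first exact: measurable_funX.
rewrite (_ : (fun w => _) = \1_[set w | e < `|X w|]); last first.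
  apply/funext => w; rewrite indicE; congr (nat_of_bool _)%:R.
  by apply/idP/idP => [h|/set_mem//]; exact/mem_set.
apply: measurable_indic.
rewrite (_ : [set w | _] = setT `&` (fun w => `|X w|) @^-1` `]e, +oo[%classic); last first.
  by rewrite setTI; apply/seteqP; split => w /=; rewrite in_itv/= andbT.
have mN : measurable_fun setT (fun w => `|X w|) by exact: measurableT_comp.
exact: mN.
Qed.

Lemma L1_tail_sqr d (Omega : measurableType d) (R : realType)
  (P : probability Omega R) (e : R) (X : Omega -> R) : measurable_fun setT X ->
  L1 P (fun w => X w ^+ 2) -> L1 P (fun w => tail_sqr e (X w)).
Proof.
move=> mX iX; apply: (L1_le _ iX); first exact: measurable_tail_sqr.
by move=> w; rewrite ger0_norm ?tail_sqr_ge0// tail_sqr_le.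
Qed.

(** * Martingale differences and one step of the telescoping *)

Section martingale_differences.
Context d (Omega : measurableType d) (R : realType) (P : probability Omega R).
Variable F : nat -> set (set Omega).
Hypothesis sF : forall k, sub_algebra (F k).
Hypothesis FS : forall k, F k `<=` F k.+1.
Implicit Types (X Y : Omega -> R).

Definition mdiff k X := [/\ sub_measurable (F k) X, L1 P (fun w => X w ^+ 2) &
  is_cond_exp P (F k.-1) X (cst 0)].

Lemma filtration_le j k : (j <= k)%N -> F j `<=` F k.
Proof.
move=> /subnK <-; elim: (k - j)%N => [//|i IH]; apply: subset_trans IH _.
by rewrite addSn; exact: FS.
Qed.

Lemma mdiff_measurable k X : mdiff k X -> measurable_fun setT X.
Proof. by case=> h _ _; exact: sub_measurable_fun h. Qed.

Lemma mdiff_L1 k X : mdiff k X -> L1 P X.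
Proof. by move=> h; apply: L1_sqr; [exact: mdiff_measurable h|case: h]. Qed.

Lemma mdiffZ k c X : mdiff k X -> mdiff k (fun w => c * X w).
Proof.
move=> h; have [h1 h2 h3] := h; split.
- exact: sub_measurableZ.
- by apply: (L1_ext (f := fun w => c ^+ 2 * X w ^+ 2)) (L1Z _ h2) => w; rewrite exprMn.
- have := is_cond_expZ c (sF _) (mdiff_L1 h) h3.
  by rewrite (_ : (fun w => c * cst 0 w) = cst 0)//; apply/funext => w /=; rewrite mulr0.
Qed.

Lemma mdiffD k X Y : mdiff k X -> mdiff k Y -> mdiff k (fun w => X w + Y w).
Proof.
move=> h h'; have [h1 h2 h3] := h; have [h1' h2' h3'] := h'; split.
- exact: sub_measurableD.
- by apply: L1_sqrD => //; [exact: mdiff_measurable h|exact: mdiff_measurable h'].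
- have := is_cond_expD (sF _) (mdiff_L1 h) (mdiff_L1 h') h3 h3'.
  by rewrite (_ : (fun w => cst 0 w + cst 0 w) = cst 0)//; apply/funext => w /=; rewrite addr0.
Qed.

Lemma mdiff_bmul (M : R) k X Y : (0 < k)%N -> mdiff k X ->
  sub_measurable (F k.-1) Y -> (forall w, `|Y w| <= M) ->
  mdiff k (fun w => Y w * X w).
Proof.
move=> k0 h sY bY; have [h1 h2 h3] := h; split.
- apply: sub_measurableM => //; apply: sub_measurable_mono sY.
  exact: filtration_le (leq_pred _).
- apply: (L1_ext (f := fun w => Y w ^+ 2 * X w ^+ 2)) => [w|]; first by rewrite exprMn.
  apply: (L1_bmul (M := M ^+ 2)) => //.
    by apply: measurable_funX; exact: sub_measurable_fun sY.
  by move=> w; rewrite normrX ler_pXn2r ?nnegrE// (le_trans _ (bY w)).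
- have := is_cond_exp_bmul (sF _) (mdiff_L1 h) h3 sY bY.
  by rewrite (_ : (fun w => Y w * cst 0 w) = cst 0)//; apply/funext => w /=; rewrite mulr0.
Qed.

Lemma mdiff_sum_measurable (X : nat -> Omega -> R) n :
  (forall k, (1 <= k <= n)%N -> mdiff k (X k)) ->
  sub_measurable (F n) (fun w => \sum_(1 <= k < n.+1) X k w).
Proof.
move=> hX; under eq_fun do rewrite big_nat.
apply: sub_measurable_sum => // k kn; have [h _ _] := hX k kn.
by apply: sub_measurable_mono h; apply: filtration_le; case/andP: kn.
Qed.

(** The product of the past sum and the new increment integrates to 0 by [pull_out0_L2], so
    variances add. *)
Lemma mdiff_sum_L2 (X : nat -> Omega -> R) n :
  (forall k, (1 <= k <= n)%N -> mdiff k (X k)) ->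
  L1 P (fun w => (\sum_(1 <= k < n.+1) X k w) ^+ 2) /\
  \int[P]_w ((\sum_(1 <= k < n.+1) X k w) ^+ 2) =
    \sum_(1 <= k < n.+1) \int[P]_w (X k w ^+ 2).
Proof.
elim: n => [|n IH] hX.
  rewrite big_geq//; under eq_fun do rewrite big_geq// expr0n/=.
  by split; [exact: L1_cst|exact: E_cst].
have hX' k : (1 <= k <= n)%N -> mdiff k (X k).
  by move=> /andP[k1 kn]; apply: hX; rewrite k1 leqW.
have [IH1 IH2] := IH hX'.
have hn := hX n.+1 (leqnn _ : (1 <= n.+1 <= n.+1)%N).
have [h1 h2 h3] := hn.
have sS := mdiff_sum_measurable hX'.
have mS := sub_measurable_fun (sF _) sS.
have mX := mdiff_measurable hn.
have iSX := L1_mul mS mX IH1 h2.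
under eq_fun do rewrite big_nat_recr//=.
split; first exact: L1_sqrD.
rewrite big_nat_recr//= -IH2.
rewrite (_ : (fun w => _) = fun w => ((\sum_(1 <= k < n.+1) X k w) ^+ 2 +
   2 * ((\sum_(1 <= k < n.+1) X k w) * X n.+1 w)) + X n.+1 w ^+ 2); last first.
  by apply/funext => w; ring.
rewrite E_D//; last by apply: L1D => //; exact: L1Z.
rewrite E_D//; last exact: L1Z.
by rewrite E_Z// (pull_out0_L2 (sF n) mX h2 h3 sS IH1) mulr0 addr0.
Qed.

(* One step in telescoping [exp (V_k / 2) cos (S_k)], where [V_k] is the conditional
   variance: [A] is the past sum and [B] the exponential weight. *)
Lemma martingale_clt_step (C K e : R) (G : set (set Omega)) X s A B :
  sub_algebra G -> 0 <= e -> measurable_fun setT X ->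
  L1 P (fun w => X w ^+ 2) -> is_cond_exp P G X (cst 0) ->
  is_cond_exp P G (fun w => X w ^+ 2) s -> (forall w, 0 <= s w <= C) ->
  sub_measurable G A -> sub_measurable G B -> (forall w, 0 <= B w <= K) ->
  `|\int[P]_w (B w * (cos (A w + X w) - expR (- (s w / 2)) * cos (A w)))| <=
  K * ((2 * e + e ^+ 2) * \int[P]_w (X w ^+ 2) +
       (3 + C) * \int[P]_w tail_sqr e (X w)).
Proof.
move=> sG e0 mX iX2 cX cX2 hs sA sB hB.
have mA := sub_measurable_fun sG sA; have mB := sub_measurable_fun sG sB.
have [ss is_ _] := cX2; have ms := sub_measurable_fun sG ss.
have iX := L1_sqr mX iX2.
have mcos : measurable_fun setT (@cos R).
  by apply: continuous_measurable_fun; exact: continuous_cos.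
have msin : measurable_fun setT (@sin R).
  by apply: continuous_measurable_fun; exact: continuous_sin.
have bcos x : `|cos x| <= 1 :> R by rewrite ler_norml cos_geN1 cos_le1.
have bsin x : `|sin x| <= 1 :> R by rewrite ler_norml sin_geN1 sin_le1.
have B0 w : 0 <= B w by have /andP[] := hB w.
have BK w : B w <= K by have /andP[] := hB w.
have bB w : `|B w| <= K by rewrite ger0_norm.
have s0 w : 0 <= s w by have /andP[] := hs w.
have sC w : s w <= C by have /andP[] := hs w.
have iI := L1_tail_sqr e mX iX2.
(* [U] and [V] are the [G]-measurable coefficients of [X] and of [s - X ^+ 2] in the second-order
   expansion. Both of these terms integrate to 0, which leaves the remainder [Rm]. *)
pose U w := - B w * sin (A w).
pose V w := B w * cos (A w) / 2.
have sU : sub_measurable G U.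
  rewrite /U (_ : (fun w => _) = fun w => (-1 * B w) * sin (A w)); last first.
    by apply/funext => w; rewrite mulN1r.
  by apply: sub_measurableM => //; [exact: sub_measurableZ|exact: sub_measurable_comp sA].
have sV : sub_measurable G V.
  rewrite /V (_ : (fun w => _) = fun w => 2^-1 * (B w * cos (A w))); last first.
    by apply/funext => w; rewrite mulrC.
  by apply: sub_measurableZ => //; apply: sub_measurableM => //; exact: sub_measurable_comp sA.
have bU w : `|U w| <= K by rewrite /U normrM normrN -[K]mulr1 ler_pM.
have bV w : `|V w| <= K.
  rewrite /V normrM normrM [`|2^-1|]ger0_norm// ler_pdivrMr//.
  have := ler_pM (normr_ge0 _) (normr_ge0 _) (bB w) (bcos (A w)).
  by have := le_trans (B0 w) (BK w); lra.
have mU := sub_measurable_fun sG sU; have mV := sub_measurable_fun sG sV.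
pose Rm w := B w * ((cos (A w + X w) - cos (A w) + X w * sin (A w) + X w ^+ 2 / 2 * cos (A w))
   - (expR (- (s w / 2)) - 1 + s w / 2) * cos (A w)).
have iUX : L1 P (fun w => U w * X w) by exact: L1_bmul bU _.
have iVX : L1 P (fun w => V w * X w ^+ 2) by exact: L1_bmul bV _.
have iVs : L1 P (fun w => V w * s w) by exact: L1_bmul bV _.
pose W w := K * ((2 * e * X w ^+ 2 + 3 * tail_sqr e (X w)) + s w * s w).
have iss : L1 P (fun w => s w * s w).
  by apply: (L1_bmul (M := C)) => // w; rewrite ger0_norm.
have iW : L1 P W by apply/L1Z/L1D => //; apply: L1D; exact: L1Z.
have hR w : `|Rm w| <= W w.
  rewrite /Rm /W normrM ger0_norm//; apply: ler_pM => //.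
  apply: le_trans (ler_normB _ _) _; apply: lerD; first exact: cosD_taylor.
  rewrite normrM -expr2 -[leRHS]mulr1; apply: ler_pM => //; exact: expRN_taylor.
have mR : measurable_fun setT Rm.
  have mAX : measurable_fun setT (fun w => cos (A w + X w)).
    by apply: (measurableT_comp mcos); exact: measurable_funD.
  have mcA : measurable_fun setT (fun w => cos (A w)) by exact: measurableT_comp.
  have msA : measurable_fun setT (fun w => sin (A w)) by exact: measurableT_comp.
  have mX2 : measurable_fun setT (fun w => X w ^+ 2 / 2).
    by apply: measurable_funM => //; exact: measurable_funX.
  have ms2 : measurable_fun setT (fun w => s w / 2) by exact: measurable_funM.
  have mexp : measurable_fun setT (fun w => expR (- (s w / 2))).
    by apply: (measurableT_comp (@measurable_expR R)); exact: measurableT_comp.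
  apply: measurable_funM => //; apply: measurable_funB; last first.
    by apply: measurable_funM => //; apply: measurable_funD => //; exact: measurable_funB.
  apply: measurable_funD; last exact: measurable_funM.
  by apply: measurable_funD; [exact: measurable_funB|exact: measurable_funM].
have iR : L1 P Rm by exact: L1_le iW hR.
rewrite (_ : (fun w => B w * _) = fun w =>
  ((U w * X w + V w * s w) - V w * X w ^+ 2) + Rm w); last first.
  by apply/funext => w; rewrite /U /V /Rm; field.
rewrite E_D//; last by apply: L1B => //; exact: L1D.
rewrite E_B//; last exact: L1D.
rewrite E_D// (pull_out sG iX cX sU bU) (pull_out sG iX2 cX2 sV bV).
rewrite (_ : (fun w => U w * cst 0 w) = cst 0); last by apply/funext => w; rewrite mulr0.
rewrite E_cst add0r subrr add0r.
apply: le_trans (E_norm iR) _.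
apply: (le_trans (E_le (L1_norm iR) iW hR)).
have K0 : 0 <= K by have := hB point; move=> /andP[]; exact: le_trans.
have C0 : 0 <= C by have := hs point; move=> /andP[]; exact: le_trans.
rewrite /W E_Z; last by apply/L1D => //; apply: L1D; exact: L1Z.
apply: ler_wpM2l => //.
rewrite E_D//; last by apply: L1D; exact: L1Z.
rewrite E_D; [|exact: L1Z|exact: L1Z].
rewrite !E_Z//.
(* As [s] is [G]-measurable, [E[s^2] = E[s X^2]]. Where [|X| <= e] the integrand is at most
   [e ^+ 2 * s], whose mean is [e ^+ 2] times that of [X ^+ 2]; elsewhere [s <= C] is used. *)
have h : \int[P]_w (s w * s w) <= e ^+ 2 * \int[P]_w (X w ^+ 2) +
    C * \int[P]_w tail_sqr e (X w).
  have bs w : `|s w| <= C by rewrite ger0_norm.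
  rewrite -(pull_out sG iX2 cX2 ss bs).
  have Es : \int[P]_w s w = \int[P]_w (X w ^+ 2).
    have b1 (w : Omega) : `|cst 1 w| <= 1 :> R by rewrite /= normr1.
    have := pull_out sG iX2 cX2 (sub_measurable_cst 1 sG) b1.
    rewrite (_ : (fun w => cst 1 w * X w ^+ 2) = fun w => X w ^+ 2); last first.
      by apply/funext => w; rewrite /= mul1r.
    rewrite (_ : (fun w => cst 1 w * s w) = s)//.
    by apply/funext => w; rewrite /= mul1r.
  rewrite -Es -!E_Z// -E_D; [|exact: L1Z|exact: L1Z].
  apply: E_le; [exact: L1_bmul bs _|by apply: L1D; exact: L1Z|move=> w].
  have h1 := s0 w; have h2 := sC w; have h3 := sqr_ge0 (X w).
  rewrite /tail_sqr; have [h4|h4] := ltP e `|X w|.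
    by rewrite mulr1; have := ler_wpM2r h3 h2; have := mulr_ge0 (sqr_ge0 e) h1; lra.
  rewrite mulr0 mulr0 addr0 mulrC ler_wpM2r//.
  by rewrite -real_normK ?num_real// ler_pXn2r ?nnegrE.
by move: h; set a := \int[P]_w _; set b := \int[P]_w _; set c := \int[P]_w _ => h; lra.
Qed.

Lemma E_cond_exp G X Z : sub_algebra G -> L1 P X -> is_cond_exp P G X Z ->
  \int[P]_w Z w = \int[P]_w X w.
Proof.
move=> sG iX cXZ; have b1 (w : Omega) : `|cst 1 w| <= 1 :> R by rewrite /= normr1.
have := pull_out sG iX cXZ (sub_measurable_cst 1 sG) b1.
rewrite (_ : (fun w => cst 1 w * X w) = X); last by apply/funext => w; rewrite /= mul1r.
by rewrite (_ : (fun w => cst 1 w * Z w) = Z)//; apply/funext => w; rewrite /= mul1r.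
Qed.

(** Bounds pass to a conditional expectation only almost surely. Clipping selects a version that
    satisfies them everywhere, as the lemmas on bounded multipliers require. *)
Lemma is_cond_exp_clip (M : R) G X Z : sub_algebra G -> measurable_fun setT X ->
  is_cond_exp P G X Z -> (forall w, 0 <= X w <= M) ->
  exists Z', [/\ is_cond_exp P G X Z', (forall w, 0 <= Z' w <= M) &
    {ae P, forall w, Z w = Z' w}].
Proof.
move=> sG mX cXZ hX; have [sZ iZ _] := cXZ.
have X0 w : 0 <= X w by have /andP[] := hX w.
have XM w : X w <= M by have /andP[] := hX w.
have M0 : 0 <= M by apply: le_trans (XM point).
have iX : L1 P X by apply: (L1_bounded P (M := M)) => // w; rewrite ger0_norm.
have ae1 := is_cond_exp_ge0 sG iX cXZ X0.
have iM : L1 P (fun w => M - X w) by apply: L1B => //; exact: L1_cst.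
have cM : is_cond_exp P G (fun w => M - X w) (fun w => M - Z w).
  have c1 : is_cond_exp P G (cst M) (cst M).
    by split => //; [exact: sub_measurable_cst|exact: L1_cst].
  have := is_cond_expD sG (L1_cst P M) (L1Z (-1) iX) c1 (is_cond_expZ (-1) sG iX cXZ).
  by under eq_fun do rewrite mulN1r; under [X in is_cond_exp _ _ _ X]eq_fun do rewrite mulN1r.
have ae2 : {ae P, forall w, 0 <= M - Z w}.
  by apply: (is_cond_exp_ge0 sG iM cM) => w; rewrite subr_ge0.
pose Z' w := Num.min (Num.max (Z w) 0) M.
have ae : {ae P, forall w, Z w = Z' w}.
  near=> w.
  have h1 : 0 <= Z w by near: w.
  have h2 : 0 <= M - Z w by near: w.
  by rewrite /Z' max_l// min_l// -subr_ge0.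
exists Z'; split => //.
- apply: is_cond_exp_ae ae => //.
  apply: (sub_measurable_min sG _ (sub_measurable_cst M sG)).
  exact: (sub_measurable_max sG sZ (sub_measurable_cst 0 sG)).
- by move=> w; rewrite /Z' le_min le_max lexx orbT M0 ge_min lexx orbT.
Unshelve. all: by end_near. Qed.

End martingale_differences.

(** * Estimates for martingales with bounded conditional variance *)

Section bounded_variation.
Context d (Omega : measurableType d) (R : realType) (P : probability Omega R).
Variable F : nat -> set (set Omega).
Hypothesis sF : forall k, sub_algebra (F k).
Hypothesis FS : forall k, F k `<=` F k.+1.
Variables (n : nat) (X s : nat -> Omega -> R) (C e : R).
Hypothesis hX : forall k, (1 <= k <= n)%N -> mdiff P F k (X k).
Hypothesis hs : forall k, (1 <= k <= n)%N ->
  is_cond_exp P (F k.-1) (fun w => X k w ^+ 2) (s k).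
Hypothesis s0 : forall k w, (1 <= k <= n)%N -> 0 <= s k w.
Hypothesis sC : forall w, \sum_(1 <= k < n.+1) s k w <= C.
Hypothesis e0 : 0 <= e.

Let S j w := \sum_(1 <= k < j.+1) X k w.
Let V j w := \sum_(1 <= k < j.+1) s k w.
Let tail := \sum_(1 <= k < n.+1) \int[P]_w tail_sqr e (X k w).

Let VC j w : (j <= n)%N -> 0 <= V j w <= C.
Proof.
move=> jn; apply/andP; split.
  rewrite /V big_nat sumr_ge0// => k /andP[k1 kj]; rewrite s0// k1/=.
  exact: leq_trans jn.
apply: le_trans (sC w); rewrite /V [leRHS](@big_cat_nat _ _ _ j.+1)//=.
rewrite lerDl big_nat sumr_ge0// => k /andP[jk kn]; apply: s0.
by rewrite ltnS in kn; rewrite kn (leq_trans _ jk).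
Qed.

Let C0 : 0 <= C.
Proof. by have /andP[h /(le_trans h)] := VC point (leqnn n). Qed.

Let sVm k : (1 <= k <= n)%N -> sub_measurable (F k.-1) (s k).
Proof. by move=> kn; case: (hs kn). Qed.

Let sV j : (j < n)%N -> sub_measurable (F j) (V j.+1).
Proof.
move=> jn; rewrite /V; under eq_fun do rewrite big_nat.
apply: sub_measurable_sum => // k /andP[k1 kj].
apply: (sub_measurable_mono _ (sVm _)); last first.
  by rewrite k1 -ltnS (leq_trans kj).
by apply: filtration_le => //; case: k k1 kj.
Qed.

Let sC1 k w : (1 <= k <= n)%N -> s k w <= C.
Proof.
move=> /andP[k1 kn]; apply: le_trans (sC w).
rewrite [leRHS](bigD1_seq k) ?mem_index_iota ?k1 ?ltnS ?iota_uniq//= lerDl.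
rewrite big_seq_cond sumr_ge0// => i; rewrite mem_index_iota ltnS => /andP[? _].
exact: s0.
Qed.

Lemma sum_E_sqr : \sum_(1 <= k < n.+1) \int[P]_w (X k w ^+ 2) <= C.
Proof.
rewrite big_nat (eq_bigr (fun k => \int[P]_w s k w)); last first.
  move=> k kn; symmetry; apply: E_cond_exp (hs kn) => //.
  by have [_ ? _] := hX kn.
rewrite -E_sum; last by move=> k kn; exact: is_cond_exp_L1 (hs kn).
rewrite -[leRHS](E_cst P); apply: E_le.
- by apply: L1_sum => k kn; exact: is_cond_exp_L1 (hs kn).
- exact: L1_cst.
- by move=> w; rewrite -big_nat.
Qed.

(** The weight gains the factor [expR (s k / 2)] one step ahead, [s k] being known at time [k.-1].
    This cancels the factor [expR (- (s k / 2))] that conditioning produces, so only the errors of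
    [martingale_clt_step] accumulate; [V <= C] bounds the weights by [K]. *)
Lemma bounded_clt phi :
  `|\int[P]_w (expR (V n w / 2) * cos (S n w + phi)) - cos phi| <=
  expR (C / 2) * ((2 * e + e ^+ 2) * C + (3 + C) * tail).
Proof.
set K := expR (C / 2).
pose b k := K * ((2 * e + e ^+ 2) * \int[P]_w (X k w ^+ 2) +
       (3 + C) * \int[P]_w tail_sqr e (X k w)).
suff key j : (j <= n)%N ->
    `|\int[P]_w (expR (V j w / 2) * cos (S j w + phi)) - cos phi| <=
    \sum_(1 <= k < j.+1) b k.
  apply: le_trans (key n (leqnn n)) _.
  rewrite -mulr_sumr; apply: ler_wpM2l; first exact: expR_ge0.
  rewrite big_split/= -!mulr_sumr lerD2r; apply: ler_wpM2l; last exact: sum_E_sqr.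
  by rewrite addr_ge0 ?sqr_ge0// mulr_ge0.
have mcos : measurable_fun setT (@cos R).
  by apply: continuous_measurable_fun; exact: continuous_cos.
have mexp2 : measurable_fun setT (fun x : R => expR (x / 2)).
  by apply: (measurableT_comp (@measurable_expR R)); exact: mulrr_measurable.
have mcosp : measurable_fun setT (fun x : R => cos (x + phi)).
  by apply: (measurableT_comp mcos); exact: measurable_funD.
have bcos x : `|cos x| <= 1 :> R by rewrite ler_norml cos_geN1 cos_le1.
have sS i : (i <= n)%N -> sub_measurable (F i) (S i).
  move=> ilen; apply: (mdiff_sum_measurable sF FS) => k /andP[k1 ki]; apply: hX.
  by rewrite k1 (leq_trans ki).
have bV i w : (i <= n)%N -> `|expR (V i w / 2)| <= K.
  move=> ilen; rewrite ger0_norm ?expR_ge0// ler_expR ler_wpM2r//.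
  by case/andP: (VC w ilen).
have mV i : (i <= n)%N -> measurable_fun setT (fun w => expR (V i w / 2)).
  case: i => [_|i ilen].
    rewrite (_ : (fun w => _) = cst 1)//; apply/funext => w.
    by rewrite /V big_geq// mul0r expR0.
  by apply: (measurableT_comp mexp2); exact: sub_measurable_fun (sV ilen).
have iM i : (i <= n)%N -> L1 P (fun w => expR (V i w / 2) * cos (S i w + phi)).
  move=> ilen; apply: (L1_bmul (mV i ilen) (fun w => bV i w ilen)).
  apply: (L1_bounded P _ (fun w => bcos _)).
  by apply: (measurableT_comp mcosp); exact: sub_measurable_fun (sS i ilen).
elim: j => [_|j IH jn].
  rewrite [leRHS]big_geq// (_ : (fun w => _) = cst (cos phi)); last first.
    by apply/funext => w; rewrite /V /S !big_geq// mul0r expR0 mul1r add0r.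
  by rewrite E_cst subrr normr0.
have jn' : (1 <= j.+1 <= n)%N by [].
rewrite big_nat_recr//=; apply: le_trans (lerD (IH (ltnW jn)) (lexx _)).
set a1 := \int[P]_w _; set a0 := \int[P]_w _.
rewrite (_ : a1 - cos phi = (a0 - cos phi) + (a1 - a0)); last by ring.
apply: le_trans (ler_normD _ _) _; rewrite lerD2l /a1 /a0.
rewrite -E_B; [|exact: iM|exact/iM/ltnW].
rewrite (_ : (fun w => _) = fun w => expR (V j.+1 w / 2) *
   (cos ((S j w + phi) + X j.+1 w) - expR (- (s j.+1 w / 2)) * cos (S j w + phi))); last first.
  apply/funext => w; rewrite mulrBr mulrA -expRD; congr (_ * cos _ - expR _ * _).
    by rewrite /S big_nat_recr//= addrAC.
  have -> : V j.+1 w = V j w + s j.+1 w by rewrite /V big_nat_recr.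
  by field.
have [h1 h2 h3] := hX jn'.
apply: (martingale_clt_step (sF j)) => //.
- exact: mdiff_measurable (hX jn').
- exact: (hs jn').
- by move=> w; rewrite s0//= sC1.
- apply: sub_measurableD => //; [exact/sS/ltnW|exact: sub_measurable_cst].
- by apply: (sub_measurable_comp mexp2); exact: sV.
- by move=> w; rewrite expR_ge0/= -[leLHS]ger0_norm ?expR_ge0// bV.
Qed.

(** Squares truncated at [e], minus their conditional means, are martingale differences bounded by
    [e ^+ 2], and their sum has variance at most [e ^+ 2 * C]. The part cut off and its conditional
    mean cost [2 * tail] in L1. Chebyshev's and Markov's inequalities at level [eps / 2] give the
    two terms. *)
Lemma bounded_quadratic_variation (eps : R) : 0 < eps ->
  (P [set w | (eps < `|\sum_(1 <= k < n.+1) X k w ^+ 2 - V n w|)%R] <=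
   (4 * (e ^+ 2 * C) / eps ^+ 2 + 4 * tail / eps)%:E)%E.
Proof.
move=> eps0.
pose D k w := X k w ^+ 2 - tail_sqr e (X k w).
have hD k w : 0 <= D k w <= e ^+ 2.
  rewrite /D /tail_sqr; have h := sqr_ge0 (X k w); have [h1|h1] := ltP e `|X k w|.
    by rewrite mulr1 subrr lexx sqr_ge0.
  by rewrite mulr0 subr0 h/= -real_normK ?num_real// ler_pXn2r ?nnegrE.
have mX k : (1 <= k <= n)%N -> measurable_fun setT (X k).
  by move=> kn; exact: mdiff_measurable (hX kn).
have iX2 k : (1 <= k <= n)%N -> L1 P (fun w => X k w ^+ 2).
  by move=> kn; case: (hX kn).
have it k : (1 <= k <= n)%N -> L1 P (fun w => tail_sqr e (X k w)).
  by move=> kn; apply: L1_tail_sqr; [exact: mX|exact: iX2].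
have iD k : (1 <= k <= n)%N -> L1 P (D k).
  by move=> kn; apply: L1B; [exact: iX2|exact: it].
have mD k : (1 <= k <= n)%N -> measurable_fun setT (D k).
  by move=> kn; exact: L1_measurable (iD k kn).
have /choice[dd hdd] k : exists d, (1 <= k <= n)%N ->
    is_cond_exp P (F k.-1) (D k) d /\ (forall w, 0 <= d w <= e ^+ 2).
  case: (boolP (1 <= k <= n)%N) => kn; last by exists (cst 0).
  have cD := cond_expP (sF k.-1) (iD k kn).
  by have [d0 [? ? _]] := is_cond_exp_clip (sF k.-1) (mD k kn) cD (hD k); exists d0.
have cD k (kn : (1 <= k <= n)%N) := (hdd k kn).1.
have bd k (kn : (1 <= k <= n)%N) := (hdd k kn).2.
have bd' k w : (1 <= k <= n)%N -> `|dd k w| <= e ^+ 2.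
  by move=> kn; have /andP[h1 h2] := bd k kn w; rewrite ger0_norm.
have sd k : (1 <= k <= n)%N -> sub_measurable (F k.-1) (dd k).
  by move=> kn; case: (cD k kn).
have md k : (1 <= k <= n)%N -> measurable_fun setT (dd k).
  by move=> kn; exact: sub_measurable_fun (sd k kn).
have id k : (1 <= k <= n)%N -> L1 P (dd k).
  by move=> kn; exact: is_cond_exp_L1 (cD k kn).
pose m k w := D k w - dd k w.
have bm k w : (1 <= k <= n)%N -> `|m k w| <= e ^+ 2.
  move=> kn; have /andP[? ?] := hD k w; have /andP[? ?] := bd k kn w.
  by rewrite ler_norml /m; apply/andP; split; lra.
have mm k : (1 <= k <= n)%N -> measurable_fun setT (m k).
  by move=> kn; apply: measurable_funB; [exact: mD|exact: md].
have FF k : F k.-1 `<=` F k by apply: filtration_le => //; exact: leq_pred.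
have sX k : (1 <= k <= n)%N -> sub_measurable (F k) (X k) by move=> kn; case: (hX kn).
have mdm k : (1 <= k <= n)%N -> mdiff P F k (m k).
  move=> kn; split.
  - apply: sub_measurableB => //; last exact: sub_measurable_mono (sd k kn).
    apply: (sub_measurable_comp (phi := fun x => x ^+ 2 - tail_sqr e x)) (sX k kn).
    by apply: measurable_funB; [exact: exprn_measurable|exact: measurable_tail_sqr].
  - apply: (L1_bounded P (M := (e ^+ 2) ^+ 2)).
      by apply: measurable_funX; exact: mm.
    by move=> w; rewrite normrX ler_pXn2r ?nnegrE ?sqr_ge0// bm.
  - have c2 : is_cond_exp P (F k.-1) (dd k) (dd k).
      by split; [exact: sd|exact: id|].
    have := is_cond_expD (sF k.-1) (iD k kn) (L1Z (-1) (id k kn)) (cD k kn)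
      (is_cond_expZ (-1) (sF _) (id k kn) c2).
    rewrite (_ : (fun w => dd k w + -1 * dd k w) = cst 0); last first.
      by apply/funext => w /=; rewrite mulN1r subrr.
    by congr is_cond_exp; apply/funext => w; rewrite mulN1r.
have [iSm ESm] := mdiff_sum_L2 sF FS mdm.
have Em k : (1 <= k <= n)%N -> \int[P]_w (m k w ^+ 2) <= e ^+ 2 * \int[P]_w (X k w ^+ 2).
  move=> kn.
  have iDd : L1 P (fun w => dd k w * D k w) by exact: L1_bmul (md k kn) (fun w =>
    bd' k w kn) (iD k kn).
  have idd : L1 P (fun w => dd k w * dd k w) by exact: L1_bmul (md k kn) (fun w =>
    bd' k w kn) (id k kn).
  have iD2 : L1 P (fun w => D k w * D k w).
    apply: (L1_bmul (mD k kn) _ (iD k kn) (M := e ^+ 2)) => w.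
    by have /andP[h1 h2] := hD k w; rewrite ger0_norm.
  rewrite (_ : (fun w => _) = fun w => (D k w * D k w - 2 * (dd k w * D k w)) +
    dd k w * dd k w); last first.
    by apply/funext => w; rewrite /m; ring.
  rewrite E_D//; last by apply: L1B => //; exact: L1Z.
  rewrite E_B//; last exact: L1Z.
  rewrite E_Z// (pull_out (sF k.-1) (iD k kn) (cD k kn) (sd k kn) (fun w => bd' k w kn)).
  have h1 : 0 <= \int[P]_w (dd k w * dd k w) by apply: E_ge0 => w; rewrite -expr2 sqr_ge0.
  have h2 : \int[P]_w (D k w * D k w) <= e ^+ 2 * \int[P]_w (X k w ^+ 2).
    rewrite -E_Z; last exact: iX2.
    apply: E_le => //; first by apply: L1Z; exact: iX2.
    move=> w; have /andP[d1 d2] := hD k w; apply: ler_pM => //.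
    by rewrite /D lerBlDr lerDl tail_sqr_ge0.
  by lra.
have is_ k : (1 <= k <= n)%N -> L1 P (s k) by move=> kn; exact: is_cond_exp_L1 (hs kn).
(* [s k - dd k] is a version of the conditional expectation of the tail, hence nonnegative almost
   surely, so the two parts of [r k] have the same mean. *)
pose r k w := tail_sqr e (X k w) + `|s k w - dd k w|.
have ir k : (1 <= k <= n)%N -> L1 P (r k).
  by move=> kn; apply: L1D; [exact: it|apply: L1_norm; apply: L1B; [exact: is_|exact: id]].
have Er k : (1 <= k <= n)%N -> \int[P]_w r k w = 2 * \int[P]_w tail_sqr e (X k w).
  move=> kn; rewrite E_D; [|exact: it|by apply: L1_norm; apply: L1B; [exact: is_|exact: id]].
  have csd : is_cond_exp P (F k.-1) (fun w => tail_sqr e (X k w)) (fun w => s k w - dd k w).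
    have := is_cond_expD (sF k.-1) (iX2 k kn) (L1Z (-1) (iD k kn)) (hs kn)
      (is_cond_expZ (-1) (sF _) (iD k kn) (cD k kn)).
    rewrite (_ : (fun w => s k w + _) = fun w => s k w - dd k w); last first.
      by apply/funext => w /=; rewrite mulN1r.
    by congr is_cond_exp; apply/funext => w; rewrite mulN1r /D; ring.
  have ae := is_cond_exp_ge0 (sF k.-1) (it k kn) csd (fun w => tail_sqr_ge0 _ _).
  have msd : measurable_fun setT (fun w => s k w - dd k w).
    by apply: (sub_measurable_fun (sF k.-1)); case: csd.
  rewrite (E_ae (f := fun w => `|s k w - dd k w|) (g := fun w => s k w - dd k w)) //.
  - by rewrite (E_cond_exp (sF _) (it k kn) csd); ring.
  - exact: measurableT_comp.
  - by apply: filterS ae => w h; rewrite ger0_norm.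
pose T w := \sum_(1 <= k < n.+1) r k w.
have iT : L1 P T.
  rewrite /T; under eq_fun do rewrite big_nat; exact: L1_sum.
have ET : \int[P]_w T w = 2 * tail.
  rewrite /T; under eq_fun do rewrite big_nat.
  rewrite E_sum// /tail mulr_sumr [RHS]big_nat; exact: eq_bigr.
have T0 w : 0 <= T w.
  by apply: sumr_ge0 => k _; rewrite addr_ge0// tail_sqr_ge0.
pose M2 w := (\sum_(1 <= k < n.+1) m k w) ^+ 2.
have EM2 : \int[P]_w M2 w <= e ^+ 2 * C.
  rewrite ESm; apply: (@le_trans _ _ (e ^+ 2 * \sum_(1 <= k < n.+1) \int[P]_w (X k w ^+ 2))).
    by rewrite mulr_sumr big_nat [leRHS]big_nat; apply: ler_sum => k kn; exact: Em.
  by rewrite ler_wpM2l ?sqr_ge0// sum_E_sqr.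
have h2 : 0 < eps / 2 by rewrite divr_gt0.
have h4 : 0 < (eps / 2) ^+ 2 by rewrite exprn_gt0.
have sub : [set w | (eps < `|\sum_(1 <= k < n.+1) X k w ^+ 2 - V n w|)%R] `<=`
   [set w | (eps / 2) ^+ 2 < M2 w] `|` [set w | eps / 2 < T w].
  move=> w /= hw; apply/orP; rewrite -implyNb -leNgt; apply/implyP => hM.
  have {}hM : `|\sum_(1 <= k < n.+1) m k w| <= eps / 2.
    by rewrite -(@ler_pXn2r _ 2) ?nnegrE ?(ltW h2)// real_normK ?num_real.
  rewrite ltNge; apply/negP => hT; move: hw; rewrite ltNge => /negP; apply.
  rewrite (_ : _ - V n w = \sum_(1 <= k < n.+1) m k w +
     \sum_(1 <= k < n.+1) (tail_sqr e (X k w) - (s k w - dd k w))); last first.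
    by rewrite -big_split/= /V -sumrB; apply: eq_bigr => k _; rewrite /m /D; ring.
  apply: le_trans (ler_normD _ _) _.
  have : `|\sum_(1 <= k < n.+1) (tail_sqr e (X k w) - (s k w - dd k w))| <= T w.
    apply: le_trans (ler_norm_sum _ _ _) _; apply: ler_sum => k _.
    by apply: le_trans (ler_normB _ _) _; rewrite ger0_norm ?tail_sqr_ge0.
  by lra.
have mS (f : Omega -> R) c : measurable_fun setT f -> measurable [set w | (c < f w)%R].
  move=> mf; rewrite (_ : [set w | _] = setT `&` f @^-1` `]c, +oo[%classic); first exact: mf.
  by rewrite setTI; apply/seteqP; split => w /=; rewrite in_itv/= andbT.
have mQ : measurable_fun setT (fun w => `|\sum_(1 <= k < n.+1) X k w ^+ 2 - V n w|).
  apply: measurableT_comp => //.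
  apply: (L1_measurable (P := P)); apply: L1B; rewrite /V; under eq_fun do rewrite big_nat;
    exact: L1_sum.
have mM2 := L1_measurable iSm; have mT := L1_measurable iT.
apply: (@le_trans _ _ (P ([set w | (eps / 2) ^+ 2 < M2 w] `|` [set w | eps / 2 < T w]))).
  apply: le_measure sub; rewrite inE; first exact: mS.
  by apply: measurableU; exact: mS.
apply: le_trans (measureU2 _ _ _) _; [exact: mS|exact: mS|].
rewrite EFinD; apply: leeD.
  apply: le_trans (E_markov h4 iSm (fun w => sqr_ge0 _)) _.
  rewrite lee_fin (_ : 4 * _ / _ = (e ^+ 2 * C) / (eps / 2) ^+ 2); last first.
    by field; exact: lt0r_neq0.
  by rewrite ler_wpM2r// invr_ge0 ltW.
apply: le_trans (E_markov h2 iT T0) _.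
rewrite lee_fin ET (_ : 4 * tail / eps = 2 * tail / (eps / 2))//.
by field; exact: lt0r_neq0.
Qed.

End bounded_variation.

(** * Events whose probability tends to one *)

Section events_with_high_probability.
Context d (Omega : measurableType d) (R : realType).
Variable P : nat -> probability Omega R.

(* Nonmeasurable events are allowed, through measurable covers of their
   complements. *)
Definition whp (E : nat -> set Omega) := forall eps : R, 0 < eps ->
  \forall n \near \oo, exists A, [/\ measurable A, ~` E n `<=` A &
    (P n A <= eps%:E)%E].

Lemma whp_sub (E E' : nat -> set Omega) : (\forall n \near \oo, E n `<=` E' n) -> whp E ->
  whp E'.
Proof.
move=> h hE eps e0; near=> n.
have [A [mA sA PA]] : exists A, [/\ measurable A, ~` E n `<=` A & (P n A <= eps%:E)%E].
  by near: n; exact: hE.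
exists A; split => //; apply: subset_trans sA; apply: subsetC.
by near: n.
Unshelve. all: by end_near. Qed.

Lemma whpI (E E' : nat -> set Omega) : whp E -> whp E' -> whp (fun n => E n `&` E' n).
Proof.
move=> hE hE' eps e0; have e2 : 0 < eps / 2 by rewrite divr_gt0.
near=> n.
have [A [mA sA PA]] : exists A, [/\ measurable A, ~` E n `<=` A & (P n A <= (eps / 2)%:E)%E].
  by near: n; exact: hE.
have [B [mB sB PB]] : exists A, [/\ measurable A, ~` E' n `<=` A & (P n A <= (eps / 2)%:E)%E].
  by near: n; exact: hE'.
exists (A `|` B); split; first exact: measurableU.
  by rewrite setCI; exact: setUSS.
apply: le_trans (measureU2 _ mA mB) _.
by rewrite [eps]splitr EFinD leeD.
Unshelve. all: by end_near. Qed.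

Lemma whp_ae (E : nat -> set Omega) : (\forall n \near \oo, {ae P n, forall w, E n w}) -> whp E.
Proof.
move=> h eps e0; near=> n.
have [A [mA PA sA]] : {ae P n, forall w, E n w} by near: n.
by exists A; split => //; rewrite PA lee_fin ltW.
Unshelve. all: by end_near. Qed.

Lemma whp_bound (f : nat -> Omega -> R) (c : R) :
  (\forall n \near \oo, measurable_fun setT (f n)) ->
  (forall eps, 0 < eps -> \forall n \near \oo, (P n [set w | (c < f n w)%R] <= eps%:E)%E) ->
  whp (fun n => [set w | f n w <= c]).
Proof.
move=> mf h eps e0; near=> n; exists [set w | c < f n w]; split.
- have mfn : measurable_fun setT (f n) by near: n.
  rewrite (_ : [set w | _] = setT `&` f n @^-1` `]c, +oo[%classic); first exact: mfn.
  by rewrite setTI; apply/seteqP; split => w /=; rewrite in_itv/= andbT.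
- by move=> w /= /negP; rewrite -ltNge.
- by near: n; exact: h.
Unshelve. all: by end_near. Qed.

Lemma cvg_in_prob_whp (X : nat -> Omega -> R) c eta :
  (\forall n \near \oo, measurable_fun setT (X n)) -> cvg_in_prob P X c -> 0 < eta ->
  whp (fun n => [set w | `|X n w - c| <= eta]).
Proof.
move=> mX h eta0; apply: (whp_bound (f := fun n w => `|X n w - c|)).
  by apply: filterS mX => n mX; apply: measurableT_comp => //; exact: measurable_funB.
move=> eps e0; have /fine_cvgP[] := h _ eta0.
move=> fin /cvgr0Pnorm_le/(_ _ e0) hn; near=> n.
rewrite -[X in (X <= _)%E]fineK; last by near: n.
rewrite lee_fin; apply: le_trans (ler_norm _) _; near: n; exact: hn.
Unshelve. all: by end_near. Qed.

Lemma E_le_ae (Q : probability Omega R) f g : L1 Q f -> L1 Q g ->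
  {ae Q, forall w, f w <= g w} -> \int[Q]_w f w <= \int[Q]_w g w.
Proof.
move=> hf hg h.
have mf := L1_measurable hf; have mg := L1_measurable hg.
have mm : measurable_fun setT (fun w => Num.max (f w) (g w)) by exact: measurable_maxr.
have ae : {ae Q, forall w, g w = Num.max (f w) (g w)}.
  by apply: filterS h => w fg; rewrite max_r.
have im : L1 Q (fun w => Num.max (f w) (g w)) by exact: L1_ae ae hg.
rewrite (E_ae mg mm ae); apply: E_le => // w.
by rewrite le_max lexx.
Qed.

Lemma E_le_off (Q : probability Omega R) f (A : set Omega) (M p eps : R) :
  L1 Q f -> measurable A -> (Q A <= p%:E)%E -> 0 <= M -> 0 <= eps ->
  {ae Q, forall w, f w <= M} -> {ae Q, forall w, ~ A w -> f w <= eps} ->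
  \int[Q]_w f w <= eps + M * p.
Proof.
move=> hf mA QA M0 e0 h1 h2.
have iA : L1 Q \1_A by exact: integrable_indic.
apply: (@le_trans _ _ (\int[Q]_w (eps + M * \1_A w))).
  apply: E_le_ae => //; first by apply: L1D; [exact: L1_cst|exact: L1Z].
  near=> w.
  have h1w : f w <= M by near: w.
  have h2w : ~ A w -> f w <= eps by near: w.
  rewrite indicE; have [_|/negP nA] := boolP (w \in A).
    by rewrite mulr1; lra.
  by rewrite mulr0 addr0; apply: h2w => Aw; apply: nA; exact/mem_set.
rewrite E_D; [|exact: L1_cst|exact: L1Z].
rewrite (E_cst Q eps) E_Z// lerD2l ler_wpM2l//.
by rewrite -lee_fin E_indic.
Unshelve. all: by end_near. Qed.

End events_with_high_probability.

(** * Stopping before the conditional variance exceeds a bound *)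

Section stopping.
Context d (Omega : measurableType d) (R : realType) (P : probability Omega R).
Variable F : nat -> set (set Omega).
Hypothesis sF : forall k, sub_algebra (F k).
Hypothesis FS : forall k, F k `<=` F k.+1.
Variables (n : nat) (X s : nat -> Omega -> R) (C : R).
Hypothesis hX : forall k, (1 <= k <= n)%N -> mdiff P F k (X k).
Hypothesis hs : forall k, (1 <= k <= n)%N ->
  is_cond_exp P (F k.-1) (fun w => X k w ^+ 2) (s k).
Hypothesis s0 : forall k w, (1 <= k <= n)%N -> 0 <= s k w.
Hypothesis C0 : 0 <= C.

(* For predictable [s] the stopped sum of [s] never exceeds [C]: the indicator
   already sees the term at time [k]. *)
Definition before_exit k w : R := (\sum_(1 <= j < k.+1) s j w <= C)%R%:R.

Lemma before_exit_bound k w : `|before_exit k w| <= 1.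
Proof. by rewrite /before_exit; case: (_ <= C); rewrite ?normr1 ?normr0. Qed.

Lemma before_exit_ge0 k w : 0 <= before_exit k w.
Proof. by rewrite /before_exit. Qed.

Lemma before_exit_le1 k w : before_exit k w <= 1.
Proof. by apply: le_trans (ler_norm _) (before_exit_bound k w). Qed.

Lemma before_exit_measurable k : (1 <= k <= n)%N ->
  sub_measurable (F k.-1) (before_exit k).
Proof.
move=> /andP[k1 kn].
have -> : before_exit k = \1_[set w | \sum_(1 <= j < k.+1) s j w <= cst C w].
  apply/funext => w; rewrite /before_exit indicE; congr (nat_of_bool _)%:R.
  by apply/idP/idP => [h|/set_mem//]; exact/mem_set.
apply: sub_measurable_indic => //; apply: sub_measurable_le => //; last first.
  exact: sub_measurable_cst.
under eq_fun do rewrite big_nat.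
apply: sub_measurable_sum => // j /andP[j1 jk].
have jn : (1 <= j <= n)%N by rewrite j1 -ltnS (leq_trans jk).
have [sj _ _] := hs jn; apply: sub_measurable_mono sj.
by apply: filtration_le => //; case: j k j1 k1 jk {jn kn} => [|j] [|k].
Qed.

Let Y k w := before_exit k w * X k w.
Let t k w := before_exit k w * s k w.

Lemma stopped_mdiff k : (1 <= k <= n)%N -> mdiff P F k (Y k).
Proof.
move=> kn; apply: (mdiff_bmul sF FS _ (hX kn) (before_exit_measurable kn)).
  by case/andP: kn.
exact: before_exit_bound.
Qed.

Lemma before_exit_idem k w : before_exit k w ^+ 2 = before_exit k w.
Proof. by rewrite /before_exit; case: (_ <= _); rewrite ?expr1n ?expr0n. Qed.

Lemma stopped_cond_exp k : (1 <= k <= n)%N ->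
  is_cond_exp P (F k.-1) (fun w => Y k w ^+ 2) (t k).
Proof.
move=> kn; have [_ iX _] := hX kn.
have := is_cond_exp_bmul (sF _) iX (hs kn) (before_exit_measurable kn)
  (before_exit_bound k).
by congr is_cond_exp; apply/funext => w; rewrite /Y exprMn before_exit_idem.
Qed.

Lemma stopped_ge0 k w : (1 <= k <= n)%N -> 0 <= t k w.
Proof. by move=> kn; rewrite mulr_ge0 ?s0// before_exit_ge0. Qed.

(** By induction: either the unstopped sum is still at most [C] and dominates the stopped one, or
    the new term is 0. *)
Lemma stopped_sum_le w : \sum_(1 <= k < n.+1) t k w <= C.
Proof.
suff : forall j, (j <= n)%N -> \sum_(1 <= k < j.+1) t k w <= C by exact.
elim=> [|j IH] jn; first by rewrite big_geq.
rewrite big_nat_recr//= {2}/t /before_exit.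
case: (boolP (\sum_(1 <= i < j.+2) s i w <= C)) => h.
  rewrite mul1r; apply: le_trans h; rewrite [leRHS]big_nat_recr//= lerD2r.
  rewrite big_nat [leRHS]big_nat; apply: ler_sum => k /andP[k1 kj].
  have kn : (1 <= k <= n)%N by rewrite k1 (leq_trans _ jn)// ltnW.
  by rewrite /t ler_piMl ?before_exit_le1// s0.
by rewrite mul0r addr0; exact/IH/ltnW.
Qed.

Lemma before_exit1 w : \sum_(1 <= k < n.+1) s k w <= C ->
  forall k, (1 <= k <= n)%N -> before_exit k w = 1.
Proof.
move=> h k /andP[k1 kn]; rewrite /before_exit (le_trans _ h)//.
rewrite [leRHS](@big_cat_nat _ _ _ k.+1)//= lerDl big_nat sumr_ge0// => j /andP[kj jn].
by apply: s0; rewrite (leq_trans _ kj)//= -ltnS.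
Qed.

Lemma stopped_eq w : \sum_(1 <= k < n.+1) s k w <= C ->
  (forall k, (1 <= k <= n)%N -> Y k w = X k w) /\
  (forall k, (1 <= k <= n)%N -> t k w = s k w).
Proof.
by move=> h; split=> k kn; rewrite /Y /t before_exit1// mul1r.
Qed.

Lemma stopped_tail e k w : 0 <= e ->
  tail_sqr e (Y k w) = before_exit k w * tail_sqr e (X k w).
Proof.
move=> e0; rewrite /Y /before_exit /tail_sqr; case: (_ <= C); rewrite ?mul1r// !mul0r.
by rewrite expr0n/= mul0r.
Qed.

(** Stopping turns a Lindeberg condition in probability into one in mean. The conditional tails
    [u k] are at most [l k], so their sum is at most [eps] off [A]; they are also at most [s k], so
    their stopped sum is at most [C], even on [A]. *)
Lemma stopped_tail_sum_le (e : R) (Z l : nat -> Omega -> R) (A : set Omega) (eps p : R) :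
  0 <= e -> 0 <= eps ->
  (forall k, (1 <= k <= n)%N -> L1 P (Z k)) ->
  (forall k w, (1 <= k <= n)%N -> tail_sqr e (X k w) <= Z k w) ->
  (forall k, (1 <= k <= n)%N -> is_cond_exp P (F k.-1) (Z k) (l k)) ->
  measurable A -> ~` [set w | \sum_(1 <= k < n.+1) l k w <= eps] `<=` A ->
  (P A <= p%:E)%E ->
  \sum_(1 <= k < n.+1) \int[P]_w tail_sqr e (Y k w) <= eps + C * p.
Proof.
move=> e0 eps0 iZ hZ hl mA sA PA.
have mX k : (1 <= k <= n)%N -> measurable_fun setT (X k).
  by move=> kn; exact: mdiff_measurable (hX kn).
have iX2 k : (1 <= k <= n)%N -> L1 P (fun w => X k w ^+ 2).
  by move=> kn; case: (hX kn).
have it k : (1 <= k <= n)%N -> L1 P (fun w => tail_sqr e (X k w)).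
  by move=> kn; apply: L1_tail_sqr; [exact: mX|exact: iX2].
pose u k := cond_exp P (F k.-1) (fun w => tail_sqr e (X k w)).
have hu k : (1 <= k <= n)%N ->
    is_cond_exp P (F k.-1) (fun w => tail_sqr e (X k w)) (u k).
  by move=> kn; apply: cond_expP => //; exact: it.
have iu k : (1 <= k <= n)%N -> L1 P (u k) by move=> kn; exact: is_cond_exp_L1 (hu k kn).
have diff k (Z' : Omega -> R) z : (1 <= k <= n)%N -> L1 P Z' ->
    is_cond_exp P (F k.-1) Z' z -> (forall w, tail_sqr e (X k w) <= Z' w) ->
    {ae P, forall w, u k w <= z w}.
  move=> kn iZ' hz hle.
  have := is_cond_expD (sF k.-1) iZ' (L1Z (-1) (it k kn)) hz
    (is_cond_expZ (-1) (sF _) (it k kn) (hu k kn)).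
  move=> /(is_cond_exp_ge0 (sF k.-1) (L1D iZ' (L1Z (-1) (it k kn)))).
  have h w : 0 <= Z' w + -1 * tail_sqr e (X k w) by rewrite mulN1r subr_ge0.
  by move=> /(_ h); apply: filterS => w; rewrite mulN1r subr_ge0.
have ae1 : {ae P, forall w, forall k, (1 <= k <= n)%N -> u k w <= s k w}.
  apply/ae_foralln => k; case: (boolP (1 <= k <= n)%N) => kn; last exact: aeW.
  apply: filterS (diff k _ _ kn (iX2 k kn) (hs kn) _) => // w.
  exact: tail_sqr_le.
have ae2 : {ae P, forall w, forall k, (1 <= k <= n)%N -> u k w <= l k w}.
  apply/ae_foralln => k; case: (boolP (1 <= k <= n)%N) => kn; last exact: aeW.
  apply: filterS (diff k _ _ kn (iZ k kn) (hl k kn) _) => // w.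
  exact: hZ.
have ae3 : {ae P, forall w, forall k, (1 <= k <= n)%N -> 0 <= u k w}.
  apply/ae_foralln => k; case: (boolP (1 <= k <= n)%N) => kn; last exact: aeW.
  apply: filterS (is_cond_exp_ge0 (sF _) (it k kn) (hu k kn) (fun w => tail_sqr_ge0 _ _)) => //.
have iBu k : (1 <= k <= n)%N -> L1 P (fun w => before_exit k w * u k w).
  move=> kn; apply: (L1_bmul _ (before_exit_bound k) (iu k kn)).
  exact: sub_measurable_fun (before_exit_measurable kn).
rewrite big_nat (eq_bigr (fun k => \int[P]_w (before_exit k w * u k w))); last first.
  move=> k kn; rewrite -(pull_out (sF k.-1) (it k kn) (hu k kn) (before_exit_measurable kn)
    (before_exit_bound k)).
  by apply: E_ext => w; rewrite stopped_tail.
rewrite -E_sum//.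
apply: (E_le_off _ mA PA) => //; first exact: L1_sum.
- apply: filterS ae1 => w h; rewrite -big_nat; apply: le_trans (stopped_sum_le w).
  rewrite big_nat [leRHS]big_nat; apply: ler_sum => k kn.
  by rewrite ler_wpM2l ?before_exit_ge0// h.
- near=> w => Aw.
  have h2 : forall k, (1 <= k <= n)%N -> u k w <= l k w by near: w.
  have h3 : forall k, (1 <= k <= n)%N -> 0 <= u k w by near: w.
  have : \sum_(1 <= k < n.+1) l k w <= eps.
    by apply: contrapT => h; apply: Aw; exact: sA.
  apply: le_trans; rewrite [leRHS]big_nat; apply: ler_sum => k kn.
  apply: le_trans (h2 k kn); rewrite ler_piMl ?h3// before_exit_le1.
Unshelve. all: by end_near. Qed.

End stopping.

(** * Limit theorems for martingale arrays *)

Section martingale_array.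
Context d (Omega : measurableType d) (R : realType).
Variable P : nat -> probability Omega R.
Variable F : nat -> set (set Omega).
Hypothesis sF : forall k, sub_algebra (F k).
Hypothesis FS : forall k, F k `<=` F k.+1.
Variables (X s0 : nat -> nat -> Omega -> R) (v : R).
Hypothesis v0 : 0 <= v.
Hypothesis hX : forall n k, (1 <= k <= n)%N -> mdiff (P n) F k (X n k).
Hypothesis hs0 : forall n k, (1 <= k <= n)%N ->
  is_cond_exp (P n) (F k.-1) (fun w => X n k w ^+ 2) (s0 n k).
Hypothesis variance_cvg : forall eta : R, 0 < eta ->
  whp P (fun n => [set w | `|\sum_(1 <= k < n.+1) s0 n k w - v| <= eta]).
(** Allowing a dominating [Z] lets one Lindeberg condition, on the norm of a vector, serve all
    linear forms of that vector. *)
Hypothesis lindeberg : forall e : R, 0 < e -> exists Z l : nat -> nat -> Omega -> R,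
  [/\ forall n k, (1 <= k <= n)%N -> L1 (P n) (Z n k),
      forall n k w, (1 <= k <= n)%N -> tail_sqr e (X n k w) <= Z n k w,
      forall n k, (1 <= k <= n)%N -> is_cond_exp (P n) (F k.-1) (Z n k) (l n k) &
      forall eta : R, 0 < eta ->
        whp P (fun n => [set w | \sum_(1 <= k < n.+1) l n k w <= eta])].

(** The given conditional variances are nonnegative only almost surely, whereas the stopping
    argument uses nonnegativity everywhere. *)
Let s n k w := Num.max (s0 n k w) 0.
Let C := v + 1.
Let Y n k w := before_exit (s n) C k w * X n k w.
Let t n k w := before_exit (s n) C k w * s n k w.

Let s_ge0 n k w : (1 <= k <= n)%N -> 0 <= s n k w.
Proof. by move=> _; rewrite /s le_max lexx orbT. Qed.

Let C0 : 0 <= C. Proof. by rewrite addr_ge0. Qed.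

Let s_ae n : {ae P n, forall w, forall k, (1 <= k <= n)%N -> s0 n k w = s n k w}.
Proof.
apply/ae_foralln => k; case: (boolP (1 <= k <= n)%N) => kn; last exact: aeW.
have [_ iX _] := hX kn.
apply: filterS (is_cond_exp_ge0 (sF _) iX (hs0 kn) (fun w => sqr_ge0 _)) => w h _.
by rewrite /s max_l.
Qed.

Let hs n k : (1 <= k <= n)%N ->
  is_cond_exp (P n) (F k.-1) (fun w => X n k w ^+ 2) (s n k).
Proof.
move=> kn; apply: is_cond_exp_ae (hs0 kn) _ _ => //.
  have [ss _ _] := hs0 kn.
  exact: (sub_measurable_max (sF _) ss (sub_measurable_cst 0 (sF _))).
by apply: filterS (s_ae n) => w; apply.
Qed.

Let s_cvg eta : 0 < eta ->
  whp P (fun n => [set w | `|\sum_(1 <= k < n.+1) s n k w - v| <= eta]).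
Proof.
move=> eta0; have h1 := variance_cvg eta0.
have h2 : whp P (fun n => [set w | forall k, (1 <= k <= n)%N -> s0 n k w = s n k w]).
  by apply: whp_ae; exact: nearW.
apply: whp_sub (whpI h1 h2); apply: nearW => n w /= [+ h].
rewrite big_nat [in X in _ -> X]big_nat.
by under eq_bigr do rewrite h//.
Qed.

Let good : whp P (fun n => [set w |
  (forall k, (1 <= k <= n)%N -> Y n k w = X n k w) /\
  (forall k, (1 <= k <= n)%N -> t n k w = s n k w)]).
Proof.
apply: whp_sub (s_cvg ltr01); apply: nearW => n w /= h.
have hC : \sum_(1 <= k < n.+1) s n k w <= C.
  by rewrite /C; move: h; rewrite ler_norml => /andP[_]; rewrite lerBlDl.
exact: (stopped_eq (n := n) (X n) (fun k w => @s_ge0 n k w) hC).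
Qed.

Let mdY n k : (1 <= k <= n)%N -> mdiff (P n) F k (Y n k).
Proof.
move=> kn.
exact: (stopped_mdiff sF FS C (@hX n) (@hs n) kn).
Qed.

Let hsY n k : (1 <= k <= n)%N ->
  is_cond_exp (P n) (F k.-1) (fun w => Y n k w ^+ 2) (t n k).
Proof.
move=> kn.
exact: (stopped_cond_exp sF FS C (@hX n) (@hs n) kn).
Qed.

Let t_ge0 n k w : (1 <= k <= n)%N -> 0 <= t n k w.
Proof. exact: (stopped_ge0 C (@s_ge0 n) w). Qed.

Let t_sum n w : \sum_(1 <= k < n.+1) t n k w <= C.
Proof. by have := stopped_sum_le (@s_ge0 n) C0 w. Qed.

Let tail e n := \sum_(1 <= k < n.+1) \int[P n]_w tail_sqr e (Y n k w).

Let tail_cvg e eps : 0 < e -> 0 < eps -> \forall n \near \oo, tail e n <= eps.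
Proof.
move=> e0 eps0; have [Z [l [h1 h2 h3 h4]]] := lindeberg e0.
have eps2 : 0 < eps / 2 by rewrite divr_gt0.
have p0 : 0 < eps / 2 / (C + 1) by rewrite divr_gt0// ltr_wpDl.
near=> n.
have [A [mA sA PA]] : exists A, [/\ measurable A,
    ~` [set w | \sum_(1 <= k < n.+1) l n k w <= eps / 2] `<=` A &
    (P n A <= (eps / 2 / (C + 1))%:E)%E].
  by near: n; exact: h4.
have := @stopped_tail_sum_le _ _ _ (P n) F sF FS n (X n) (s n) C (fun k kn => hX kn)
  (fun k kn => hs kn) (fun k w => @s_ge0 n k w) C0 e (Z n) (l n) A (eps / 2) _
  (ltW e0) (ltW eps2) (h1 n) (h2 n) (h3 n) mA sA PA.
move=> /le_trans; apply.
have : C * (eps / 2 / (C + 1)) <= eps / 2.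
  rewrite mulrCA ler_piMr ?(ltW eps2)// ler_pdivrMr ?ltr_wpDl//; lra.
lra.
Unshelve. all: by end_near. Qed.

(** A single stopped increment above [eta] pushes the sum of truncated squares above [eta ^+ 2], and
    the mean of that sum tends to 0. *)
Lemma martingale_array_max eta : 0 < eta ->
  whp P (fun n => [set w | forall k, (1 <= k <= n)%N -> `|X n k w| <= eta]).
Proof.
move=> eta0; have eta2 : 0 < eta ^+ 2 by rewrite exprn_gt0.
have h : whp P (fun n => [set w | \sum_(1 <= k < n.+1) tail_sqr eta (Y n k w) <= eta ^+ 2]).
  have it n : L1 (P n) (fun w => \sum_(1 <= k < n.+1) tail_sqr eta (Y n k w)).
    under eq_fun do rewrite big_nat; apply: L1_sum => k kn.
    apply: L1_tail_sqr; first exact: mdiff_measurable (mdY kn).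
    by case: (mdY kn).
  apply: (whp_bound (f := fun n w => \sum_(1 <= k < n.+1) tail_sqr eta (Y n k w))).
    by apply: nearW => n; exact: L1_measurable (it n).
  move=> eps eps0; near=> n.
  apply: le_trans (E_markov eta2 (it n) _) _.
    by move=> w; apply: sumr_ge0 => k _; exact: tail_sqr_ge0.
  rewrite lee_fin ler_pdivrMr//.
  have -> : \int[P n]_w (\sum_(1 <= k < n.+1) tail_sqr eta (Y n k w)) = tail eta n.
    rewrite /tail; under eq_fun do rewrite big_nat.
    rewrite E_sum -?big_nat// => k kn.
    by apply: L1_tail_sqr; [exact: mdiff_measurable (mdY kn)|case: (mdY kn)].
  by near: n; apply: tail_cvg => //; rewrite mulr_gt0.
apply: whp_sub (whpI good h); apply: nearW => n w /= [[hY _] ht] k kn.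
rewrite -hY// leNgt; apply/negP => hlt.
move: ht; rewrite leNgt => /negP; apply.
rewrite (bigD1_seq k) ?mem_index_iota ?iota_uniq//= ltr_wpDr//.
  by apply: sumr_ge0 => i _; exact: tail_sqr_ge0.
rewrite /tail_sqr hlt mulr1 -[ltRHS]real_normK ?num_real//.
by rewrite ltr_pXn2r// nnegrE ltW.
Unshelve. all: by end_near. Qed.

(** Chebyshev's inequality for the stopped sum, whose second moment is at most [C]. Stopped and
    original sums agree with probability tending to one. *)
Lemma martingale_array_tight eps : 0 < eps -> exists M : R, 0 < M /\
  \forall n \near \oo, exists A, [/\ measurable A,
    ~` [set w | `|\sum_(1 <= k < n.+1) X n k w| <= M] `<=` A & (P n A <= eps%:E)%E].
Proof.
move=> eps0; have e2 : 0 < eps / 2 by rewrite divr_gt0.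
pose M2 := C / (eps / 2) + 1.
have M20 : 0 < M2 by rewrite ltr_wpDl// divr_ge0// ltW.
exists (Num.sqrt M2); split; first by rewrite sqrtr_gt0.
near=> n.
have [A [mA sA PA]] : exists A, [/\ measurable A,
    ~` [set w | (forall k, (1 <= k <= n)%N -> Y n k w = X n k w) /\
                (forall k, (1 <= k <= n)%N -> t n k w = s n k w)] `<=` A &
    (P n A <= (eps / 2)%:E)%E].
  by near: n; exact: good.
have [iS ES] := mdiff_sum_L2 sF FS (fun k (kn : (1 <= k <= n)%N) => mdY kn).
pose S2 w := (\sum_(1 <= k < n.+1) Y n k w) ^+ 2.
have mB : measurable [set w | M2 < S2 w].
  rewrite (_ : [set w | _] = setT `&` S2 @^-1` `]M2, +oo[%classic).
    exact: (L1_measurable iS).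
  by rewrite setTI; apply/seteqP; split => w /=; rewrite in_itv/= andbT.
exists (A `|` [set w | M2 < S2 w]); split; first exact: measurableU.
- move=> w /= hw; have [|nA] := pselect (A w); [by left|right].
  have [hY _] := contrapT (fun h => nA (sA w h)).
  move: hw => /negP; rewrite -ltNge => hw.
  rewrite /S2 big_nat (eq_bigr (fun k => X n k w)); last by move=> k kn; exact: hY.
  rewrite -big_nat -(sqr_sqrtr (ltW M20)) -[ltRHS]real_normK ?num_real//.
  by rewrite ltr_pXn2r ?nnegrE// sqrtr_ge0.
- apply: le_trans (measureU2 _ mA mB) _.
  rewrite [eps in leRHS]splitr EFinD leeD//.
  apply: le_trans (E_markov M20 iS (fun w => sqr_ge0 _)) _.
  rewrite lee_fin ler_pdivrMr// ES.
  apply: (@le_trans _ _ C).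
    exact: (sum_E_sqr sF (fun k kn => mdY kn) (fun k kn => hsY kn) (@t_sum n)).
  by rewrite /M2 mulrDr mulr1 mulrC divfK ?gt_eqF// lerDl ltW.
Unshelve. all: by end_near. Qed.

Lemma martingale_array_quadratic_variation eta : 0 < eta ->
  whp P (fun n => [set w | `|\sum_(1 <= k < n.+1) X n k w ^+ 2 - v| <= eta]).
Proof.
move=> eta0; have eta2 : 0 < eta / 2 by rewrite divr_gt0.
have h : whp P (fun n => [set w | `|\sum_(1 <= k < n.+1) Y n k w ^+ 2 -
    \sum_(1 <= k < n.+1) t n k w| <= eta / 2]).
  apply: (whp_bound (f := fun n w => `|\sum_(1 <= k < n.+1) Y n k w ^+ 2 -
      \sum_(1 <= k < n.+1) t n k w|)).
    apply: nearW => n; apply: measurableT_comp => //.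
    apply: (L1_measurable (P := P n)); apply: L1B; under eq_fun do rewrite big_nat;
      apply: L1_sum => k kn.
      by case: (mdY kn).
    exact: is_cond_exp_L1 (hsY kn).
  (* With truncation level [Num.sqrt b], the first term of [bounded_quadratic_variation] at level
     [eta / 2] is at most [eps / 2]; [C + 1] replaces [C] to keep the denominator positive. *)
  move=> eps eps0; pose b := eps / 2 * (eta / 2) ^+ 2 / (4 * (C + 1)).
  have b0 : 0 < b.
    by rewrite divr_gt0 ?mulr_gt0 ?divr_gt0 ?exprn_gt0// ltr_wpDl.
  have e0 : 0 < Num.sqrt b by rewrite sqrtr_gt0.
  near=> n.
  have := @bounded_quadratic_variation _ _ _ (P n) F sF FS n (Y n) (t n) C (Num.sqrt b)
    (@mdY n) (@hsY n) (@t_sum n) (ltW e0) (eta / 2) eta2.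
  move=> /le_trans; apply.
  rewrite lee_fin [leRHS]splitr; apply: lerD.
    rewrite sqr_sqrtr ?(ltW b0)// ler_pdivrMr ?exprn_gt0// /b.
    have -> : 4 * (eps / 2 * (eta / 2) ^+ 2 / (4 * (C + 1)) * C) =
      (eps / 2 * (eta / 2) ^+ 2) * (C / (C + 1)).
      by field; rewrite gt_eqF// ltr_wpDl.
    rewrite ler_piMr ?mulr_ge0 ?sqr_ge0 ?divr_ge0 ?(ltW eps0) ?(ltW eta0)//.
    by rewrite ler_pdivrMr ?ltr_wpDl//; lra.
  rewrite ler_pdivrMr// -ler_pdivlMl//.
  by near: n; apply: (tail_cvg e0); rewrite mulr_gt0 ?invr_gt0// mulr_gt0// divr_gt0.
apply: whp_sub (whpI good (whpI h (s_cvg eta2))).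
apply: nearW => n w /= [[hY ht] [h1 h2]].
have e1 : \sum_(1 <= k < n.+1) Y n k w ^+ 2 = \sum_(1 <= k < n.+1) X n k w ^+ 2.
  by rewrite big_nat [RHS]big_nat; apply: eq_bigr => k kn; rewrite hY.
have e2 : \sum_(1 <= k < n.+1) t n k w = \sum_(1 <= k < n.+1) s n k w.
  by rewrite big_nat [RHS]big_nat; apply: eq_bigr => k kn; rewrite ht.
rewrite e1 e2 in h1.
move: h1 h2; set a := \sum_(1 <= k < _) _; set b := \sum_(1 <= k < _) _.
rewrite !ler_norml => /andP[? ?] /andP[? ?]; apply/andP; split; lra.
Unshelve. all: by end_near. Qed.

(** [bounded_clt] gives the limit of a weighted mean [G] of the stopped sums. The random weight
    [expR (V n w / 2)] is then replaced by the constant [expR (v / 2)], and the stopped sums by the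
    original ones, outside an event of probability at most [p]. *)
Lemma martingale_array_clt phi :
  (fun n => \int[P n]_w cos (\sum_(1 <= k < n.+1) X n k w + phi)) @ \oo -->
  cos phi * expR (- (v / 2)).
Proof.
pose K := expR (C / 2).
have K0 : 0 < K by exact: expR_gt0.
have mcosp : measurable_fun setT (fun x : R => cos (x + phi)).
  apply: (measurableT_comp (f := @cos R)); last exact: measurable_funD.
  by apply: continuous_measurable_fun; exact: continuous_cos.
have bcos (x : R) : `|cos x| <= 1 by rewrite ler_norml cos_geN1 cos_le1.
pose SX n w := \sum_(1 <= k < n.+1) X n k w.
pose SY n w := \sum_(1 <= k < n.+1) Y n k w.
pose V n w := \sum_(1 <= k < n.+1) t n k w.
have mSX n : measurable_fun setT (SX n).
  by apply: (sub_measurable_fun (sF n)); exact: mdiff_sum_measurable (@hX n).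
have mSY n : measurable_fun setT (SY n).
  by apply: (sub_measurable_fun (sF n)); exact: mdiff_sum_measurable (@mdY n).
have mV n : measurable_fun setT (V n).
  apply: (L1_measurable (P := P n)); rewrite /V; under eq_fun do rewrite big_nat.
  by apply: L1_sum => k kn; exact: is_cond_exp_L1 (hsY kn).
have icX n : L1 (P n) (fun w => cos (SX n w + phi)).
  by apply: (L1_bounded (P n) _ (fun w => bcos _)); exact: measurableT_comp mcosp _.
have icY n : L1 (P n) (fun w => cos (SY n w + phi)).
  by apply: (L1_bounded (P n) _ (fun w => bcos _)); exact: measurableT_comp mcosp _.
have V0 n w : 0 <= V n w.
  by rewrite /V big_nat sumr_ge0// => k kn; exact: t_ge0.
have bV n w : `|expR (V n w / 2)| <= K.
  by rewrite ger0_norm ?expR_ge0// ler_expR ler_wpM2r// t_sum.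
have mexp n : measurable_fun setT (fun w => expR (V n w / 2)).
  by apply: (measurableT_comp (@measurable_expR R)); exact: measurable_funM.
have iG n : L1 (P n) (fun w => expR (V n w / 2) * cos (SY n w + phi)).
  exact: L1_bmul (mexp n) (bV n) (icY n).
have bv : `|expR (v / 2)| <= K.
  by rewrite ger0_norm ?expR_ge0// ler_expR /C; lra.
apply/cvgrPdist_le => eps eps0.
(* Four errors of [eps / 4] each: the bad event ([p]), the distance of the weight from its limit
   ([kap]), the truncation level ([e]) and the sum of tails. *)
pose p := eps / (8 * (K + 1)).
have K1 : 0 < K + 1 by rewrite addr_gt0.
have p0 : 0 < p by rewrite divr_gt0// mulr_gt0.
have eps4 : 0 < eps / 4 by rewrite divr_gt0.
pose e := Num.min 1 (eps / (12 * K * (C + 1))).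
have C1 : 0 < C + 1 by rewrite ltr_wpDl.
have e0 : 0 < e by rewrite lt_min ltr01 divr_gt0// !mulr_gt0.
have [kap [kap0 hkap]] : exists kap : R, 0 < kap /\
    forall x, `|x - v| <= kap -> `|expR (x / 2) - expR (v / 2)| <= eps / 4.
  have cexp : {for v, continuous (fun x : R => expR (x / 2))}.
    apply: continuous_comp; first exact: mulrr_continuous.
    exact: continuous_expR.
  have /cvgrPdist_le /(_ _ eps4) := cexp.
  case=> r /= r0 h; exists (r / 2); split; first by rewrite divr_gt0.
  move=> x hx; rewrite distrC; apply: h; rewrite /= distrC; apply: le_lt_trans hx _.
  by rewrite ltr_pdivrMr// ltr_pMr// ltr1n.
near=> n.
have [A [mA sA PA]] : exists A, [/\ measurable A,
    ~` ([set w | (forall k, (1 <= k <= n)%N -> Y n k w = X n k w) /\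
                (forall k, (1 <= k <= n)%N -> t n k w = s n k w)] `&`
       [set w | `|\sum_(1 <= k < n.+1) s n k w - v| <= kap]) `<=` A &
    (P n A <= p%:E)%E].
  by near: n; exact: whpI good (s_cvg kap0) _ p0.
have hA w : ~ A w -> SX n w = SY n w /\ `|V n w - v| <= kap.
  move=> nA; have [[hY ht] hsv] := contrapT (fun h => nA (sA w h)).
  split; first by rewrite /SX /SY big_nat [RHS]big_nat; apply: eq_bigr => k kn; rewrite hY.
  rewrite /V; move: hsv => /=; rewrite big_nat (eq_bigr (fun k => t n k w)) -?big_nat//.
  by move=> k kn; rewrite ht.
have ht : tail e n <= eps / (4 * K * (3 + C)).
  near: n; apply: tail_cvg => //.
  by rewrite divr_gt0// !mulr_gt0// ltr_pwDl.
set En := \int[P n]_w cos (SX n w + phi).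
pose EY := \int[P n]_w cos (SY n w + phi).
pose G := \int[P n]_w (expR (V n w / 2) * cos (SY n w + phi)).
have h1 : `|En - EY| <= 2 * p.
  rewrite -E_B//; apply: le_trans (E_norm (L1B (icX n) (icY n))) _.
  rewrite -[leRHS]add0r; apply: (E_le_off _ mA PA) => //.
  - exact/L1_norm/L1B.
  - apply: aeW => w; apply: le_trans (ler_normB _ _) _.
    by have := bcos (SX n w + phi); have := bcos (SY n w + phi); lra.
  - by apply: aeW => w nA; have [-> _] := hA w nA; rewrite subrr normr0.
have h2 : `|G - expR (v / 2) * EY| <= eps / 4 + (2 * K) * p.
  rewrite -E_Z// -E_B//; last exact: L1Z.
  apply: le_trans (E_norm (L1B (iG n) (L1Z _ (icY n)))) _.
  apply: (E_le_off _ mA PA) => //.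
  - by apply/L1_norm/L1B => //; exact: L1Z.
  - by rewrite mulr_ge0// ltW.
  - exact: ltW.
  - apply: aeW => w; apply: le_trans (ler_normB _ _) _; rewrite !normrM.
    have := ler_pM (normr_ge0 _) (normr_ge0 _) (bV n w) (bcos (SY n w + phi)).
    have := ler_pM (normr_ge0 _) (normr_ge0 _) bv (bcos (SY n w + phi)).
    by lra.
  - apply: aeW => w nA; have [_ hV] := hA w nA.
    rewrite -mulrBl normrM -[leRHS]mulr1; apply: ler_pM => //.
    exact: hkap.
have h3 : `|G - cos phi| <= K * ((2 * e + e ^+ 2) * C + (3 + C) * tail e n).
  exact: (bounded_clt sF FS (@mdY n) (@hsY n) (@t_ge0 n) (@t_sum n) (ltW e0) phi).
have ev : expR (- (v / 2)) * expR (v / 2) = 1 by rewrite -expRD addNr expR0.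
have ev1 : expR (- (v / 2)) <= 1 by rewrite -[leRHS]expR0 ler_expR oppr_le0 divr_ge0.
have evp := expR_gt0 (- (v / 2)).
(* Multiplication by [expR (- (v / 2)) <= 1] turns the comparisons [h1], [h2] and [h3] into a bound
   on the distance to the limit. *)
have -> : cos phi * expR (- (v / 2)) - En =
  expR (- (v / 2)) * ((G - expR (v / 2) * EY) - (G - cos phi)) - (En - EY).
  rewrite (_ : expR (- (v / 2)) * (_ - _) =
     cos phi * expR (- (v / 2)) - (expR (- (v / 2)) * expR (v / 2)) * EY); last by ring.
  by rewrite ev; ring.
apply: le_trans (ler_normB _ _) _; rewrite normrM (gtr0_norm evp).
have h4 : expR (- (v / 2)) * `|(G - expR (v / 2) * EY) - (G - cos phi)| <=
   `|G - expR (v / 2) * EY| + `|G - cos phi|.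
  by apply: le_trans (ler_normB _ _); rewrite ler_piMl.
have e1 : e <= 1 by rewrite ge_min lexx.
have h5 : K * ((2 * e + e ^+ 2) * C) <= eps / 4.
  have e2 : e <= eps / (12 * K * (C + 1)) by rewrite ge_min lexx orbT.
  have e3 : 2 * e + e ^+ 2 <= 3 * e by rewrite expr2; have := ler_piMl (ltW e0) e1; lra.
  apply: (@le_trans _ _ (K * ((3 * e) * C))).
    by rewrite ler_wpM2l ?(ltW K0)// ler_wpM2r.
  apply: (@le_trans _ _ (K * ((3 * (eps / (12 * K * (C + 1)))) * C))).
    by rewrite ler_wpM2l ?(ltW K0)// ler_wpM2r// ler_wpM2l.
  rewrite (_ : K * (3 * (eps / (12 * K * (C + 1))) * C) = eps / 4 * (C / (C + 1))); last first.
    by field; rewrite !gt_eqF.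
  by rewrite ler_piMr ?(ltW eps4)// ler_pdivrMr//; lra.
have h6 : K * ((3 + C) * tail e n) <= eps / 4.
  have C3 : 0 < 3 + C by rewrite ltr_pwDl.
  apply: (@le_trans _ _ (K * ((3 + C) * (eps / (4 * K * (3 + C)))))).
    by rewrite ler_wpM2l ?(ltW K0)// ler_wpM2l// ltW.
  by rewrite (_ : K * _ = eps / 4)//; field; rewrite !gt_eqF.
have h7 : 2 * p + (2 * K) * p = eps / 4.
  by rewrite /p; field; rewrite gt_eqF.
rewrite mulrDr in h3.
by lra.
Unshelve. all: by end_near. Qed.

End martingale_array.

(** * Bernstein polynomials *)
Section bernstein.
Context (R : realType).
Implicit Types (u v : R).

Definition bernstein N i u : R := 'C(N, i)%:R * u ^+ i * (1 - u) ^+ (N - i).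

Lemma bernstein_ge0 N i u : 0 <= u <= 1 -> 0 <= bernstein N i u.
Proof. by move=> /andP[u0 u1]; rewrite !mulr_ge0// exprn_ge0// subr_ge0. Qed.

Lemma bernstein_sum N u : \sum_(i < N.+1) bernstein N i u = 1.
Proof.
rewrite -[RHS](expr1n _ N) -[X in X ^+ N](subrK u 1) exprDn.
by apply: eq_bigr => i _; rewrite /bernstein -[RHS]mulr_natl; ring.
Qed.

(* [i C(N+1,i) = (N+1) C(N,i-1)] lowers the degree. *)
Lemma bernstein_mean N u : \sum_(i < N.+1) i%:R * bernstein N i u = N%:R * u.
Proof.
case: N => [|N]; first by rewrite big_ord1 !mul0r.
rewrite big_ord_recl mul0r add0r.
rewrite (eq_bigr (fun i : 'I_N.+1 => (N.+1%:R * u) * bernstein N i u)).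
  by rewrite -mulr_sumr bernstein_sum mulr1.
move=> i _; rewrite /bernstein /= /bump /= add1n subSS exprS.
have -> : (i.+1%:R : R) * ('C(N.+1, i.+1)%:R * (u * u ^+ i) * (1 - u) ^+ (N - i)) =
   (i.+1 * 'C(N.+1, i.+1))%:R * (u * u ^+ i) * (1 - u) ^+ (N - i).
  by rewrite natrM; ring.
by rewrite -mul_bin_diag natrM; ring.
Qed.

Lemma bernstein_second N u :
  \sum_(i < N.+1) (i%:R * (i%:R - 1)) * bernstein N i u = N%:R * (N%:R - 1) * u ^+ 2.
Proof.
case: N => [|N]; first by rewrite big_ord1 !mul0r.
rewrite big_ord_recl !mul0r add0r.
rewrite (eq_bigr (fun i : 'I_N.+1 => (N.+1%:R * u) * (i%:R * bernstein N i u))).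
  by rewrite -mulr_sumr bernstein_mean -natr1; ring.
move=> i _; rewrite /bernstein /= /bump /= add1n subSS exprS.
have -> : (i.+1%:R * (i.+1%:R - 1) : R) * ('C(N.+1,
  i.+1)%:R * (u * u ^+ i) * (1 - u) ^+ (N - i)) =
   (i.+1 * 'C(N.+1, i.+1))%:R * (i%:R * (u * u ^+ i) * (1 - u) ^+ (N - i)).
  by rewrite natrM -natr1; ring.
by rewrite -mul_bin_diag natrM; ring.
Qed.

(** The exact value is [u (1 - u) / (N + 1)], the variance of the mean of [N + 1] Bernoulli
    variables. *)
Lemma bernstein_variance N u : 0 <= u <= 1 ->
  \sum_(i < N.+2) (u - i%:R / N.+1%:R) ^+ 2 * bernstein N.+1 i u <= N.+1%:R^-1.
Proof.
move=> /andP[u0 u1]; pose c : R := N.+1%:R.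
have c0 : c != 0 by rewrite pnatr_eq0.
rewrite -/c.
rewrite (eq_bigr (fun i : 'I_N.+2 => u ^+ 2 * bernstein N.+1 i u +
   ((c^-2 - 2 * u / c) * (i%:R * bernstein N.+1 i u) +
    c^-2 * ((i%:R * (i%:R - 1)) * bernstein N.+1 i u)))); last first.
  by move=> i _; field.
rewrite !big_split/= -!mulr_sumr bernstein_sum bernstein_mean bernstein_second -/c.
rewrite (_ : _ + _ = c^-1 * (u * (1 - u))); last by field.
rewrite ler_piMr ?invr_ge0//.
have : 0 <= u * (1 - u) by rewrite mulr_ge0// subr_ge0.
by have := sqr_ge0 u; nra.
Qed.

(* Points with [|u - i/N| >= r] are charged at most [1/(N r^2)] (Chebyshev). *)
Lemma bernstein2_approx (f : R -> R -> R) (M eps r : R) : 0 < r -> 0 < eps ->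
  (forall u v, 0 <= u <= 1 -> 0 <= v <= 1 -> `|f u v| <= M) ->
  (forall u v u' v', 0 <= u <= 1 -> 0 <= v <= 1 -> 0 <= u' <= 1 -> 0 <= v' <= 1 ->
    `|u - u'| < r -> `|v - v'| < r -> `|f u v - f u' v'| <= eps) ->
  exists N, forall u v, 0 <= u <= 1 -> 0 <= v <= 1 ->
    `|f u v - \sum_(i < N.+2) \sum_(j < N.+2) f (i%:R / N.+1%:R) (j%:R / N.+1%:R) *
        (bernstein N.+1 i u * bernstein N.+1 j v)| <= 2 * eps.
Proof.
move=> r0 eps0 hM hr.
have M0 : 0 <= M by apply: le_trans (hM 0 0 _ _); rewrite ?lexx ?ler01.
have r2 : 0 < r ^+ 2 by rewrite exprn_gt0.
pose N := Num.bound (4 * M / r ^+ 2 / eps).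
exists N => u v hu hv.
have hN : 4 * M / r ^+ 2 * N.+1%:R^-1 <= eps.
  rewrite -/(_ / _) /N; set a := 4 * M / r ^+ 2.
  rewrite ler_pdivrMr ?ltr0Sn// mulrC -ler_pdivrMr//.
  apply: ltW; apply: (lt_le_trans (archi_boundP _)); last by rewrite ler_nat.
  by rewrite !divr_ge0// ?mulr_ge0// ltW.
have pt (i : 'I_N.+2) : 0 <= (i%:R / N.+1%:R : R) <= 1.
  rewrite divr_ge0//= ler_pdivrMr ?ltr0Sn// mul1r ler_nat -ltnS; exact: ltn_ord.
pose b (i j : 'I_N.+2) := bernstein N.+1 i u * bernstein N.+1 j v.
have b0 i j : 0 <= b i j by rewrite mulr_ge0// bernstein_ge0.
have sb : \sum_i \sum_j b i j = 1.
  rewrite /b; under eq_bigr do rewrite -mulr_sumr bernstein_sum mulr1.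
  exact: bernstein_sum.
have fE : f u v = \sum_i \sum_j f u v * b i j.
  rewrite -[LHS]mulr1 -[in LHS]sb mulr_sumr; apply: eq_bigr => i _.
  by rewrite mulr_sumr.
rewrite {1}fE -sumrB.
(* [c i j] dominates the crude bound [2 * M] as soon as one coordinate is off by at least [r]. Its
   Bernstein mean is at most [4 * M / r ^+ 2 / N.+1], which the choice of [N] makes at most
   [eps]. *)
pose c (i j : 'I_N.+2) := 2 * M / r ^+ 2 * ((u - i%:R / N.+1%:R) ^+ 2 +
  (v - j%:R / N.+1%:R) ^+ 2).
apply: (@le_trans _ _ (\sum_i \sum_j (eps * b i j + c i j * b i j))).
  apply: le_trans (ler_norm_sum _ _ _) _; apply: ler_sum => i _.
  rewrite -sumrB; apply: le_trans (ler_norm_sum _ _ _) _; apply: ler_sum => j _.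
  rewrite -mulrBl normrM (ger0_norm (b0 i j)) -mulrDl; apply: ler_wpM2r => //.
  have cc : 0 <= c i j by rewrite mulr_ge0 ?addr_ge0 ?sqr_ge0// divr_ge0 ?mulr_ge0// ltW.
  have far x y z : 0 <= z -> r <= `|x - y| -> 2 * M <= 2 * M / r ^+ 2 * ((x - y) ^+ 2 + z).
    move=> z0 h; rewrite -mulrA ler_peMr ?mulr_ge0// ler_pdivlMl// mulr1.
    have : r ^+ 2 <= (x - y) ^+ 2.
      by rewrite -[leRHS]real_normK ?num_real// ler_pXn2r ?nnegrE ?(ltW r0).
    by lra.
  have le2M : `|f u v - f (i%:R / N.+1%:R) (j%:R / N.+1%:R)| <= 2 * M.
    apply: le_trans (ler_normB _ _) _.
    by have := hM u v hu hv; have := hM _ _ (pt i) (pt j); lra.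
  have [h1|h1] := ltP `|u - i%:R / N.+1%:R| r; last first.
    by have := far _ _ _ (sqr_ge0 (v - j%:R / N.+1%:R)) h1; rewrite -/(c i j); lra.
  have [h2|h2] := ltP `|v - j%:R / N.+1%:R| r; last first.
    have := far _ _ _ (sqr_ge0 (u - i%:R / N.+1%:R)) h2.
    by rewrite [_ ^+ 2 + _ ^+ 2]addrC -/(c i j); lra.
  by have := hr _ _ _ _ hu hv (pt i) (pt j) h1 h2; lra.
have e1 : \sum_i \sum_j (eps * b i j + c i j * b i j) = eps + 2 * M / r ^+ 2 *
   (\sum_(i < N.+2) (u - i%:R / N.+1%:R) ^+ 2 * bernstein N.+1 i u +
    \sum_(j < N.+2) (v - j%:R / N.+1%:R) ^+ 2 * bernstein N.+1 j v).
  under eq_bigr do rewrite big_split/= -mulr_sumr.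
  rewrite big_split/= -mulr_sumr sb mulr1; congr (_ + _).
  under eq_bigr => i _.
    rewrite (eq_bigr (fun j : 'I_N.+2 => (2 * M / r ^+ 2 *
      ((u - i%:R / N.+1%:R) ^+ 2 * bernstein N.+1 i u)) * bernstein N.+1 j v +
      (2 * M / r ^+ 2 * bernstein N.+1 i u) *
      ((v - j%:R / N.+1%:R) ^+ 2 * bernstein N.+1 j v))); last first.
      by move=> j _; rewrite /c /b; ring.
    rewrite big_split/= -!mulr_sumr bernstein_sum mulr1.
    over.
  rewrite big_split/= -mulr_sumr mulrDr; congr (_ + _).
  by rewrite -mulr_suml -mulr_sumr bernstein_sum mulr1.
rewrite e1 (_ : 2 * eps = eps + eps); last by ring.
rewrite lerD2l.
apply: le_trans hN.
have v1 := bernstein_variance N hu; have v2 := bernstein_variance N hv.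
rewrite (_ : 4 * M / r ^+ 2 * N.+1%:R^-1 = 2 * M / r ^+ 2 * (N.+1%:R^-1 + N.+1%:R^-1));
  last by ring.
by apply: ler_wpM2l; [rewrite divr_ge0 ?mulr_ge0// ltW|exact: lerD].
Qed.

End bernstein.

(** * Dyadic energies of W^{1,2} functions *)

Section test_functions.
Context (R : realType).
Implicit Types x h p q a b : R.

(** Squared positive parts are continuously differentiable, which is the regularity [C1c] demands;
    combinations of them give smoothed indicators with explicit derivatives. *)
Definition pos_part_sqr x : R := Num.max x 0 ^+ 2.

Lemma pos_part_sqr_derive x : h^-1 *: (pos_part_sqr (h + x) - pos_part_sqr x) @[h --> 0^'] -->
  2 * Num.max x 0.
Proof.
apply/cvgrPdist_le => e e0; exists e => //= h.
rewrite /ball_/= sub0r normrN => he h0.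
have hp : 0 < `|h| by rewrite normr_gt0.
apply: (@le_trans _ _ `|h|); last exact: ltW.
rewrite -(ler_pM2r hp) -normrM -expr2.
rewrite (_ : (_ - _) * h = 2 * Num.max x 0 * h - (pos_part_sqr (h + x) - pos_part_sqr x));
  last first.
  by rewrite mulrBl mulrC /GRing.scale/=; congr (_ - _); rewrite mulrC mulrA mulfV// mul1r.
rewrite /pos_part_sqr real_normK ?num_real// ler_norml.
have := sqr_ge0 h; have := sqr_ge0 x; have := sqr_ge0 (h + x).
by case: (leP x 0) => ?; case: (leP (h + x) 0) => ? ? ? ?; apply/andP; split; nra.
Qed.

Lemma is_derive_pos_part_sqr x : is_derive x (1 : R) pos_part_sqr (2 * Num.max x 0).
Proof.
have hc := @pos_part_sqr_derive x.
have hc' : h^-1 *: (pos_part_sqr (h *: (1 : R) + x) - pos_part_sqr x) @[h --> 0^'] -->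
  2 * Num.max x 0.
  by under eq_fun do rewrite [_ *: 1]mulr1.
apply: DeriveDef; first by apply/cvg_ex; eexists; exact: hc'.
by apply: cvg_lim hc'.
Qed.

(* The primitive of the tent function supported in [0, 1] with integral 1. *)
Definition smooth_step x : R :=
  2 * pos_part_sqr x - 4 * pos_part_sqr (x - 2^-1) + 2 * pos_part_sqr (x - 1).

Definition tent x : R :=
  4 * Num.max x 0 - 8 * Num.max (x - 2^-1) 0 + 4 * Num.max (x - 1) 0.

Lemma is_derive_smooth_step x : is_derive x (1 : R) smooth_step (tent x).
Proof.
have h0 := is_derive_pos_part_sqr x.
have hs c : is_derive x (1 : R) (fun y => pos_part_sqr (y - c)) (2 * Num.max (x - c) 0).
  have h1 : is_derive x (1 : R) (fun y => y - c) 1.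
    by apply: is_derive_eq; rewrite subr0.
  have := @is_derive1_comp R pos_part_sqr (fun y => y - c) x (2 * Num.max (x - c) 0) 1
    (is_derive_pos_part_sqr _) h1.
  by rewrite mulr1.
have h1 := hs 2^-1; have h2 := hs 1.
rewrite /smooth_step; apply: is_derive_eq.
rewrite /tent /GRing.scale/=; ring.
Qed.

Lemma smooth_step_le0 x : x <= 0 -> smooth_step x = 0.
Proof.
move=> x0; rewrite /smooth_step /pos_part_sqr !max_r; first ring; lra.
Qed.

Lemma smooth_step_ge1 x : 1 <= x -> smooth_step x = 1.
Proof.
move=> x1; rewrite /smooth_step /pos_part_sqr !max_l; first field; lra.
Qed.

Lemma tent_out x : x <= 0 \/ 1 <= x -> tent x = 0.
Proof.
move=> [x0|x1]; rewrite /tent; first by rewrite !max_r; first ring; lra.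
by rewrite !max_l; first field; lra.
Qed.

Lemma tent_ge0 x : 0 <= tent x.
Proof.
rewrite /tent; case: (leP x 0) => ?; case: (leP (x - 2^-1) 0) => ?;
  case: (leP (x - 1) 0) => ?; lra.
Qed.

Lemma smooth_step_itv x : 0 <= smooth_step x <= 1.
Proof.
rewrite /smooth_step /pos_part_sqr; have := sqr_ge0 x; have := sqr_ge0 (x - 1).
case: (leP x 0) => ?; case: (leP (x - 2^-1) 0) => ?;
  case: (leP (x - 1) 0) => ? ? ?; apply/andP; split; nra.
Qed.

Lemma continuous_tent : continuous tent.
Proof.
have cm : continuous (fun y : R => Num.max y 0).
  by move=> x; apply: (@continuous_max R R id (cst 0) x); [exact: cvg_id|exact: cvg_cst].
have cs c : continuous (fun y : R => Num.max (y - c) 0).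
  move=> x; apply: (@continuous_comp _ _ _ (fun y => y - c) (fun y => Num.max y 0) x).
    by apply: cvgB; [exact: cvg_id|exact: cvg_cst].
  exact: cm.
move=> x; apply: cvgD; [apply: cvgB|]; apply: cvgM; try exact: cvg_cst.
- exact: cm.
- exact: cs.
- exact: cs.
Qed.

Definition step h p x : R := smooth_step ((x - p) / h).
Definition bump h p x : R := tent ((x - p) / h) / h.

Lemma is_derive_step h p x : is_derive x (1 : R) (step h p) (bump h p x).
Proof.
have h1 : is_derive x (1 : R) (fun y => (y - p) / h) h^-1.
  by apply: is_derive_eq; rewrite /GRing.scale/= ; ring.
have := @is_derive1_comp R smooth_step (fun y =>
  (y - p) / h) x (tent ((x - p) / h)) h^-1 (is_derive_smooth_step _) h1.
exact.
Qed.

Lemma continuous_bump h p : continuous (bump h p).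
Proof.
move=> x; apply: cvgM; last exact: cvg_cst.
apply: (@continuous_comp _ _ _ (fun y => (y - p) / h) tent x).
  apply: cvgM; last exact: cvg_cst.
  by apply: cvgB; [exact: cvg_id|exact: cvg_cst].
exact: continuous_tent.
Qed.

Lemma continuous_step h p : continuous (step h p).
Proof.
move=> x; apply: differentiable_continuous.
exact/derivable1_diffP/(@ex_derive _ _ _ _ _ _ _ (is_derive_step h p x)).
Qed.

Lemma bump_ge0 h p x : 0 < h -> 0 <= bump h p x.
Proof. by move=> h0; rewrite divr_ge0 ?tent_ge0// ltW. Qed.

Lemma bump_out h p x : 0 < h -> x <= p \/ p + h <= x -> bump h p x = 0.
Proof.
move=> h0 hx; rewrite /bump tent_out ?mul0r//; case: hx => hx; [left|right].
  by rewrite ler_pdivrMr// mul0r subr_le0.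
by rewrite ler_pdivlMr// mul1r lerBrDl.
Qed.

Lemma step_le h p x : 0 < h -> x <= p -> step h p x = 0.
Proof. by move=> h0 hx; rewrite /step smooth_step_le0// ler_pdivrMr// mul0r subr_le0. Qed.

Lemma step_ge h p x : 0 < h -> p + h <= x -> step h p x = 1.
Proof. by move=> h0 hx; rewrite /step smooth_step_ge1// ler_pdivlMr// mul1r lerBrDl. Qed.

Local Notation leb := (@lebesgue_measure R).

Lemma integrable_continuous_itv (f : R -> R) a b :
  {within `[a, b], continuous f} -> leb.-integrable `[a, b] (EFin \o f).
Proof. by apply: continuous_compact_integrable; exact: segment_compact. Qed.

Lemma integral_bump h p a b : 0 < h -> a <= p -> p + h <= b ->
  \int[leb]_(x in `[a, b]) bump h p x = 1.
Proof.
move=> h0 ap pb; have ab : a < b by lra.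
have cb : {within `[a, b], continuous (bump h p)}.
  by apply: continuous_subspaceT; exact: continuous_bump.
rewrite /Rintegral (@continuous_FTC2 R (bump h p) (step h p) a b ab cb).
- by rewrite step_ge// step_le// sube0.
- split=> [x _||].
  + exact: (@ex_derive _ _ _ _ _ _ _ (is_derive_step h p x)).
  + by apply: cvg_at_right_filter; exact: continuous_step.
  + by apply: cvg_at_left_filter; exact: continuous_step.
- by move=> x _; rewrite derive1E; have /@derive_val := is_derive_step h p x.
Qed.

Lemma bump_average h p a b (g : R -> R) (c e : R) : 0 < h -> a <= p -> p + h <= b ->
  {within `[a, b], continuous g} ->
  (forall x, p <= x <= p + h -> `|g x - c| <= e) ->
  `|\int[leb]_(x in `[a, b]) (g x * bump h p x) - c| <= e.
Proof.
move=> h0 ap pb cg hg.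
have cb : {within `[a, b], continuous (bump h p)}.
  by apply: continuous_subspaceT; exact: continuous_bump.
have mab : measurable (`[a, b]%classic : set (measurableTypeR R)) by exact: measurable_itv.
have igb : leb.-integrable `[a, b] (EFin \o (fun x => g x * bump h p x)).
  by apply: integrable_continuous_itv => x; apply: cvgM; [exact: cg|exact: cb].
have ib := integrable_continuous_itv cb.
have icb : leb.-integrable `[a, b] (EFin \o (fun x => c * bump h p x)).
  exact: (integrableZl mab c ib).
have ieb : leb.-integrable `[a, b] (EFin \o (fun x => e * bump h p x)).
  exact: (integrableZl mab e ib).
have -> : c = \int[leb]_(x in `[a, b]) (c * bump h p x).
  by rewrite RintegralZl// integral_bump// mulr1.
rewrite -RintegralB//.
have iB : leb.-integrable `[a, b] (EFin \o (fun x => g x * bump h p x - c * bump h p x)).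
  exact: (integrableB mab igb icb).
apply: le_trans (le_normr_Rintegral mab iB) _.
have -> : e = \int[leb]_(x in `[a, b]) (e * bump h p x).
  by rewrite RintegralZl// integral_bump// mulr1.
apply: le_Rintegral => //; first exact: (integrable_norm iB).
move=> x _; rewrite -mulrBl normrM (ger0_norm (bump_ge0 p x h0)).
have [hx|hx] := boolP (p <= x <= p + h).
  by apply: ler_wpM2r; [exact: bump_ge0|exact: hg].
rewrite bump_out ?mulr0//.
by move: hx; rewrite negb_and -!ltNge => /orP[/ltW|/ltW]; [left|right].
Qed.

(** The test function is a smoothed indicator of [s, t], with derivative a bump near [s] minus one
    near [t]. By continuity the integrals of [g] against the bumps are within [e / 2] of [g s] and
    [g t]. On the other side, [|phi| <= 1] and [phi] vanishes off [s, t]. *)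
Lemma weak_derivative_increment_le a b s t (g D : R -> R) : a <= s -> s < t -> t <= b ->
  {within `[a, b], continuous g} -> weak_L2_derivative a b g D ->
  `|g t - g s| <= \int[leb]_(x in `[s, t]) `|D x|.
Proof.
move=> as_ st tb cg [mD iD2 hD].
have mab : measurable (`[a, b]%classic : set (measurableTypeR R)) by exact: measurable_itv.
have mst : measurable (`[s, t]%classic : set (measurableTypeR R)) by exact: measurable_itv.
have ab : a < b by lra.
have iD : leb.-integrable `[a, b] (EFin \o D).
  have i1 : leb.-integrable `[a, b] (EFin \o (fun x => 1 + D x ^+ 2)).
    have i0 : leb.-integrable `[a, b] (EFin \o cst 1).
      by apply: integrable_continuous_itv; apply: continuous_subspaceT => x; exact: cvg_cst.
    exact: (integrableD mab i0 iD2).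
  apply: (le_integrable mab _ _ i1); first exact/measurable_EFinP.
  move=> x _ /=; rewrite lee_fin [leRHS]ger0_norm ?addr_ge0 ?sqr_ge0//.
  by rewrite ler_norml; have := sqr_ge0 (D x - 1); have := sqr_ge0 (D x + 1);
    have := sqr_ge0 (D x) => *; apply/andP; split; nra.
have sub : `[s, t] `<=` (`[a, b] : set R).
  by move=> x /=; rewrite !in_itv/= => /andP[? ?]; apply/andP; split; lra.
have iDst : leb.-integrable `[s, t] (EFin \o D) by exact: integrableS iD.
apply/ler_addgt0Pl => e e0.
have e2 : 0 < e / 2 by rewrite divr_gt0.
have near_end c : c \in `[a, b] -> exists r, 0 < r /\
    forall x, x \in `[a, b] -> `|x - c| < r -> `|g x - g c| <= e / 2.
  move=> cab; move: cg => /subspace_continuousP /(_ c cab).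
  move=> /cvgrPdist_le/(_ _ e2); rewrite near_withinE /= => -[r /= r0 h].
  exists r; split => // x xab xc; rewrite distrC; apply: h => //=.
  by rewrite distrC.
have sab : s \in `[a, b] by rewrite in_itv/=; apply/andP; split; lra.
have tab : t \in `[a, b] by rewrite in_itv/=; apply/andP; split; lra.
have [r1 [r10 h1]] := near_end s sab; have [r2 [r20 h2]] := near_end t tab.
pose h := Num.min (Num.min (r1 / 4) (r2 / 4)) ((t - s) / 8).
have h0 : 0 < h by rewrite !lt_min !divr_gt0// subr_gt0.
have hr1 : h <= r1 / 4 by rewrite !ge_min lexx.
have hr2 : h <= r2 / 4 by rewrite !ge_min lexx orbT.
have hts : h <= (t - s) / 8 by rewrite !ge_min lexx !orbT.
(* Both bumps are shifted inwards, so that the support [p, q + h] stays inside the open interval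
   even when [s = a] or [t = b], as [C1c] requires. *)
pose p := s + h; pose q := t - 2 * h.
have [sp ap pb] : [/\ s < p, a <= p & p + h <= b].
  by clear -as_ st tb h0 hts; rewrite /p; split; lra.
have [pq qt aq qb] : [/\ p + h <= q, q + h < t, a <= q & q + h <= b].
  by clear -as_ st tb h0 hts; rewrite /p /q; split; lra.
have [pq' pqh] : p <= q /\ p + h <= q + h by clear -pq h0; split; lra.
have qqh : q <= q + h by clear -h0; lra.
pose phi x := step h p x - step h q x.
have dphi x : is_derive x (1 : R) phi (bump h p x - bump h q x).
  have d1 := is_derive_step h p x; have d2 := is_derive_step h q x.
  by rewrite /phi; apply: is_deriveB.
have phi' : derive1 phi = fun x => bump h p x - bump h q x.
  by apply/funext => x; rewrite derive1E; have /@derive_val := dphi x.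
have phiC : C1c a b phi.
  split.
  - by move=> x; have [] := dphi x.
  - by rewrite phi' => x; apply: cvgB; exact: continuous_bump.
  - exists p, (q + h); split; [exact: le_lt_trans sp|exact: lt_le_trans tb|].
    move=> x; rewrite in_itv/= negb_and -!ltNge => /orP[/ltW|/ltW] hx.
      by rewrite /phi !step_le ?subrr// (le_trans hx).
    by rewrite /phi !step_ge ?subrr// (le_trans _ hx).
have := hD phi phiC; rewrite phi' => hDphi.
have cb c : {within `[a, b], continuous (bump h c)}.
  by apply: continuous_subspaceT; exact: continuous_bump.
have igb c : leb.-integrable `[a, b] (EFin \o (fun x => g x * bump h c x)).
  by apply: integrable_continuous_itv => x; apply: cvgM; [exact: cg|exact: cb].
have b1 : `|\int[leb]_(x in `[a, b]) (g x * bump h p x) - g s| <= e / 2.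
  apply: (bump_average h0 ap pb cg) => x /andP[x1 x2].
  by apply: h1; [rewrite in_itv/=|rewrite ger0_norm]; clear -x1 x2 r10 hr1 h0 ap pb sp;
    rewrite /p in sp ap pb x1 x2 *; lra.
have b2 : `|\int[leb]_(x in `[a, b]) (g x * bump h q x) - g t| <= e / 2.
  apply: (bump_average h0 aq qb cg) => x /andP[x1 x2].
  by apply: h2; [rewrite in_itv/=|rewrite distrC ger0_norm];
    clear -x1 x2 r20 hr2 h0 aq qb qt; rewrite /q in qt aq qb x1 x2 *; lra.
have : \int[leb]_(x in `[a, b]) (g x * (bump h p x - bump h q x)) =
   \int[leb]_(x in `[a, b]) (g x * bump h p x) - \int[leb]_(x in `[a, b]) (g x * bump h q x).
  by rewrite -RintegralB//; apply: eq_Rintegral => x _; rewrite mulrBr.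
rewrite hDphi => hI.
have mphi : measurable_fun setT phi.
  by apply: continuous_measurable_fun => x; apply: cvgB; exact: continuous_step.
have bphi x : `|phi x| <= 1.
  have /andP[p0 p1] := smooth_step_itv ((x - p) / h).
  have /andP[q0 q1] := smooth_step_itv ((x - q) / h).
  by clear -p0 p1 q0 q1; rewrite ler_norml /phi /step; apply/andP; split; lra.
have iDphi : leb.-integrable `[a, b] (EFin \o (fun x => D x * phi x)).
  apply: (le_integrable mab _ _ iD).
    by apply/measurable_EFinP/measurable_funM => //; exact: measurable_funTS.
  by move=> x _ /=; rewrite lee_fin normrM ler_piMr.
have b3 : `|\int[leb]_(x in `[a, b]) (D x * phi x)| <= \int[leb]_(x in `[s, t]) `|D x|.
  apply: le_trans (le_normr_Rintegral mab iDphi) _.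
  rewrite [leRHS](_ : _ = \int[leb]_(x in `[a, b]) ((fun x => `|D x|) \_ `[s, t]) x);
    last first.
    by rewrite -Rintegral_mkcondr setIidr.
  apply: le_Rintegral => //; first exact: (integrable_norm iDphi).
    apply: (le_integrable mab _ _ iD).
      apply/measurable_EFinP; apply: (measurable_funS measurableT) => //.
      apply/(measurable_restrictT _ mst).
      apply: measurableT_comp => //.
      exact: (measurable_funS mab sub mD).
    move=> x _ /=; rewrite lee_fin /patch; case: ifP => _; first by rewrite normr_id.
    by rewrite normr0.
  move=> x _; rewrite normrM /patch; case: ifPn => hx; first by rewrite ler_piMr.
  have : x \notin `[p, q + h].
    apply: contra hx; rewrite inE/= !in_itv/= => /andP[x1 x2].
    by rewrite (le_trans (ltW sp) x1) (le_trans x2 (ltW qt)).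
  rewrite in_itv/= negb_and -!ltNge => /orP[/ltW|/ltW] hx'.
    by rewrite /phi !step_le ?subrr ?normr0 ?mulr0// (le_trans hx').
  by rewrite /phi !step_ge ?subrr ?normr0 ?mulr0// (le_trans _ hx').
move: b1 b2 b3 hI.
set I1 := \int[leb]_(x in _) _; set I2 := \int[leb]_(x in _) _; set I3 :=
  \int[leb]_(x in _) (D x * _).
set J := \int[leb]_(x in _) _ => b1 b2 b3 hI.
clear -b1 b2 b3 hI.
have -> : g t - g s = (I3 + (I1 - g s)) - (I2 - g t) by lra.
apply: le_trans (ler_normB _ _) _; have := ler_normD I3 (I1 - g s); lra.
Qed.

End test_functions.

Section dyadic_energy.
Context (R : realType).
Variables (a b : R).
Hypothesis ab : a < b.
Local Notation leb := (@lebesgue_measure R).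
Implicit Types g D : R -> R.

Definition mesh N : R := (b - a) / (2 ^ N)%:R.
Definition grid N i : R := a + i%:R * mesh N.

(* Nondecreasing in [N], bounded by the W^{1,2} norm, and with expectation additive
   over martingale differences. *)
Definition energy N g : R :=
  g a ^+ 2 + \sum_(i < 2 ^ N) (g (grid N i.+1) - g (grid N i)) ^+ 2 / mesh N.

Lemma mesh_gt0 N : 0 < mesh N.
Proof. by rewrite divr_gt0 ?subr_gt0// ltr0n expn_gt0. Qed.

Lemma meshS N : mesh N = 2 * mesh N.+1.
Proof.
rewrite /mesh expnS natrM; field.
by rewrite pnatr_eq0 -lt0n expn_gt0.
Qed.

Lemma grid0 N : grid N 0 = a. Proof. by rewrite /grid mul0r addr0. Qed.

Lemma grid_last N : grid N (2 ^ N) = b.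
Proof.
rewrite /grid /mesh mulrC divfK; first by rewrite addrC subrK.
by rewrite pnatr_eq0 -lt0n expn_gt0.
Qed.

Lemma gridS N i : grid N i.+1 = grid N i + mesh N.
Proof. by rewrite /grid -natr1; ring. Qed.

Lemma grid_double N i : grid N.+1 i.*2 = grid N i.
Proof. by rewrite /grid (meshS N) -muln2 natrM; ring. Qed.

Lemma grid_mono N i j : (i <= j)%N -> grid N i <= grid N j.
Proof. by move=> ij; rewrite /grid lerD2l ler_wpM2r ?ler_nat// ltW ?mesh_gt0. Qed.

Lemma grid_itv N i : (i <= 2 ^ N)%N -> a <= grid N i <= b.
Proof. by move=> h; rewrite -{1}(grid0 N) -(grid_last N) !grid_mono. Qed.

Lemma energy_ge0 N g : 0 <= energy N g.
Proof.
rewrite addr_ge0 ?sqr_ge0// sumr_ge0// => i _.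
by rewrite divr_ge0 ?sqr_ge0// ltW ?mesh_gt0.
Qed.

Lemma sum_double (f : nat -> R) n :
  \sum_(i < n.*2) f i = \sum_(i < n) (f i.*2 + f i.*2.+1).
Proof.
elim: n => [|n IH]; first by rewrite !big_ord0.
by rewrite doubleS !big_ord_recr/= IH addrA.
Qed.

(** Halving an interval: [(u + v)^2 / (2 h) <= (u^2 + v^2) / h], with [h] the finer mesh and [u],
    [v] the two increments. *)
Lemma energy_mono N g : energy N g <= energy N.+1 g.
Proof.
rewrite lerD2l expnS mul2n.
rewrite (sum_double (fun i => (g (grid N.+1 i.+1) - g (grid N.+1 i)) ^+ 2 / mesh N.+1)).
apply: ler_sum => i _; rewrite -doubleS !grid_double.
set x := g _; set y := g (grid _ _); set z := g (grid _ _).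
rewrite -mulrDl (meshS N) invfM mulrA ler_pM2r ?invr_gt0 ?mesh_gt0//.
by have := sqr_ge0 (x + y - 2 * z); lra.
Qed.

Lemma sqr_sum_le (x : nat -> R) n : (\sum_(i < n) x i) ^+ 2 <= n%:R * \sum_(i < n) x i ^+ 2.
Proof.
elim: n => [|n IH]; first by rewrite !big_ord0 expr0n/= mul0r.
rewrite !big_ord_recr/= -natr1; move: IH.
set S := \sum_(i < n) _; set Q := \sum_(i < n) _; set c := (n%:R : R) => IH.
have c0 : 0 <= c by rewrite ler0n.
have Q0 : 0 <= Q by apply: sumr_ge0 => i _; exact: sqr_ge0.
suff : 2 * S * x n <= Q + c * x n ^+ 2 by nra.
have [cz|cn] := eqVneq c 0.
  have S0 : S = 0.
    by apply/eqP; rewrite -sqrf_eq0 eq_le sqr_ge0 andbT; rewrite cz mul0r in IH.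
  by rewrite S0 cz mulr0 !mul0r addr0.
have cp : 0 < c by rewrite lt_neqAle eq_sym cn.
rewrite -(ler_pM2l cp); have := sqr_ge0 (S - c * x n); nra.
Qed.

(** A grid value is [g a] plus increments, and Cauchy-Schwarz bounds the square of their sum by
    [b - a] times the second part of the energy. The constant is independent of [N], so the bound
    survives refinement. *)
Lemma grid_le_energy N i g : (i <= 2 ^ N)%N ->
  g (grid N i) ^+ 2 <= 2 * (1 + (b - a)) * energy N g.
Proof.
move=> iN; pose x j := g (grid N j.+1) - g (grid N j).
have e1 : g (grid N i) = g a + \sum_(j < i) x j.
  elim: i iN => [|i IH] iN; first by rewrite big_ord0 addr0 grid0.
  by rewrite big_ord_recr/= addrA -IH ?(ltnW iN)// /x addrC subrK.
have e2 : (\sum_(j < i) x j) ^+ 2 <= (b - a) * \sum_(j < 2 ^ N) x j ^+ 2 / mesh N.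
  apply: le_trans (sqr_sum_le _ _) _.
  have m0 := mesh_gt0 N.
  have -> : b - a = (2 ^ N)%:R * mesh N.
    by rewrite mulrC divfK// pnatr_eq0 -lt0n expn_gt0.
  rewrite -mulrA -mulr_suml [mesh N * _]mulrC divfK ?gt_eqF//.
  apply: ler_pM; rewrite ?ler_nat//.
    by apply: sumr_ge0 => j _; exact: sqr_ge0.
  rewrite -!(big_mkord xpredT (fun j => x j ^+ 2)) [leRHS](@big_cat_nat _ _ _ i)//=.
  by rewrite lerDl sumr_ge0// => j _; exact: sqr_ge0.
have ba : 0 < b - a by rewrite subr_gt0.
have s0 : 0 <= \sum_(j < 2 ^ N) x j ^+ 2 / mesh N.
  by apply: sumr_ge0 => j _; rewrite divr_ge0 ?sqr_ge0// ltW ?mesh_gt0.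
rewrite e1 /energy -/x; move: e2 s0.
set s := \sum_(j < i) _; set E := \sum_(j < _) _ => e2 s0.
have h1 := sqr_ge0 (g a - s); have h2 := mulr_ge0 (ltW ba) (sqr_ge0 (g a)).
by nra.
Qed.

(** Together with [grid_le_energy], this converts an energy bound holding at all levels into a bound
    on the supremum. *)
Lemma grid_dense (f : R -> R) M : {within `[a, b], continuous f} ->
  (forall N i, (i <= 2 ^ N)%N -> f (grid N i) <= M) ->
  forall z, z \in `[a, b] -> f z <= M.
Proof.
move=> cf hf z zab; apply/ler_addgt0Pl => e e0.
move: cf => /subspace_continuousP /(_ z zab).
move=> /cvgrPdist_le/(_ _ e0); rewrite near_withinE /= => -[r /= r0 h].
have ba : 0 < b - a by rewrite subr_gt0.
pose N := Num.bound ((b - a) / r).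
have mN : mesh N < r.
  rewrite ltr_pdivrMr ?ltr0n ?expn_gt0// mulrC -ltr_pdivrMr//.
  apply: lt_trans (archi_boundP _) _; first by rewrite divr_ge0// ltW.
  by rewrite ltr_nat ltn_expl.
have [i [iN hi]] : exists i, (i <= 2 ^ N)%N /\ grid N i <= z < grid N i + r.
  pose i := Num.truncn ((z - a) / mesh N).
  move: zab; rewrite in_itv/= => /andP[az zb].
  have m0 := mesh_gt0 N.
  have q0 : 0 <= (z - a) / mesh N by rewrite divr_ge0 ?subr_ge0// ltW.
  have /andP[i1 i2] := truncn_itv q0; rewrite -/i in i1 i2.
  exists i; split.
    rewrite -(ler_nat R); apply: le_trans i1 _.
    by rewrite ler_pdivrMr// lerBlDl -/(grid N (2 ^ N)) grid_last.
  move: i1 i2; rewrite ler_pdivlMr// ltr_pdivrMr// -natr1 mulrDl mul1r => i1 i2.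
  by rewrite /grid; apply/andP; split; lra.
have /andP[g1 g2] := grid_itv iN.
have := h (grid N i); rewrite /ball_/= => /(_ _ _).
have /andP[i1 i2] := hi.
rewrite ger0_norm ?subr_ge0// ltrBlDl => /(_ i2).
rewrite in_itv/= g1 g2 => /(_ isT); have := hf N i iN.
by rewrite /from_subspace ler_norml => hM /andP[_ h2]; clear -hM h2; lra.
Qed.

(** Cauchy-Schwarz: integrating [(k |D| - 1)^2 >= 0] gives an inequality in [k], used at
    [k = J / I], or at a large [k] to force [J = 0] when [I = 0]. *)
Lemma sqr_Rintegral_norm_le s t D : s < t ->
  lebesgue_measure.-integrable `[s, t] (EFin \o D) ->
  lebesgue_measure.-integrable `[s, t] (fun x => (D x ^+ 2)%:E) ->
  (\int[leb]_(x in `[s, t]) `|D x|) ^+ 2 <= (t - s) * \int[leb]_(x in `[s, t]) (D x ^+ 2).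
Proof.
move=> st iD iD2.
have mst : measurable (`[s, t]%classic : set (measurableTypeR R)) by exact: measurable_itv.
set J := \int[leb]_(x in _) _; set I := \int[leb]_(x in _) _.
have J0 : 0 <= J by apply: Rintegral_ge0.
have I0 : 0 <= I by apply: Rintegral_ge0 => x _; exact: sqr_ge0.
have key k : 2 * J * k <= k ^+ 2 * I + (t - s).
  have ic : leb.-integrable `[s, t] (EFin \o cst 1).
    by apply: integrable_continuous_itv; apply: continuous_subspaceT => x; exact: cvg_cst.
  have i1 : leb.-integrable `[s, t] (EFin \o (fun x => k ^+ 2 * D x ^+ 2)).
    exact: (integrableZl mst _ iD2).
  have i2 : leb.-integrable `[s, t] (EFin \o (fun x => 2 * k * `|D x|)).
    exact: (integrableZl mst _ (integrable_norm iD)).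
  have i3 : leb.-integrable `[s, t] (EFin \o (fun x => k ^+ 2 * D x ^+ 2 + cst 1 x)).
    exact: (integrableD mst i1 ic).
  have -> : t - s = \int[leb]_(x in `[s, t]) (cst 1 x).
    rewrite (Rintegral_cst _ mst) mul1r.
    by have := lebesgue_measure_itv `[s, t]; rewrite /= lte_fin st => ->.
  have -> : k ^+ 2 * I = \int[leb]_(x in `[s, t]) (k ^+ 2 * D x ^+ 2).
    by rewrite RintegralZl.
  rewrite -RintegralD//.
  have -> : 2 * J * k = \int[leb]_(x in `[s, t]) (2 * k * `|D x|).
    rewrite RintegralZl//; first by rewrite -/J; ring.
    exact: integrable_norm.
  apply: le_Rintegral => // x _ /=; rewrite -[D x ^+ 2]real_normK ?num_real//.
  by have := sqr_ge0 (k * `|D x| - 1); lra.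
have [Iz|In] := eqVneq I 0.
  have := key ((t - s) / (2 * J) + 1); have [->|Jn] := eqVneq J 0.
    by rewrite expr0n/= Iz !mulr0.
  rewrite Iz mulr0 add0r mulrDr mulr1 mulrC divfK ?mulf_neq0//.
  by have : 0 < J by [rewrite lt_neqAle eq_sym Jn]; lra.
have Ip : 0 < I by rewrite lt_neqAle eq_sym In.
have := key (J / I); rewrite expr_div_n -(ler_pM2r Ip).
rewrite (_ : 2 * J * (J / I) * I = 2 * J ^+ 2); last by field.
rewrite (_ : (J ^+ 2 / I ^+ 2 * I + (t - s)) * I = J ^+ 2 + (t - s) * I); last by field.
by lra.
Qed.

Lemma sum_Rintegral_grid N n (f : R -> R) : (n <= 2 ^ N)%N ->
  leb.-integrable `[a, b] (EFin \o f) ->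
  \sum_(i < n) \int[leb]_(x in `[grid N i, grid N i.+1]) f x =
  \int[leb]_(x in `[a, grid N n]) f x.
Proof.
move=> nN intf.
have mitv s t : measurable (`[s, t]%classic : set (measurableTypeR R)) by exact: measurable_itv.
have intS s t : a <= s -> t <= b -> leb.-integrable `[s, t] (EFin \o f).
  move=> as_ tb; apply: integrableS intf => //.
  by move=> x /=; rewrite !in_itv/= => /andP[? ?]; apply/andP; split; lra.
elim: n nN => [|n IH] nN.
  by rewrite big_ord0 grid0 set_itv1 Rintegral_set1.
have /andP[g1 g2] := grid_itv (ltnW nN); have /andP[g3 g4] := grid_itv nN.
rewrite big_ord_recr/= IH; last exact: ltnW.
have := @Rintegral_itvB R f (BLeft a) (BRight (grid N n.+1)) (grid N n) (intS _ _ (lexx _) g4).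
rewrite !bnd_simp => /(_ g1 (grid_mono _ (leqnSn n))).
rewrite Rintegral_itv_obnd_cbnd; first by move=> <-; ring.
apply: integrableS (intS _ _ g1 g4) => //.
by move=> x /=; rewrite !in_itv/= => /andP[/ltW -> ->].
Qed.

(** With [I] the integral of the squared weak derivative, [g a ^+ 2 <= 2 g y ^+ 2 + 2 (b - a) I]
    averaged over [y] produces the coefficients [2 / (b - a)] and [2 (b - a)]; the increments
    contribute the 1. *)
Definition sobolev_const : R := 2 / (b - a) + 2 * (b - a) + 1.

(** On each grid interval the squared increment divided by the mesh is at most the integral of
    [D ^+ 2] there, so the increments cost at most the whole integral, whatever the level. *)
Lemma energy_le_sobolev N g D : {within `[a, b], continuous g} ->
  weak_L2_derivative a b g D ->
  energy N g <= sobolev_const * (\int[leb]_(x in `[a, b]) (g x ^+ 2) +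
                                 \int[leb]_(x in `[a, b]) (D x ^+ 2)).
Proof.
move=> cg hD; have [mD iD2 _] := hD.
have ba : 0 < b - a by rewrite subr_gt0.
have mitv s t : measurable (`[s, t]%classic : set (measurableTypeR R)) by exact: measurable_itv.
have subi s t : a <= s -> t <= b -> `[s, t] `<=` (`[a, b] : set R).
  by move=> as_ tb x /=; rewrite !in_itv/= => /andP[? ?]; apply/andP; split; lra.
have iD2s s t : a <= s -> t <= b -> leb.-integrable `[s, t] (fun x => (D x ^+ 2)%:E).
  by move=> as_ tb; apply: integrableS iD2 => //; exact: subi.
have iDs s t : a <= s -> t <= b -> leb.-integrable `[s, t] (EFin \o D).
  move=> as_ tb.
  have i0 : leb.-integrable `[s, t] (EFin \o cst 1).
    by apply: integrable_continuous_itv; apply: continuous_subspaceT => x; exact: cvg_cst.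
  have i1 : leb.-integrable `[s, t] (EFin \o (fun x => 1 + D x ^+ 2)).
    exact: (integrableD (mitv _ _) i0 (iD2s _ _ as_ tb)).
  apply: (le_integrable (mitv _ _) _ _ i1).
    apply/measurable_EFinP; exact: (measurable_funS (mitv a b) (subi _ _ as_ tb) mD).
  move=> x _ /=; rewrite lee_fin [leRHS]ger0_norm ?addr_ge0 ?sqr_ge0//.
  by rewrite ler_norml; have := sqr_ge0 (D x - 1); have := sqr_ge0 (D x + 1);
    have := sqr_ge0 (D x) => *; apply/andP; split; nra.
have incr s t : a <= s -> s < t -> t <= b ->
    (g t - g s) ^+ 2 <= (t - s) * \int[leb]_(x in `[s, t]) (D x ^+ 2).
  move=> as_ st tb.
  apply: le_trans (sqr_Rintegral_norm_le st (iDs _ _ as_ tb) (iD2s _ _ as_ tb)).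
  rewrite -[leLHS]real_normK ?num_real// ler_pXn2r ?nnegrE//.
    exact: (weak_derivative_increment_le as_ st tb cg hD).
  exact: Rintegral_ge0.
set IG := \int[leb]_(x in _) _; set I := \int[leb]_(x in _) _.
have I0 : 0 <= I by apply: Rintegral_ge0 => x _; exact: sqr_ge0.
have hsum : \sum_(i < 2 ^ N) (g (grid N i.+1) - g (grid N i)) ^+ 2 / mesh N <= I.
  rewrite /I -(grid_last N) -sum_Rintegral_grid//.
  apply: ler_sum => i _; rewrite ler_pdivrMr ?mesh_gt0// mulrC.
  have /andP[g1 _] := grid_itv (ltnW (ltn_ord i)); have /andP[_ g4] := grid_itv (ltn_ord i).
  have lt : grid N i < grid N i.+1 by rewrite gridS ltrDl mesh_gt0.
  have e : grid N i.+1 - grid N i = mesh N by rewrite gridS addrAC subrr add0r.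
  by have := incr _ _ g1 lt g4; rewrite e.
have hy y : y \in `[a, b] -> g a ^+ 2 <= 2 * g y ^+ 2 + 2 * (b - a) * I.
  rewrite in_itv/= => /andP[ay yb].
  have h : (g y - g a) ^+ 2 <= (b - a) * I.
    move: ay; rewrite le_eqVlt => /orP[/eqP <-|ay].
      by rewrite subrr expr0n/= mulr_ge0// ltW.
    apply: le_trans (incr _ _ (lexx a) ay yb) _.
    apply: ler_pM; rewrite ?subr_ge0 ?(ltW ay)//.
    - by apply: Rintegral_ge0 => x _; exact: sqr_ge0.
    - by rewrite lerD2r.
    rewrite -subr_ge0 /I.
    rewrite (@Rintegral_itvB R (fun x => D x ^+ 2) (BLeft a) (BRight b) y)//.
    - by apply: Rintegral_ge0 => x _; exact: sqr_ge0.
    - by rewrite bnd_simp ltW.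
  have := sqr_ge0 (g a - 2 * g y); have := sqr_ge0 (g y).
  by move: h; clear; nra.
have hga : (b - a) * g a ^+ 2 <= 2 * IG + 2 * (b - a) ^+ 2 * I.
  have ic c : leb.-integrable `[a, b] (EFin \o cst c).
    by apply: integrable_continuous_itv; apply: continuous_subspaceT => x; exact: cvg_cst.
  have ig2 : leb.-integrable `[a, b] (EFin \o (fun x => g x ^+ 2)).
    by apply: integrable_continuous_itv => x; apply: cvgM; exact: cg.
  have ig22 : leb.-integrable `[a, b] (EFin \o (fun x => 2 * g x ^+ 2)).
    exact: (integrableZl (mitv _ _) _ ig2).
  have icst c : \int[leb]_(x in `[a, b]) (cst c x) = c * (b - a).
    rewrite (Rintegral_cst _ (mitv _ _)).
    by have := lebesgue_measure_itv `[a, b]; rewrite /= lte_fin ab => ->.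
  have isum : leb.-integrable `[a, b]
      (EFin \o (fun y => 2 * g y ^+ 2 + cst (2 * (b - a) * I) y)).
    exact: (integrableD (mitv _ _) ig22 (ic _)).
  rewrite mulrC -icst.
  apply: (@le_trans _ _ (\int[leb]_(y in `[a, b]) (2 * g y ^+ 2 + cst (2 * (b - a) * I) y))).
    by apply: le_Rintegral => //= y yab; exact: hy.
  by rewrite RintegralD// RintegralZl// icst -/IG le_eqVlt; apply/orP; left; apply/eqP; ring.
have IG0 : 0 <= IG by apply: Rintegral_ge0 => x _; exact: sqr_ge0.
have hga' : g a ^+ 2 <= 2 / (b - a) * IG + 2 * (b - a) * I.
  rewrite -(ler_pM2l ba); apply: le_trans hga _.
  by rewrite le_eqVlt; apply/orP; left; apply/eqP; field; rewrite gt_eqF.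
have h1 : 0 <= 2 / (b - a) * I by rewrite mulr_ge0// divr_ge0// ltW.
have h2 : 0 <= 2 * (b - a) * IG by rewrite mulr_ge0// mulr_ge0// ltW.
rewrite /energy /sobolev_const; move: hga' hsum I0 IG0 h1 h2; clear.
move: (\sum_(i < _) _) (2 / (b - a)) (g a ^+ 2) => s c e *.
by lra.
Qed.

Lemma energy_le_W12 N g : W12 a b g ->
  ((energy N g)%:E <= sobolev_const%:E * W12_normsq a b g)%E.
Proof.
move=> [cg [D0 hD0]].
have hD : weak_L2_derivative a b g (weak_derivative a b g).
  by rewrite /weak_derivative; case: xgetP => [D _ //|/(_ D0)].
have [_ iD _] := hD.
have ig2 : leb.-integrable `[a, b] (EFin \o (fun x => g x ^+ 2)).
  by apply: integrable_continuous_itv => x; apply: cvgM; exact: cg.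
have mab : measurable (`[a, b]%classic : set (measurableTypeR R)) by exact: measurable_itv.
have fin f : leb.-integrable `[a, b] (EFin \o f) ->
    (\int[leb]_(x in `[a, b]) (f x)%:E = (\int[leb]_(x in `[a, b]) f x)%:E)%E.
  by move=> hf; rewrite /Rintegral fineK//; apply: integrable_fin_num.
rewrite /W12_normsq !fin// -EFinD -EFinM lee_fin.
exact: energy_le_sobolev.
Qed.

End dyadic_energy.

(** * Convergence of expectations from cosine transforms *)

Section gaussian.
Context (R : realType).
Local Notation leb := (@lebesgue_measure R).

(** The Radon-Nikodym derivative of [normal_prob] agrees almost everywhere with [normal_pdf], since
    both have the same integral over every measurable set. *)
Lemma integral_normal_prob (s : R) (f : R -> \bar R) (U : set (measurableTypeR R)) :
  measurable U -> measurable_fun U f ->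
  (normal_prob 0 s).-integrable U f ->
  (\int[normal_prob 0 s]_(x in U) f x =
   \int[leb]_(x in U) (f x * (normal_pdf 0 s x)%:E))%E.
Proof.
move=> mU mf finf.
have mp : measurable_fun U (fun x : measurableTypeR R => (normal_pdf 0 s x)%:E).
  by apply/measurable_EFinP/measurable_funTS; exact: measurable_normal_pdf.
rewrite -(Radon_Nikodym_change_of_variables (normal_prob_dominates 0 s))//=.
apply: ae_eq_integral => //.
- apply: emeasurable_funM => //; apply: (measurable_int leb).
  apply: (integrableS _ _ (@subsetT _ _)) => //=.
  by apply: Radon_Nikodym_integrable; exact: normal_prob_dominates.
- exact: emeasurable_funM.
- apply: ae_eqe_mul2l => /=.
  rewrite Radon_NikodymE//=; first exact: normal_prob_dominates.
  move=> abmu; case: cid => /= h [h1 h2 h3].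
  apply: integral_ae_eq => //=.
  + exact: integrableS h2.
  + by move=> E E01 mE; rewrite -h3.
Qed.

Variable s : R.
Hypothesis s0 : 0 < s.
Let p x := normal_pdf 0 s x.

Let pE x : p x = normal_peak s * expR (- (x ^+ 2 / (2 * s ^+ 2))).
Proof.
rewrite /p normal_pdfE ?gt_eqF// /normal_fun subr0.
by congr (_ * expR _); rewrite mulNr [in RHS]mulr_natl.
Qed.

Let sn0 : s != 0. Proof. by rewrite gt_eqF. Qed.

Lemma is_derive_normal_pdf x : is_derive x (1 : R) p (- (x / s ^+ 2) * p x).
Proof.
have -> : p = fun x => normal_peak s * expR (- (x ^+ 2 / (2 * s ^+ 2))).
  by apply/funext => y; rewrite pE.
have h : is_derive x (1 : R) (fun y => - (y ^+ 2 / (2 * s ^+ 2))) (- (x / s ^+ 2)).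
  apply: is_derive_eq; rewrite /GRing.scale/=; field.
  exact: sn0.
have h2 := is_derive1_comp (is_derive_expR _) h.
have h3 := is_deriveZ (normal_peak s) h2.
apply: (is_derive_eq h3).
by rewrite /GRing.scale/=; ring.
Qed.

Section truncated.
Variables (N phi : R).
Hypothesis N0 : 0 < N.

Let F t := \int[leb]_(x in `[-N, N]) (cos (t * x + phi) * p x).

Let cont_p : continuous p.
Proof. by move=> x; exact: continuous_normal_pdf. Qed.

Let d_lin t x : is_derive x (1 : R) (fun y => t * y + phi) t.
Proof. by apply: is_derive_eq; rewrite /GRing.scale/=; ring. Qed.

Let d_lin' x t : is_derive t (1 : R) (fun y => y * x + phi) x.
Proof. by apply: is_derive_eq; rewrite /GRing.scale/=; ring. Qed.

Let d_sin t x : is_derive x (1 : R) (fun y => sin (t * y + phi)) (t * cos (t * x + phi)).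
Proof. by rewrite mulrC; apply: (is_derive1_comp (is_derive_sin _) (d_lin t x)). Qed.

Let d_cos x t : is_derive t (1 : R) (fun y => cos (y * x + phi) * p x)
  (- x * sin (t * x + phi) * p x).
Proof.
have h := is_derive1_comp (is_derive_cos _) (d_lin' x t).
have h2 := is_deriveZ (p x) h.
have -> : (fun y => cos (y * x + phi) * p x) = p x *: (cos \o (fun y => y * x + phi)).
  by apply/funext => y; rewrite mulrC.
apply: (is_derive_eq h2).
by rewrite /GRing.scale/=; ring.
Qed.

Let cont_lin (t : R) : continuous (fun x : R => t * x + phi).
Proof.
by move=> x; apply: cvgD; [apply: cvgM; [exact: cvg_cst|exact: cvg_id]|exact: cvg_cst].
Qed.

Let int_cos t : leb.-integrable `[-N, N] (EFin \o (fun x => cos (t * x + phi) * p x)).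
Proof.
apply: integrable_continuous_itv; apply: continuous_subspaceT => x.
apply: cvgM; last exact: cont_p.
apply: (@continuous_comp _ _ _ (fun y => t * y + phi) cos x); first exact: cont_lin.
exact: continuous_cos.
Qed.

Let bound_partial t x : x \in `[-N, N] -> `|- x * sin (t * x + phi) * p x| <= N * normal_peak s.
Proof.
rewrite in_itv/= => xN; rewrite !normrM normrN -[N]mulr1.
apply: ler_pM => //; last first.
  by rewrite ger0_norm ?normal_pdf_ge0//; exact: normal_pdf_ub.
by apply: ler_pM => //; [rewrite ler_norml|rewrite ler_norml sin_geN1 sin_le1].
Qed.

Let mNN : measurable (`[-N, N]%classic : set (measurableTypeR R)).
Proof. exact: measurable_itv. Qed.

(** On the compact interval the derivative of the integrand in [t] is bounded by the constant
    [N * normal_peak s], which justifies differentiating under the integral. *)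
Lemma derive_truncated_cos t : is_derive t (1 : R) F
  (\int[leb]_(x in `[-N, N]) (- x * sin (t * x + phi) * p x)).
Proof.
pose f (t : R) (x : measurableTypeR R) := cos (t * x + phi) * p x.
have It : `]t - 1, t + 1[%classic t by rewrite /= in_itv/=; apply/andP; split; lra.
have der x t' : derivable (f^~ x) t' 1.
  exact: (@ex_derive _ _ _ _ _ _ _ (d_cos x t')).
have part t' x : partial1of2 f t' x = - x * sin (t' * x + phi) * p x.
  by rewrite partial1of2E; have /@derive_val := d_cos x t'.
have iG : leb.-integrable `[-N, N] (EFin \o cst (N * normal_peak s)).
  by apply: integrable_continuous_itv; apply: continuous_subspaceT => x; exact: cvg_cst.
have G0 (y : measurableTypeR R) : 0 <= cst (N * normal_peak s) y.
  by rewrite /= mulr_ge0 ?normal_peak_ge0// ltW.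
have bd (t' : R) (y : measurableTypeR R) : `]t - 1, t + 1[%classic t' -> `[-N, N]%classic y ->
    `|partial1of2 f t' y| <= cst (N * normal_peak s) y.
  by move=> _ yN; rewrite part; exact: bound_partial.
have intf (t' : R) : `]t - 1, t + 1[%classic t' -> leb.-integrable `[-N, N] (EFin \o f t').
  by move=> _; exact: int_cos.
have derf (t' : R) (y : measurableTypeR R) : `]t - 1, t + 1[%classic t' ->
  `[-N, N]%classic y -> derivable (f^~ y) t' 1 by move=> _ _; exact: der.
have D1 := derivable_under_integral mNN It intf derf G0 iG bd.
have D2 := differentiation_under_integral mNN It intf derf G0 iG bd.
apply: DeriveDef; first exact: D1.
rewrite -derive1E [LHS]D2; apply: eq_Rintegral => x _; exact: part.
Qed.

Lemma truncated_cos_by_parts t :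
  \int[leb]_(x in `[-N, N]) (- x * sin (t * x + phi) * p x) =
  s ^+ 2 * (sin (t * N + phi) * p N - sin (t * - N + phi) * p (- N) - t * F t).
Proof.
have NN : - N < N by apply: (lt_trans _ N0); rewrite oppr_lt0.
have cf : {within `[-N, N], continuous (fun x => t * cos (t * x + phi))}.
  apply: continuous_subspaceT => x; apply: cvgM; first exact: cvg_cst.
  apply: (@continuous_comp _ _ _ (fun y => t * y + phi) cos x); first exact: cont_lin.
  exact: continuous_cos.
have cg : {within `[-N, N], continuous (fun x => - (x / s ^+ 2) * p x)}.
  apply: continuous_subspaceT => x; apply: cvgM; last exact: cont_p.
  by apply: cvgN; apply: cvgM; [exact: cvg_id|exact: cvg_cst].
have loc (f f' : R -> R) : (forall x, is_derive x (1 : R) f (f' x)) ->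
   derivable_oo_LRcontinuous f (- N) N /\ {in `]- N, N[, f^`()%classic =1 f'}.
  move=> df; have cf' : continuous f.
    move=> x; apply: differentiable_continuous.
    exact/derivable1_diffP/(@ex_derive _ _ _ _ _ _ _ (df x)).
  split; first split=> [x _||].
  - exact: (@ex_derive _ _ _ _ _ _ _ (df x)).
  - by apply: cvg_at_right_filter; exact: cf'.
  - by apply: cvg_at_left_filter; exact: cf'.
  by move=> x _; rewrite derive1E; have /@derive_val := df x.
have [l1 l2] := loc _ _ (d_sin t); have [l3 l4] := loc _ _ is_derive_normal_pdf.
have := Rintegration_by_parts NN cf l1 l2 cg l3 l4.
have -> : \int[leb]_(x in `[-N, N]) (t * cos (t * x + phi) * p x) = t * F t.
  rewrite /F -(RintegralZl t mNN (int_cos t)).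
  by apply: eq_Rintegral => x _; ring.
move=> <-; rewrite -RintegralZl//.
  by apply: eq_Rintegral => x _; field; exact: sn0.
apply: integrable_continuous_itv => x; apply: cvgM; last exact: cg.
apply: continuous_subspaceT => {}x.
apply: (@continuous_comp _ _ _ (fun y => t * y + phi) sin x); first exact: cont_lin.
exact: continuous_sin.
Qed.

(** [expR (s ^+ 2 / 2 * t ^+ 2) * F t] is constant in [t] up to the two boundary terms of the
    integration by parts, each at most [p N] in absolute value. The mean value theorem compares its
    values at 0 and 1. *)
Lemma truncated_cos_bound :
  `|expR (s ^+ 2 / 2) * F 1 - F 0| <= expR (s ^+ 2 / 2) * s ^+ 2 * (2 * p N).
Proof.
pose B t := sin (t * N + phi) * p N - sin (t * - N + phi) * p (- N).
pose H t := expR (s ^+ 2 / 2 * t ^+ 2) * F t.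
have dH t : is_derive t (1 : R) H (expR (s ^+ 2 / 2 * t ^+ 2) * (s ^+ 2 * B t)).
  have h1 : is_derive t (1 : R) (fun y => s ^+ 2 / 2 * y ^+ 2) (s ^+ 2 * t).
    by apply: is_derive_eq; rewrite /GRing.scale/=; field.
  have h2 := is_derive1_comp (is_derive_expR _) h1.
  have h3 := derive_truncated_cos t; rewrite truncated_cos_by_parts in h3.
  have h4 := is_deriveM h2 h3.
  apply: (is_derive_eq h4).
  by rewrite /GRing.scale/= /B; ring.
have pNN : p (- N) = p N by rewrite !pE sqrrN.
have p0 x : 0 <= p x by exact: normal_pdf_ge0.
have cH : {within `[0, 1], continuous H}.
  apply: continuous_subspaceT => x; apply: differentiable_continuous.
  exact/derivable1_diffP/(@ex_derive _ _ _ _ _ _ _ (dH x)).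
have [c] := MVT ltr01 (fun t _ => dH t) cH.
rewrite in_itv/= => /andP[c0 c1].
rewrite /H expr1n expr0n/= mulr1 mulr0 expR0 mul1r subr0 mulr1 => ->.
rewrite normrM ger0_norm ?expR_ge0// normrM (ger0_norm (sqr_ge0 s)) mulrA.
apply: ler_pM => //.
- by rewrite mulr_ge0 ?expR_ge0 ?sqr_ge0.
- apply: ler_wpM2r; first exact: sqr_ge0.
  rewrite ler_expR ler_piMr ?divr_ge0 ?sqr_ge0// expr_le1 ?ltW//.
- rewrite /B pNN; apply: le_trans (ler_normB _ _) _; rewrite !normrM (ger0_norm (p0 N)).
  have h x : `|sin x| * p N <= p N by rewrite ler_piMl// ler_norml sin_geN1 sin_le1.
  by have := h (1 * N + phi); have := h (c * N + phi); have := h (c * - N + phi); lra.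
Qed.

End truncated.

Lemma eq_of_cvg_dist (u v : nat -> R) (A B C : R) : u @ \oo --> A -> v @ \oo --> B ->
  (forall n, `|u n - v n| <= n.+1%:R^-1 * C) -> A = B.
Proof.
move=> uA vB h; apply/eqP; rewrite -subr_eq0; apply/eqP.
suff h0 : (u - v) @ \oo --> (0 : R).
  by rewrite -(cvg_lim (@Rhausdorff R) (cvgB uA vB)) (cvg_lim (@Rhausdorff R) h0).
apply/cvgr0Pnorm_le => e e0.
have C0 : 0 <= C by have := h 0%N; rewrite invr1 mul1r; apply: le_trans.
exists (Num.bound (C / e)) => // n /= hn.
apply: le_trans (h n) _; rewrite mulrC ler_pdivrMr ?ltr0Sn// mulrC -ler_pdivrMr//.
apply/ltW/(lt_le_trans (archi_boundP _)); first by rewrite divr_ge0// ltW.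
by rewrite ler_nat ltnW.
Qed.

(* With [F t] the transform of the density truncated to [-N, N], integration by
   parts gives [F' = - s^2 t F] up to boundary terms, and N tends to infinity. *)
Lemma normal_cos (phi : R) :
  \int[normal_prob 0 s]_x cos (x + phi) = cos phi * expR (- (s ^+ 2 / 2)).
Proof.
pose Q : probability (measurableTypeR R) R := normal_prob 0 s.
rewrite -/Q.
have bcos (x : R) : `|cos x| <= 1 by rewrite ler_norml cos_geN1 cos_le1.
have mcosp (t : R) : measurable_fun [set: measurableTypeR R] (fun x : measurableTypeR R =>
  cos (t * x + phi)).
  apply: continuous_measurable_fun => x.
  apply: (@continuous_comp _ _ _ (fun y => t * y + phi) cos x).
    by apply: cvgD; [apply: cvgM; [exact: cvg_cst|exact: cvg_id]|exact: cvg_cst].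
  exact: continuous_cos.
have mitv (a b : R) : measurable (`[a, b]%classic : set (measurableTypeR R))
  by exact: measurable_itv.
pose I (t : R) (n : nat) := \int[leb]_(x in `[- n.+1%:R, n.+1%:R]) (cos (t * x + phi) * p x).
have lim t : I t @ \oo --> \int[Q]_x cos (t * x + phi).
  have -> : I t = fun n => \int[Q]_x (\1_(`[- n.+1%:R,
    n.+1%:R]%classic : set (measurableTypeR R)) x * cos (t * x + phi)).
    apply/funext => n; rewrite -E_setI//.
    have iQ : L1 Q (fun x => cos (t * x + phi)).
      exact: (L1_bounded Q (mcosp t) (fun x => bcos _)).
    rewrite /Rintegral integral_normal_prob//.
      by apply/measurable_EFinP; exact: measurable_funTS.
    exact: (integrableS measurableT (mitv _ _) (@subsetT _ _) iQ).
  apply: (E_dct (P := Q) _ (mcosp t) _ (L1_cst Q 1)).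
  - by move=> n; apply: measurable_funM => //; exact: measurable_indic.
  - move=> x; apply: cvg_near_cst.
    exists (Num.bound `|x|) => // n /= hn.
    rewrite indicE mem_set ?mul1r//= in_itv/= -ler_norml.
    apply/ltW/(lt_trans (archi_boundP (normr_ge0 _))).
    by rewrite ltr_nat ltnS.
  - move=> n x; rewrite indicE /=; case: (_ \in _); first by rewrite mul1r.
    by rewrite mul0r normr0.
(* The boundary terms vanish at rate [1 / n], a consequence of [expR x >= 1 + x]. *)
have pb n : p n.+1%:R <= n.+1%:R^-1 * (normal_peak s * (2 * s ^+ 2)).
  rewrite pE [leRHS]mulrCA; apply: ler_wpM2l; first exact: normal_peak_ge0.
  have s20 : 0 < 2 * s ^+ 2 by rewrite mulr_gt0// exprn_gt0.
  rewrite expRN; apply: (@le_trans _ _ ((n.+1%:R / (2 * s ^+ 2))^-1)); last first.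
    by rewrite invf_div mulrC.
  rewrite lef_pV2 ?posrE ?expR_gt0 ?divr_gt0//.
  apply: le_trans (expR_ge1Dx _); apply: (@le_trans _ _ (n.+1%:R ^+ 2 / (2 * s ^+ 2))).
    by rewrite ler_pM2r ?invr_gt0// expr2 ler_peMl// ler1n.
  by rewrite lerDr.
have h : expR (s ^+ 2 / 2) * \int[Q]_x cos (1 * x + phi) = \int[Q]_x cos (0 * x + phi).
  apply: (eq_of_cvg_dist (u := fun n => expR (s ^+ 2 / 2) * I 1 n) (v := I 0)
    (C := expR (s ^+ 2 / 2) * s ^+ 2 * (2 * (normal_peak s * (2 * s ^+ 2))))).
  - by apply: cvgM; [exact: cvg_cst|exact: lim].
  - exact: lim.
  - move=> n; apply: le_trans (truncated_cos_bound phi (ltr0Sn _ n)) _.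
    rewrite (_ : n.+1%:R^-1 * _ = expR (s ^+ 2 / 2) * s ^+ 2 *
      (2 * (n.+1%:R^-1 * (normal_peak s * (2 * s ^+ 2))))); last by ring.
    apply: ler_wpM2l; first by rewrite mulr_ge0 ?expR_ge0 ?sqr_ge0.
    by apply: ler_wpM2l => //; exact: pb.
have e0 : \int[Q]_x cos (0 * x + phi) = cos phi.
  by rewrite -[RHS](E_cst Q); apply: E_ext => x; rewrite mul0r add0r.
have e1 : \int[Q]_x cos (1 * x + phi) = \int[Q]_x cos (x + phi).
  by apply: E_ext => x; rewrite mul1r.
move: h; rewrite e0 e1 => <-.
by rewrite mulrAC -expRD subrr expR0 mul1r.
Qed.

End gaussian.

(** * Approximation by trigonometric polynomials *)

Section trigonometric_test_functions.
Context (R : realType).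

(** If the arcsines [s >= t] differ by at least [r], then [sin s - sin t = 2 cos m sin h] with [m],
    [h] the half sum and half difference. Here [h >= r / 2], and [cos m >= sin h] because
    [|m| + h <= pi / 2]. *)
Lemma asin_modulus (r a b : R) : 0 < r -> r <= pi -> -1 <= a <= 1 -> -1 <= b <= 1 ->
  `|a - b| < 2 * sin (r / 2) ^+ 2 -> `|asin a - asin b| < r.
Proof.
wlog : a b / asin b <= asin a => [h r0 rpi ha hb|].
  have [ba|/ltW ab] := leP (asin b) (asin a); first exact: h.
  by rewrite distrC [`|asin a - _|]distrC; exact: h.
move=> ba r0 rpi ha hb hab; rewrite ltNge; apply/negP => hr; move: hab; apply/negP;
  rewrite -leNgt.
move: hr; rewrite ger0_norm ?subr_ge0// => hr.
have [s1 s2] : - (pi / 2) <= asin a /\ asin a <= pi / 2.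
  by split; [exact: asin_geNpi2|exact: asin_lepi2].
have [t1 t2] : - (pi / 2) <= asin b /\ asin b <= pi / 2.
  by split; [exact: asin_geNpi2|exact: asin_lepi2].
rewrite -(asinK ha) -(asinK hb).
set s := asin a in ba s1 s2 hr *; set t := asin b in ba t1 t2 hr *.
set m := (s + t) / 2; set h := (s - t) / 2.
have -> : sin s - sin t = 2 * cos m * sin h.
  have -> : s = m + h by rewrite /m /h; field.
  have -> : t = m - h by rewrite /m /h; field.
  by rewrite (sinD m h) (sinB m h); ring.
have sinE x : sin x = cos (pi / 2 - x) :> R
  by rewrite cosB cos_pihalf sin_pihalf mul0r add0r mul1r.
have pp := pi_gt0 R.
have dec x y : 0 <= x -> x <= y -> y <= pi -> cos y <= cos x :> R.
  move=> x0 xy ypi; have [->//|ne] := eqVneq x y.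
  by apply: ltW; rewrite ltr_cos ?in_itv/=; [rewrite lt_neqAle ne|apply/andP; split; lra..].
have sr0 : 0 <= sin (r / 2) :> R by apply: sin_ge0_pi; apply/andP; split; lra.
have h1 : sin (r / 2) <= sin h :> R.
  by rewrite !sinE; apply: dec; rewrite /h; lra.
have h2 : sin h <= cos m :> R.
  rewrite sinE -[cos m]cos_norm.
  have [m0|m0] := leP 0 m; [rewrite ger0_norm//|rewrite ltr0_norm//];
    by apply: dec; move: m0; rewrite /h /m; lra.
apply: le_trans (ler_norm _); rewrite expr2 mulrA.
by apply: ler_pM => //; [apply: mulr_ge0|apply: ler_wpM2l => //; exact: le_trans h1 h2].
Qed.

(** Joint measurability in the form used under integrals, by composition, so that no sigma-algebra
    on the plane is involved. *)
Definition measurable2 (f : R -> R -> R) := forall d (T : measurableType d) (u v : T -> R),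
  measurable_fun setT u -> measurable_fun setT v ->
  measurable_fun setT (fun w => f (u w) (v w)).

Context d (Omega : measurableType d) (P : nat -> probability Omega R).
Context d' (Omega' : measurableType d') (P' : probability Omega' R).
Variables (X Y : nat -> Omega -> R) (X' Y' : Omega' -> R).
Hypothesis mX : forall n, measurable_fun setT (X n).
Hypothesis mY : forall n, measurable_fun setT (Y n).
Hypothesis mX' : measurable_fun setT X'.
Hypothesis mY' : measurable_fun setT Y'.

(** The free phase includes the sines, so that cosines alone suffice for the product-to-sum
    formula. *)
Let wave (al be phi x y : R) := cos (al * x + be * y + phi).

Let wave_bound al be phi x y : `|wave al be phi x y| <= 1.
Proof. by rewrite ler_norml cos_geN1 cos_le1. Qed.

Let wave_measurable al be phi : measurable2 (wave al be phi).
Proof.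
move=> e T u v mu mv; apply: (measurableT_comp (f := @cos R)).
  by apply: continuous_measurable_fun; exact: continuous_cos.
by apply: measurable_funD => //; apply: measurable_funD; exact: measurable_funM.
Qed.

Hypothesis wave_cvg : forall al be phi : R,
  (fun n => \int[P n]_w wave al be phi (X n w) (Y n w)) @ \oo -->
  \int[P']_w wave al be phi (X' w) (Y' w).

(* Test functions whose expectations converge even after multiplication by a wave:
   an algebra containing the polynomials in [sin (x / L)] and [sin (y / L)]. *)
Definition admissible (f : R -> R -> R) := [/\ measurable2 f,
  (exists M, forall x y, `|f x y| <= M) &
  forall al be phi : R,
    (fun n => \int[P n]_w (f (X n w) (Y n w) * wave al be phi (X n w) (Y n w))) @ \oo -->
    \int[P']_w (f (X' w) (Y' w) * wave al be phi (X' w) (Y' w))].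

Let adm_L1 e (T : measurableType e) (Q : probability T R) (u v : T -> R) f al be phi :
  measurable_fun setT u -> measurable_fun setT v ->
  measurable2 f -> (exists M, forall x y, `|f x y| <= M) ->
  L1 Q (fun w => f (u w) (v w) * wave al be phi (u w) (v w)).
Proof.
move=> mu mv mf [M hM]; apply: (L1_bounded Q (M := M)).
  by apply: measurable_funM; [exact: mf|exact: wave_measurable].
by move=> w; rewrite normrM -[M]mulr1; apply: ler_pM.
Qed.

Lemma admissible_cst c : admissible (fun _ _ => c).
Proof.
split; [by []|by exists (`|c|)|move=> al be phi].
have h e (T : measurableType e) (Q : probability T R) (u v : T -> R) :
    measurable_fun setT u -> measurable_fun setT v ->
    \int[Q]_w (c * wave al be phi (u w) (v w)) = c * \int[Q]_w wave al be phi (u w) (v w).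
  move=> mu mv; rewrite E_Z//; apply: (L1_bounded Q _ (fun w => wave_bound _ _ _ _ _)).
  exact: wave_measurable.
rewrite h//; under eq_fun do rewrite h//.
by apply: cvgM; [exact: cvg_cst|exact: wave_cvg].
Qed.

Lemma admissibleD f g : admissible f -> admissible g ->
  admissible (fun x y => f x y + g x y).
Proof.
move=> [mf [M hM] cf] [mg [M' hM'] cg]; split.
- by move=> e T u v mu mv; apply: measurable_funD; [exact: mf|exact: mg].
- exists (M + M') => x y; apply: le_trans (ler_normD _ _) _; exact: lerD.
move=> al be phi.
have h e (T : measurableType e) (Q : probability T R) (u v : T -> R) :
    measurable_fun setT u -> measurable_fun setT v ->
    \int[Q]_w ((f (u w) (v w) + g (u w) (v w)) * wave al be phi (u w) (v w)) =
    \int[Q]_w (f (u w) (v w) * wave al be phi (u w) (v w)) +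
    \int[Q]_w (g (u w) (v w) * wave al be phi (u w) (v w)).
  move=> mu mv; rewrite -E_D; first by apply: E_ext => w; rewrite mulrDl.
    by apply: adm_L1 => //; exists M.
  by apply: adm_L1 => //; exists M'.
rewrite h//; under eq_fun do rewrite h//.
by apply: cvgD; [exact: cf|exact: cg].
Qed.

(** Two waves multiply to half the sum of two waves, with frequencies and phases added and
    subtracted, so convergence against every wave is inherited. *)
Lemma admissibleM_wave f ga de psi : admissible f ->
  admissible (fun x y => f x y * wave ga de psi x y).
Proof.
move=> [mf [M hM] cf]; split.
- by move=> e T u v mu mv; apply: measurable_funM; [exact: mf|exact: wave_measurable].
- by exists M => x y; rewrite normrM -[M]mulr1; apply: ler_pM.
move=> al be phi.
have h e (T : measurableType e) (Q : probability T R) (u v : T -> R) :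
    measurable_fun setT u -> measurable_fun setT v ->
    \int[Q]_w (f (u w) (v w) * wave ga de psi (u w) (v w) * wave al be phi (u w) (v w)) =
    2^-1 * (\int[Q]_w (f (u w) (v w) * wave (al + ga) (be + de) (phi + psi) (u w) (v w)) +
    \int[Q]_w (f (u w) (v w) * wave (al - ga) (be - de) (phi - psi) (u w) (v w))).
  move=> mu mv; rewrite -E_D; [|by apply: adm_L1 => //; exists M..].
  rewrite -E_Z; last by apply: L1D; apply: adm_L1 => //; exists M.
  apply: E_ext => w; rewrite /wave.
  set A := al * _ + _ + _; set B := ga * _ + _ + _.
  have -> : (al + ga) * u w + (be + de) * v w + (phi + psi) = A + B by rewrite /A /B; ring.
  have -> : (al - ga) * u w + (be - de) * v w + (phi - psi) = A - B by rewrite /A /B; ring.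
  by rewrite (cosD A B) (cosB A B); field.
rewrite h//; under eq_fun do rewrite h//.
by apply: cvgM; [exact: cvg_cst|apply: cvgD; exact: cf].
Qed.

Lemma admissibleZ c f : admissible f -> admissible (fun x y => c * f x y).
Proof.
move=> [mf [M hM] cf]; split.
- by move=> e T u v mu mv; apply: measurable_funM => //; exact: mf.
- by exists (`|c| * M) => x y; rewrite normrM ler_wpM2l.
move=> al be phi.
have h e (T : measurableType e) (Q : probability T R) (u v : T -> R) :
    measurable_fun setT u -> measurable_fun setT v ->
    \int[Q]_w (c * f (u w) (v w) * wave al be phi (u w) (v w)) =
    c * \int[Q]_w (f (u w) (v w) * wave al be phi (u w) (v w)).
  move=> mu mv; rewrite -E_Z; first by apply: E_ext => w; rewrite mulrA.
  by apply: adm_L1 => //; exists M.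
rewrite h//; under eq_fun do rewrite h//.
by apply: cvgM; [exact: cvg_cst|exact: cf].
Qed.

Lemma admissible_ext f g : (forall x y, f x y = g x y) -> admissible f -> admissible g.
Proof. by move=> h; rewrite (_ : f = g)//; apply/funext => x; apply/funext => y. Qed.

Lemma admissible_sum n (f : 'I_n -> R -> R -> R) : (forall i, admissible (f i)) ->
  admissible (fun x y => \sum_(i < n) f i x y).
Proof.
elim: n f => [|n IH] f hf.
  by apply: admissible_ext (admissible_cst 0) => x y; rewrite big_ord0.
apply: admissible_ext (admissibleD (IH (fun i => f (widen_ord (leqnSn n) i)) _) (hf ord_max)).
  by move=> x y; rewrite big_ord_recr.
by move=> i; exact: hf.
Qed.

Lemma admissible_mul_pow f g i : admissible f ->
  (forall f', admissible f' -> admissible (fun x y => f' x y * g x y)) ->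
  admissible (fun x y => f x y * g x y ^+ i).
Proof.
move=> hf hg; elim: i => [|i IH].
  by apply: admissible_ext hf => x y; rewrite mulr1.
by apply: admissible_ext (hg _ IH) => x y; rewrite exprSr mulrA.
Qed.

(* sin (x / L) rescaled to the unit interval *)
Definition unit_wave (L x : R) : R := 2^-1 + 2^-1 * cos (x / L - pi / 2).

Lemma unit_wave_itv L x : 0 <= unit_wave L x <= 1.
Proof.
have := cos_geN1 (x / L - pi / 2); have := cos_le1 (x / L - pi / 2).
by rewrite /unit_wave => *; apply/andP; split; lra.
Qed.

Lemma admissible_bernstein f N i L : admissible f ->
  admissible (fun x y => f x y * bernstein N i (unit_wave L x)) /\
  admissible (fun x y => f x y * bernstein N i (unit_wave L y)).
Proof.
have ax f' : admissible f' -> admissible (fun x y => f' x y * unit_wave L x).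
  move=> hf; apply: admissible_ext (admissibleD (admissibleZ 2^-1 hf)
    (admissibleZ 2^-1 (admissibleM_wave L^-1 0 (- (pi / 2)) hf))) => x y.
  by rewrite /wave /unit_wave mul0r addr0 [L^-1 * x]mulrC; ring.
have ay f' : admissible f' -> admissible (fun x y => f' x y * unit_wave L y).
  move=> hf; apply: admissible_ext (admissibleD (admissibleZ 2^-1 hf)
    (admissibleZ 2^-1 (admissibleM_wave 0 L^-1 (- (pi / 2)) hf))) => x y.
  by rewrite /wave /unit_wave mul0r add0r [L^-1 * y]mulrC; ring.
have compl g : (forall f', admissible f' -> admissible (fun x y => f' x y * g x y)) ->
    forall f', admissible f' -> admissible (fun x y => f' x y * (1 - g x y)).
  move=> hg f' hf; apply: admissible_ext (admissibleD hf (admissibleZ (-1) (hg _ hf))) => x y.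
  by ring.
move=> hf; split.
- apply: admissible_ext (admissibleZ 'C(N, i)%:R (admissible_mul_pow (N - i)
    (admissible_mul_pow i hf ax) (compl _ ax))) => x y.
  by rewrite /bernstein; ring.
- apply: admissible_ext (admissibleZ 'C(N, i)%:R (admissible_mul_pow (N - i)
    (admissible_mul_pow i hf ay) (compl _ ay))) => x y.
  by rewrite /bernstein; ring.
Qed.

Definition locally_unif_cont (f : R -> R -> R) := forall M eps, 0 < M -> 0 < eps ->
  exists2 r, 0 < r & forall x y x' y', `|x| <= M -> `|y| <= M -> `|x'| <= M ->
    `|y'| <= M -> `|x - x'| < r -> `|y - y'| < r -> `|f x y - f x' y'| <= eps.

(** With [L = 2 M / pi], [x |-> sin (x / L)] is injective on [-M, M], with inverse given by the
    arcsine. On the box, [f] is thus a continuous function of two unit waves, and its Bernstein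
    polynomial in them is admissible. The Bernstein weights are nonnegative with sum 1, so the bound
    [B] holds on the whole plane, not only on the box. *)
Lemma admissible_approx f B M eps : 0 < M -> 0 < eps ->
  (forall x y, `|f x y| <= B) -> locally_unif_cont f ->
  exists p, [/\ admissible p, forall x y, `|p x y| <= B &
    forall x y, `|x| <= M -> `|y| <= M -> `|f x y - p x y| <= eps].
Proof.
move=> M0 eps0 hB cf; have pp := pi_gt0 R.
have e2 : 0 < eps / 2 by rewrite divr_gt0.
have [r r0 hr] := cf M (eps / 2) M0 e2.
pose L := 2 * M / pi; have L0 : 0 < L by rewrite /L divr_gt0// mulr_gt0.
have LM : L * (pi / 2) = M.
  have h (z : R) : z != 0 -> 2 * M / z * (z / 2) = M by move=> z0; field.
  by apply: h; rewrite gt_eqF.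
pose a (u : R) := L * asin (2 * u - 1).
have dom u : 0 <= u <= 1 -> -1 <= 2 * u - 1 <= (1 : R).
  by move=> /andP[u0 u1]; apply/andP; split; lra.
have aM u : 0 <= u <= 1 -> `|a u| <= M.
  move=> hu; rewrite /a normrM gtr0_norm//.
  apply: (@le_trans _ _ (L * (pi / 2))); last by rewrite le_eqVlt; apply/orP; left;
    apply/eqP; exact: LM.
  by rewrite ler_pM2l// ler_norml asin_geNpi2 ?asin_lepi2// dom.
(* The modulus for [a] is [L] times that of the arcsine, and [asin_modulus] accepts radii up to
   [pi]. *)
pose q := Num.min (r / L) pi.
have q0 : 0 < q by rewrite lt_min pp andbT divr_gt0.
have qpi : q <= pi by rewrite ge_min lexx orbT.
have sq0 : 0 < sin (q / 2) ^+ 2.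
  by rewrite exprn_gt0// sin_gt0_pi//; apply/andP; split; lra.
have ar u u' : 0 <= u <= 1 -> 0 <= u' <= 1 -> `|u - u'| < sin (q / 2) ^+ 2 -> `|a u - a u'| < r.
  move=> hu hu' h; rewrite /a -mulrBr normrM gtr0_norm// mulrC -ltr_pdivlMr//.
  apply: (@lt_le_trans _ _ q); last by rewrite /q ge_min lexx.
  apply: asin_modulus => //; [exact: dom|exact: dom|].
  have -> : 2 * u - 1 - (2 * u' - 1) = 2 * (u - u') by ring.
  by rewrite normrM ger0_norm// ltr_pM2l.
have [N hN] := @bernstein2_approx R (fun u v => f (a u) (a v)) B (eps / 2) _ sq0 e2
  (fun u v _ _ => hB _ _) (fun u v u' v' hu hv hu' hv' h1 h2 => hr _ _ _ _ (aM _ hu) (aM _ hv)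
    (aM _ hu') (aM _ hv') (ar _ _ hu hu' h1) (ar _ _ hv hv' h2)).
pose c i j := f (a (i%:R / N.+1%:R)) (a (j%:R / N.+1%:R)).
exists (fun x y => \sum_(i < N.+2) \sum_(j < N.+2) c i j *
  (bernstein N.+1 i (unit_wave L x) * bernstein N.+1 j (unit_wave L y))); split.
- apply: admissible_sum => i; apply: admissible_sum => j.
  apply: admissible_ext (proj2 (admissible_bernstein N.+1 j L
    (proj1 (admissible_bernstein N.+1 i L (admissible_cst (c i j)))))) => x y.
  by rewrite mulrA.
- move=> x y; have hx := unit_wave_itv L x; have hy := unit_wave_itv L y.
  apply: (@le_trans _ _ (\sum_(i < N.+2) \sum_(j < N.+2) B *
    (bernstein N.+1 i (unit_wave L x) * bernstein N.+1 j (unit_wave L y)))).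
    apply: le_trans (ler_norm_sum _ _ _) _; apply: ler_sum => i _.
    apply: le_trans (ler_norm_sum _ _ _) _; apply: ler_sum => j _.
    rewrite normrM; apply: ler_pM => //; first exact: hB.
    by rewrite ger0_norm// mulr_ge0//; exact: bernstein_ge0.
  under eq_bigr => i _ do (rewrite -mulr_sumr -mulr_sumr bernstein_sum mulr1).
  by rewrite -mulr_sumr bernstein_sum mulr1.
- move=> x y hx hy.
  have inv z : `|z| <= M -> a (unit_wave L z) = z.
    move=> hz; rewrite /a /unit_wave.
    have -> : 2 * (2^-1 + 2^-1 * cos (z / L - pi / 2)) - 1 = sin (z / L).
      by rewrite cosB cos_pihalf sin_pihalf; field.
    rewrite sinK; first by field; exact: lt0r_neq0.
    rewrite in_itv/= -ler_norml normrM (gtr0_norm (x := L^-1)) ?invr_gt0//.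
    rewrite ler_pdivrMr//; apply: le_trans hz _.
    by rewrite mulrC LM.
  have := hN _ _ (unit_wave_itv L x) (unit_wave_itv L y).
  by rewrite !inv// [2 * _]mulrC divfK.
Qed.

(** [f] is the pointwise limit of admissible functions approximating it on growing boxes, and these
    are measurable. *)
Lemma measurable2_luc f B : (forall x y, `|f x y| <= B) -> locally_unif_cont f -> measurable2 f.
Proof.
move=> hB cf.
have /choice[p hp] (n : nat) : exists p, [/\ admissible p, forall x y, `|p x y| <= B &
    forall x y, `|x| <= n.+1%:R -> `|y| <= n.+1%:R -> `|f x y - p x y| <= n.+1%:R^-1].
  by apply: admissible_approx.
move=> e T u v mu mv.
apply: (measurable_fun_cvg (h := fun n w => p n (u w) (v w))) => [n|w _].
  by have [[m _ _] _ _] := hp n; exact: m.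
apply/cvgrPdist_le => eps eps0; near=> n.
have [_ _ h] := hp n; apply: le_trans (h _ _ _ _) _.
- apply: (@le_trans _ _ n%:R); last by rewrite ler_nat.
  by near: n; exact: nbhs_infty_ger.
- apply: (@le_trans _ _ n%:R); last by rewrite ler_nat.
  by near: n; exact: nbhs_infty_ger.
- by apply: ltW; near: n; exact: (near_infty_natSinv_lt (PosNum eps0)).
Unshelve. all: by end_near. Qed.

Definition tight e (T : measurableType e) (Q : nat -> probability T R) (U : nat -> T -> R) :=
  forall eps : R, 0 < eps -> exists2 M : R, 0 < M & \forall n \near \oo,
    exists A, [/\ measurable A, ~` [set w | `|U n w| <= M] `<=` A & (Q n A <= eps%:E)%E].

Lemma tight_cst e (T : measurableType e) (Q : probability T R) (U : T -> R) :
  measurable_fun setT U -> tight (fun=> Q) (fun=> U).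
Proof.
move=> mU eps eps0.
have mA (k : nat) : measurable [set w | k%:R < `|U w|].
  rewrite (_ : [set w | _] = setT `&` (fun w => `|U w|) @^-1` `]k%:R, +oo[%classic).
    by apply: (measurableT_comp (f := @Num.norm R R)).
  by rewrite setTI; apply/seteqP; split => w /=; rewrite in_itv/= andbT.
have h : (fun k => \int[Q]_w \1_[set w | k%:R < `|U w|] w) @ \oo --> \int[Q]_w cst 0 w.
  apply: (E_dct (g := cst 1)).
  - by move=> k; exact: measurable_indic.
  - exact: measurable_cst.
  - move=> w; apply: cvg_near_cst; near=> k; rewrite indicE memNset//=.
    by apply/negP; rewrite -leNgt; near: k; exact: nbhs_infty_ger.
  - exact: L1_cst.
  - by move=> k w; rewrite indicE; case: (_ \in _) => /=; rewrite ?normr1 ?normr0.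
move: h; rewrite (E_cst Q 0) => /cvgr0Pnorm_le/(_ _ eps0)[k _ /(_ _ (leqnn k))].
move=> hk; exists k.+1%:R => //; apply: nearW => n; exists [set w | k%:R < `|U w|]; split => //.
  move=> w /= /negP; rewrite -ltNge; apply: le_lt_trans.
  by rewrite ler_nat.
by rewrite -E_indic// lee_fin; apply: le_trans hk; exact: ler_norm.
Unshelve. all: by end_near. Qed.

(** [f] is replaced by an admissible [p] under [P n] and under [P']. Each replacement costs [q] on
    the box, and [2 * B] off it with probability at most [2 * q], in total [q * (1 + 4 * B)]. *)
Lemma cvg_of_waves f B : (forall x y, `|f x y| <= B) -> locally_unif_cont f ->
  tight P X -> tight P Y ->
  (fun n => \int[P n]_w f (X n w) (Y n w)) @ \oo --> \int[P']_w f (X' w) (Y' w).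
Proof.
move=> hB cf tX tY; have mf := measurable2_luc hB cf.
have B0 : 0 <= B by apply: le_trans (hB 0 0).
apply/cvgrPdist_le => e e0.
pose q := e / (5 * (1 + 4 * B)).
have q0 : 0 < q by rewrite divr_gt0// mulr_gt0// ltr_wpDr// mulr_ge0.
have [M1 M10 h1] := tX q q0; have [M2 M20 h2] := tY q q0.
have [M3 M30 [n3 _ /(_ _ (leqnn n3)) h3]] := tight_cst P' mX' q0.
have [M4 M40 [n4 _ /(_ _ (leqnn n4)) h4]] := tight_cst P' mY' q0.
pose M := M1 + M2 + M3 + M4.
have M0 : 0 < M by rewrite /M; lra.
have [p [ap pB pf]] := @admissible_approx f B M q M0 q0 hB cf.
have mp : measurable2 p by case: ap.
have close e1 (T : measurableType e1) (Q : probability T R) (u v : T -> R) Mu Mv :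
    measurable_fun setT u -> measurable_fun setT v -> Mu <= M -> Mv <= M ->
    (exists A, [/\ measurable A, ~` [set w | `|u w| <= Mu] `<=` A & (Q A <= q%:E)%E]) ->
    (exists A, [/\ measurable A, ~` [set w | `|v w| <= Mv] `<=` A & (Q A <= q%:E)%E]) ->
    `|\int[Q]_w f (u w) (v w) - \int[Q]_w p (u w) (v w)| <= q * (1 + 4 * B).
  move=> mu mv uM vM [A1 [mA1 sA1 PA1]] [A2 [mA2 sA2 PA2]].
  have if_ : L1 Q (fun w => f (u w) (v w)) by apply: (L1_bounded Q (M := B)) => //; exact: mf.
  have ip : L1 Q (fun w => p (u w) (v w)) by apply: (L1_bounded Q (M := B)) => //; exact: mp.
  rewrite -E_B//; apply: le_trans (E_norm (L1B if_ ip)) _.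
  apply: (@le_trans _ _ (q + 2 * B * (q + q))); last by rewrite le_eqVlt; apply/orP; left;
    apply/eqP; ring.
  apply: (@E_le_off _ _ _ Q _ (A1 `|` A2)) => //.
  - exact/L1_norm/L1B.
  - exact: measurableU.
  - by apply: le_trans (measureU2 _ mA1 mA2) _; rewrite EFinD leeD.
  - by rewrite mulr_ge0.
  - exact: ltW.
  - apply: nearW => w; rewrite mulr2n mulrDl mul1r; apply: le_trans (ler_normB _ _) _.
    exact: lerD.
  - apply: nearW => w nA; apply: pf.
    + apply: le_trans uM; apply: contrapT => h; apply: nA; left; exact: sA1.
    + apply: le_trans vM; apply: contrapT => h; apply: nA; right; exact: sA2.
have [_ _ /(_ 0 0 (0 : R)) cp] := ap.
have cp' : (fun n => \int[P n]_w p (X n w) (Y n w)) @ \oo --> \int[P']_w p (X' w) (Y' w).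
  have wE x y : p x y * wave 0 0 0 x y = p x y by rewrite /wave !mul0r !addr0 cos0 mulr1.
  move: cp; under eq_fun do under E_ext do rewrite wE.
  by under [X in _ --> X -> _]E_ext do rewrite wE.
move/cvgrPdist_le : cp' => /(_ q q0) cp'.
have Q' := close _ _ P' X' Y' M3 M4 mX' mY' _ _ h3 h4.
near=> n.
have hn1 : `|\int[P']_w p (X' w) (Y' w) - \int[P n]_w p (X n w) (Y n w)| <= q by near: n.
have hn2 : `|\int[P n]_w f (X n w) (Y n w) - \int[P n]_w p (X n w) (Y n w)| <= q * (1 + 4 * B).
  apply: (close _ _ (P n) (X n) (Y n) M1 M2 (mX n) (mY n)); first by rewrite /M; lra.
  - by rewrite /M; lra.
  - by near: n.
  - by near: n.
have {}Q' : `|\int[P']_w f (X' w) (Y' w) - \int[P']_w p (X' w) (Y' w)| <= q * (1 + 4 * B).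
  by apply: Q'; rewrite /M; lra.
have qe : q * (5 * (1 + 4 * B)) = e.
  by rewrite /q divfK// gt_eqF// mulr_gt0// ltr_wpDr// mulr_ge0.
have qB : 0 <= q * B by rewrite mulr_ge0// ltW.
move: Q' hn1 hn2 qe qB; rewrite !ler_norml.
set a1 := \int[_]_w _; set a2 := \int[_]_w _; set a3 := \int[_]_w _; set a4 := \int[_]_w _.
move=> /andP[? ?] /andP[? ?] /andP[? ?] ? ?; apply/andP; split; nra.
Unshelve. all: by end_near. Qed.

End trigonometric_test_functions.

(** * Quadratic forms and Gaussian vectors in dimension two *)

Section two_dimensional_jets.
Context (R : realType).
Implicit Types (al be : R) (v : 'cV[R]_2) (G : 'M[R]_2).

Lemma sum_ord2 (f : 'I_2 -> R) : \sum_i f i = f 0 + f 1.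
Proof.
rewrite !big_ord_recl big_ord0 addr0 (_ : ord0 = 0)//; congr (_ + f _).
exact: val_inj.
Qed.

Lemma dotp_jet_vector al be v : dotp (jet_vector al be) v = al * v 0 0 + be * v 1 0.
Proof. by rewrite /dotp mxE sum_ord2 !mxE. Qed.

Lemma pred_normsq_jet_vector G al be : pred_normsq G (jet_vector al be) =
  al ^+ 2 * G 0 0 + al * be * G 0 1 + (al * be * G 1 0 + be ^+ 2 * G 1 1).
Proof.
by rewrite /pred_normsq /pred_inner mxE sum_ord2 !mxE !sum_ord2 !mxE /=; ring.
Qed.

Lemma pred_normsq_ge0 G u : positive_definite G -> 0 <= pred_normsq G u.
Proof.
move=> [_ h]; have [->|/h/ltW//] := eqVneq u 0.
by rewrite /pred_normsq /pred_inner trmx0 mul0mx mul0mx mxE.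
Qed.

Lemma euclid_norm_ge0 v : 0 <= euclid_norm v.
Proof. exact: sqrtr_ge0. Qed.

Lemma euclid_norm_sqr v : euclid_norm v ^+ 2 = v 0 0 ^+ 2 + v 1 0 ^+ 2.
Proof.
rewrite /euclid_norm sqr_sqrtr; last by apply: sumr_ge0 => i _; exact: sqr_ge0.
by rewrite sum_ord2.
Qed.

Lemma coord_le_euclid_norm v i : `|v i 0| <= euclid_norm v.
Proof.
rewrite -(ler_sqr (normr_ge0 _) (euclid_norm_ge0 v)) euclid_norm_sqr real_normK ?num_real//.
have [->|->] : i = 0 \/ i = 1.
  by case: i => [[|[|]]] // h; [left|right]; exact: val_inj.
- by rewrite lerDl sqr_ge0.
- by rewrite lerDr sqr_ge0.
Qed.

Lemma gaussian_vector_cos d (Omega : measurableType d) (P : probability Omega R)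
    (Z : Omega -> 'cV[R]_2) G al be phi : positive_definite G -> gaussian_vector P Z G ->
  \int[P]_w cos (al * Z w 0 0 + be * Z w 1 0 + phi) =
  cos phi * expR (- (pred_normsq G (jet_vector al be) / 2)).
Proof.
move=> pG [mZ hZ]; pose u := jet_vector al be.
have mU : measurable_fun setT (fun w => dotp u (Z w) : measurableTypeR R).
  under eq_fun do rewrite dotp_jet_vector.
  by apply: measurable_funD; apply: measurable_funM.
under E_ext do rewrite -dotp_jet_vector.
rewrite -/u; have mN0 : measurable ([set~ 0] : set R) by apply: measurableC;
  exact: measurable_set1.
(* For variance 0, [gaussian_vector] prescribes a Dirac mass at 0, which is treated apart from the
   density. *)
have := pred_normsq_ge0 u pG; rewrite le_eqVlt => /orP[/eqP h0|hpos].
  have ae : {ae P, forall w, cos (dotp u (Z w) + phi) = cst (cos phi) w}.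
    exists [set w | (~` [set 0]) (dotp u (Z w))]; split.
    - by rewrite -[X in measurable X]setTI; apply: mU => //; exact: mN0.
    - rewrite hZ//.
      by rewrite -h0 eqxx diracE memNset//=; apply.
    - by move=> w /= h h2; apply: h; rewrite h2 add0r.
  rewrite (E_ae _ _ ae)//; last first.
    apply: (measurableT_comp (f := @cos R)); last exact: measurable_funD.
    by apply: continuous_measurable_fun; exact: continuous_cos.
  by rewrite (E_cst P (cos phi)) -h0 mul0r oppr0 expR0 mulr1.
have s0 : 0 < Num.sqrt (pred_normsq G u) by rewrite sqrtr_gt0.
rewrite -[X in _ * expR (- (X / 2))]sqr_sqrtr ?ltW// -normal_cos//.
rewrite /Rintegral; congr fine.
have mc : measurable_fun setT (fun x : measurableTypeR R => (cos (x + phi))%:E).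
  apply/measurable_EFinP; apply: (measurableT_comp (f := @cos R)); last exact: measurable_funD.
  by apply: continuous_measurable_fun; exact: continuous_cos.
rewrite (@eq_measure_integral _ _ _ _ (pushforward P (fun w =>
  dotp u (Z w) : measurableTypeR R))); last first.
  by move=> B mB _; have := hZ u B mB; rewrite gt_eqF// => <-.
rewrite integral_pushforward//= preimage_setT.
apply: (L1_bounded P (M := 1)).
  by apply/measurable_EFinP; apply: (measurableT_comp mc).
by move=> w; rewrite /= ler_norml cos_geN1 cos_le1.
Qed.

End two_dimensional_jets.

(** * Arrays of normalised jets *)

Section jet_arrays.
Context d (Omega : measurableType d) (R : realType).
Variable P : nat -> probability Omega R.
Variable F : nat -> set (set Omega).
Hypothesis sF : forall k, sub_algebra (F k).
Hypothesis FS : forall k, F k `<=` F k.+1.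
Variables (V : nat -> nat -> Omega -> 'cV[R]_2) (G : 'M[R]_2).
Hypothesis V_md : forall n k, (1 <= k <= n)%N ->
  sq_integrable_martingale_difference (P n) F k (V n k).
Hypothesis lindeberg : conditional_lindeberg P F V.
Hypothesis gram_cvg : gram_cvg_in_prob P F V G.
Hypothesis posG : positive_definite G.

Let ce n k i j := cond_exp (P n) (F k.-1) (fun w => V n k w i 0 * V n k w j 0).

Let mdV n k i : (1 <= k <= n)%N -> mdiff (P n) F k (fun w => V n k w i 0).
Proof. by move=> kn; have := V_md kn i. Qed.

Let mV n k i : (1 <= k <= n)%N -> measurable_fun setT (fun w => V n k w i 0).
Proof. by move=> kn; exact: mdiff_measurable (mdV i kn). Qed.

Let L1VV n k i j : (1 <= k <= n)%N -> L1 (P n) (fun w => V n k w i 0 * V n k w j 0).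
Proof.
by move=> kn; apply: L1_mul; [exact: mV|exact: mV|case: (mdV i kn)|case: (mdV j kn)].
Qed.

Let ceP n k i j : (1 <= k <= n)%N ->
  is_cond_exp (P n) (F k.-1) (fun w => V n k w i 0 * V n k w j 0) (ce n k i j).
Proof. by move=> kn; apply: cond_expP => //; exact: L1VV. Qed.

Let gram_whp i j eta : 0 < eta ->
  whp P (fun n => [set w | `|predictable_gram (P n) F (V n) n w i j - G i j| <= eta]).
Proof.
move=> eta0; apply: (cvg_in_prob_whp _ (gram_cvg i j) eta0).
apply: nearW => n; under eq_fun do rewrite mxE big_nat.
apply: measurable_funM => //; apply: (L1_measurable (P := P n)); apply: L1_sum => k kn.
exact: is_cond_exp_L1 (ceP i j kn).
Qed.

Section linear_form.
Variables al be : R.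

(** Cramér-Wold reduction: the vector of jets is studied through all its linear forms, which are
    scalar martingale arrays. *)
Let X n k w := (Num.sqrt n%:R)^-1 * (al * V n k w 0 0 + be * V n k w 1 0).
Let s0 n k w := n%:R^-1 * ((al ^+ 2 * ce n k 0 0 w + al * be * ce n k 0 1 w) +
  (al * be * ce n k 1 0 w + be ^+ 2 * ce n k 1 1 w)).
Let v := pred_normsq G (jet_vector al be).

Let sqrtn2 n : (Num.sqrt n%:R)^-1 ^+ 2 = n%:R^-1 :> R.
Proof. by rewrite exprVn sqr_sqrtr. Qed.

Let mdX n k : (1 <= k <= n)%N -> mdiff (P n) F k (X n k).
Proof. by move=> kn; apply/mdiffZ/mdiffD => //; apply/mdiffZ => //; exact: mdV. Qed.

Let s0P n k : (1 <= k <= n)%N ->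
  is_cond_exp (P n) (F k.-1) (fun w => X n k w ^+ 2) (s0 n k).
Proof.
move=> kn; rewrite (_ : (fun w => _) = fun w => n%:R^-1 *
  ((al ^+ 2 * (V n k w 0 0 * V n k w 0 0) + al * be * (V n k w 0 0 * V n k w 1 0)) +
   (al * be * (V n k w 1 0 * V n k w 0 0) + be ^+ 2 * (V n k w 1 0 * V n k w 1 0)))).
  apply: is_cond_expZ => //.
    by apply: L1D; apply: L1D; apply: L1Z; exact: L1VV.
  apply: is_cond_expD => //.
  - by apply: L1D; apply: L1Z; exact: L1VV.
  - by apply: L1D; apply: L1Z; exact: L1VV.
  - apply: is_cond_expD => //; try (apply: L1Z; exact: L1VV).
      by apply: is_cond_expZ => //; [exact: L1VV|exact: ceP].
    by apply: is_cond_expZ => //; [exact: L1VV|exact: ceP].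
  - apply: is_cond_expD => //; try (apply: L1Z; exact: L1VV).
      by apply: is_cond_expZ => //; [exact: L1VV|exact: ceP].
    by apply: is_cond_expZ => //; [exact: L1VV|exact: ceP].
by apply/funext => w; rewrite /X exprMn sqrtn2; ring.
Qed.

Let variance_cvg eta : 0 < eta ->
  whp P (fun n => [set w | `|\sum_(1 <= k < n.+1) s0 n k w - v| <= eta]).
Proof.
move=> eta0; pose c := (`|al| + `|be|) ^+ 2 + 1.
have c0 : 0 < c by rewrite ltr_wpDl// sqr_ge0.
have e0 : 0 < eta / c by rewrite divr_gt0.
apply: whp_sub (whpI (whpI (gram_whp 0 0 e0) (gram_whp 0 1 e0))
  (whpI (gram_whp 1 0 e0) (gram_whp 1 1 e0))).
apply: nearW => n w [[/= h1 h2] [/= h3 h4]].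
have -> : \sum_(1 <= k < n.+1) s0 n k w - v =
    al ^+ 2 * (predictable_gram (P n) F (V n) n w 0 0 - G 0 0) +
    al * be * (predictable_gram (P n) F (V n) n w 0 1 - G 0 1) +
    al * be * (predictable_gram (P n) F (V n) n w 1 0 - G 1 0) +
    be ^+ 2 * (predictable_gram (P n) F (V n) n w 1 1 - G 1 1).
  rewrite /v pred_normsq_jet_vector !mxE /s0 -mulr_sumr !big_split/= -!mulr_sumr.
  by rewrite /ce; ring.
move: h1 h2 h3 h4.
move: (_ - G 0 0) (_ - G 0 1) (_ - G 1 0) (_ - G 1 1) => x1 x2 x3 x4 h1 h2 h3 h4.
apply: (@le_trans _ _ (`|al| ^+ 2 * (eta / c) + `|al| * `|be| * (eta / c) +
    `|al| * `|be| * (eta / c) + `|be| ^+ 2 * (eta / c))).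
  apply: le_trans (ler_normD _ _) _; apply: lerD; first (apply: le_trans (ler_normD _ _) _;
    apply: lerD;
    first (apply: le_trans (ler_normD _ _) _; apply: lerD)).
  - by rewrite normrM normrX ler_wpM2l ?exprn_ge0.
  - by rewrite !normrM ler_wpM2l ?mulr_ge0.
  - by rewrite !normrM ler_wpM2l ?mulr_ge0.
  - by rewrite normrM normrX ler_wpM2l ?exprn_ge0.
have -> : `|al| ^+ 2 * (eta / c) + `|al| * `|be| * (eta / c) +
    `|al| * `|be| * (eta / c) + `|be| ^+ 2 * (eta / c) =
  (`|al| + `|be|) ^+ 2 * (eta / c) by ring.
rewrite mulrA ler_pdivrMr// [leRHS]mulrC ler_wpM2r ?ltW//.
by rewrite /c ltrDl.
Qed.

(** As [|X n k|] is at most [c / sqrt n] times the norm of [V n k], its truncated square at [e] is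
    dominated by [c ^+ 2 / n] times that of the norm at [e / c * sqrt n]. *)
Let lindebergX e : 0 < e -> exists Z l : nat -> nat -> Omega -> R,
  [/\ forall n k, (1 <= k <= n)%N -> L1 (P n) (Z n k),
      forall n k w, (1 <= k <= n)%N -> tail_sqr e (X n k w) <= Z n k w,
      forall n k, (1 <= k <= n)%N -> is_cond_exp (P n) (F k.-1) (Z n k) (l n k) &
      forall eta : R, 0 < eta ->
        whp P (fun n => [set w | \sum_(1 <= k < n.+1) l n k w <= eta])].
Proof.
move=> e0; pose c := `|al| + `|be| + 1.
have c0 : 0 < c by rewrite ltr_wpDl// addr_ge0.
have ec0 : 0 < e / c by rewrite divr_gt0.
pose T n k w := euclid_norm (V n k w) ^+ 2 *
  \1_[set w' | e / c * Num.sqrt n%:R < euclid_norm (V n k w')] w.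
have mN n k : (1 <= k <= n)%N -> measurable_fun setT (fun w => euclid_norm (V n k w)).
  move=> kn; apply: (measurableT_comp (f := @Num.sqrt R)).
    by apply: continuous_measurable_fun; exact: sqrt_continuous.
  under eq_fun do rewrite sum_ord2.
  by apply: measurable_funD; apply: measurable_funX; exact: mV.
have iT n k : (1 <= k <= n)%N -> L1 (P n) (T n k).
  move=> kn; apply: (L1_le (g := fun w => V n k w 0 0 ^+ 2 + V n k w 1 0 ^+ 2)).
  - apply: measurable_funM; first by apply: measurable_funX; exact: mN.
    apply: measurable_indic; rewrite (_ : [set w' | _] =
      setT `&` (fun w => euclid_norm (V n k w)) @^-1` `]e / c * Num.sqrt n%:R, +oo[%classic).
      exact: mN.
    by rewrite setTI; apply/seteqP; split => w /=; rewrite in_itv/= andbT.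
  - by apply: L1D; [case: (mdV 0 kn)|case: (mdV 1 kn)].
  - move=> w; rewrite /T normrM -euclid_norm_sqr ger0_norm ?sqr_ge0//.
    rewrite ler_piMr ?sqr_ge0// indicE; case: (_ \in _) => /=; rewrite ?normr1 ?normr0//.
exists (fun n k w => c ^+ 2 / n%:R * T n k w).
exists (fun n k w => c ^+ 2 / n%:R * cond_exp (P n) (F k.-1) (T n k) w); split.
- by move=> n k kn; apply: L1Z; exact: iT.
- move=> n k w kn.
  have n0 : 0 < n%:R :> R by rewrite ltr0n; case/andP: kn => k1 kn; exact: leq_trans k1 kn.
  have sn0 : 0 < Num.sqrt n%:R :> R by rewrite sqrtr_gt0.
  have hX : `|X n k w| <= c / Num.sqrt n%:R * euclid_norm (V n k w).
    rewrite /X normrM gtr0_norm ?invr_gt0// mulrAC mulrC ler_pM2r ?invr_gt0//.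
    apply: le_trans (ler_normD _ _) _; rewrite !normrM /c mulrDl mulrDl mul1r.
    apply: (@le_trans _ _ (`|al| * euclid_norm (V n k w) + `|be| * euclid_norm (V n k w))).
      by apply: lerD; apply: ler_wpM2l => //; exact: coord_le_euclid_norm.
    by rewrite lerDl euclid_norm_ge0.
  rewrite /tail_sqr; have [eX|_] := ltP e `|X n k w|; last first.
    rewrite mulr0; apply: mulr_ge0; first by rewrite divr_ge0 ?sqr_ge0.
    by rewrite /T mulr_ge0 ?sqr_ge0// indicE.
  rewrite mulr1 /T indicE mem_set ?mulr1/=; last first.
    rewrite mulrAC ltr_pdivrMr// -ltr_pdivlMr//; apply: lt_le_trans eX _.
    by apply: le_trans hX _; rewrite [_ * c]mulrC mulrAC.
  rewrite -(sqr_sqrtr (ltW n0)) -expr_div_n -exprMn -[X n k w ^+ 2]real_normK ?num_real//.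
  by rewrite ler_sqr// nnegrE mulr_ge0 ?divr_ge0 ?euclid_norm_ge0 ?ltW.
- by move=> n k kn; apply: is_cond_expZ => //; [exact: iT|apply: cond_expP => //; exact: iT].
- move=> eta eta0; have eta1 : 0 < eta / c ^+ 2 by rewrite divr_gt0 ?exprn_gt0.
  apply: whp_sub (cvg_in_prob_whp _ (lindeberg ec0) eta1).
    apply: nearW => n w /=; rewrite subr0 => /(le_trans (ler_norm _)).
    by rewrite ler_pdivlMr ?exprn_gt0// mulrC mulrA -mulr_sumr.
  apply: nearW => n; apply: measurable_funM => //.
  under eq_fun do rewrite big_nat.
  apply: (L1_measurable (P := P n)); apply: L1_sum => k kn.
  by apply: is_cond_exp_L1 (cond_expP _ (iT _ _ kn)).
Qed.

Let v0 : 0 <= v. Proof. exact: pred_normsq_ge0. Qed.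

Lemma jet_array_clt phi :
  (fun n => \int[P n]_w
     cos (al * (\sum_(1 <= k < n.+1) (Num.sqrt n%:R)^-1 * V n k w 0 0) +
          be * (\sum_(1 <= k < n.+1) (Num.sqrt n%:R)^-1 * V n k w 1 0) + phi)) @ \oo -->
  cos phi * expR (- (pred_normsq G (jet_vector al be) / 2)).
Proof.
have := @martingale_array_clt _ _ _ P F sF FS X s0 v v0 mdX s0P variance_cvg lindebergX phi.
apply: cvg_trans; apply: near_eq_cvg; apply: nearW => n; apply: E_ext => w.
by rewrite !mulr_sumr -big_split/=; congr (cos (_ + _)); apply: eq_bigr => k _; rewrite /X;
  ring.
Qed.

Lemma jet_array_max eta : 0 < eta ->
  whp P (fun n => [set w | forall k, (1 <= k <= n)%N ->
    `|(Num.sqrt n%:R)^-1 * (al * V n k w 0 0 + be * V n k w 1 0)| <= eta]).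
Proof. exact: (martingale_array_max sF FS v0 mdX s0P variance_cvg lindebergX). Qed.

Lemma jet_array_quadratic_variation eta : 0 < eta ->
  whp P (fun n => [set w | `|\sum_(1 <= k < n.+1)
    ((Num.sqrt n%:R)^-1 * (al * V n k w 0 0 + be * V n k w 1 0)) ^+ 2 -
    pred_normsq G (jet_vector al be)| <= eta]).
Proof.
exact: (martingale_array_quadratic_variation sF FS v0 mdX s0P variance_cvg lindebergX).
Qed.

Lemma jet_array_tight : tight P (fun n w => \sum_(1 <= k < n.+1)
  (Num.sqrt n%:R)^-1 * (al * V n k w 0 0 + be * V n k w 1 0)).
Proof.
move=> eps eps0.
have [M [M0 h]] := martingale_array_tight sF FS v0 mdX s0P variance_cvg eps0.
by exists M.
Qed.

End linear_form.

End jet_arrays.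

(** * The Sobolev remainder *)

Section lower_integral.
Context d (Omega : measurableType d) (R : realType) (P : probability Omega R).

(* [g] need not be measurable: the integral is a lower integral. *)
Lemma le_lower_integral (f g : Omega -> \bar R) :
  (forall w, 0 <= f w)%E -> (forall w, f w <= g w)%E ->
  (\int[P]_w f w <= \int[P]_w g w)%E.
Proof.
move=> f0 fg; rewrite !ge0_integralTE//; last by move=> w; exact: le_trans (fg w).
apply: le_ereal_sup => _ [h hf <-]; exists h => // w.
exact: le_trans (hf w) (fg w).
Qed.

(** Turns a bound by a possibly nonmeasurable [g], here a squared Sobolev norm, into integrability
    of [f]. Setting [f] to 0 on a measurable null set makes the domination hold everywhere, so that
    the lower integrals can be compared. *)
Lemma L1_le_lower (f : Omega -> R) (g : Omega -> \bar R) (c : R) :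
  measurable_fun setT f -> (forall w, 0 <= f w) -> 0 < c -> (forall w, 0 <= g w)%E ->
  {ae P, forall w, ((f w)%:E <= c%:E * g w)%E} -> (\int[P]_w g w < +oo)%E ->
  L1 P f /\ \int[P]_w f w <= c * fine (\int[P]_w g w).
Proof.
move=> mf f0 c0 g0 [N [mN PN sN]] gfin.
pose h w := c^-1 * (\1_(~` N) w * f w).
have mh : measurable_fun setT h.
  apply: measurable_funM => //; apply: measurable_funM => //.
  exact/measurable_indic/measurableC.
have h0 w : 0 <= h w by apply: mulr_ge0; [rewrite invr_ge0 ltW|apply: mulr_ge0;
  rewrite ?indicE].
have hg w : ((h w)%:E <= g w)%E.
  rewrite /h indicE; have [nN|_] := boolP (w \in ~` N); last by rewrite mul0r mulr0.
  rewrite mul1r EFinM lee_pdivrMl//.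
  by apply: contrapT => hn; move/set_mem : nN; apply; exact: sN.
have hh : (\int[P]_w (h w)%:E <= \int[P]_w g w)%E by apply: le_lower_integral.
have ih : L1 P h.
  apply/integrableP; split; first exact/measurable_EFinP.
  by under eq_integral do rewrite /= ger0_norm//; exact: le_lt_trans gfin.
have ae : {ae P, forall w, c * h w = f w}.
  exists N; split => // w /= hw; apply: contrapT => nN; apply: hw.
  by rewrite /h indicE mem_set//= mul1r mulVKf// gt_eqF.
have if_ : L1 P f by exact: L1_ae ae (L1Z c ih).
split=> //; rewrite -(E_ae (L1_measurable (L1Z c ih)) mf ae) E_Z// ler_pM2l//.
by rewrite /Rintegral fine_le//;
  [exact: integrable_fin_num|rewrite ge0_fin_numE// integral_ge0].
Qed.

(** The exceptional events increase with [N], so Markov's bound, uniform in [N], passes to their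
    union by continuity from below. *)
Lemma monotone_markov (u : nat -> Omega -> R) (c kappa : R) :
  (forall N w, 0 <= u N w) -> (forall N w, u N w <= u N.+1 w) ->
  (forall N, L1 P (u N)) -> (forall N, \int[P]_w u N w <= c) -> 0 < kappa ->
  exists A, [/\ measurable A, forall w, ~ A w -> forall N, u N w <= kappa &
    (P A <= (c / kappa)%:E)%E].
Proof.
move=> u0 uS iu Eu k0.
have mB N : measurable [set w | kappa < u N w].
  rewrite (_ : [set w | _] = setT `&` u N @^-1` `]kappa, +oo[%classic).
    by apply: (L1_measurable (iu N)).
  by rewrite setTI; apply/seteqP; split => w /=; rewrite in_itv/= andbT.
exists (\bigcup_N [set w | kappa < u N w]); split.
- exact: bigcupT_measurable.
- by move=> w nA N; rewrite leNgt; apply/negP => h; apply: nA; exists N.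
have ndB : nondecreasing_seq (fun N => [set w | kappa < u N w]).
  apply/nondecreasing_seqP => N; apply/subsetPset => w /= /lt_le_trans; apply.
  exact: uS.
have cB := nondecreasing_cvg_mu (mu := P) mB (bigcupT_measurable _ mB) ndB.
rewrite -(cvg_lim _ cB)//; apply: lime_le; first by apply/cvg_ex; eexists; exact: cB.
apply: nearW => N /=; apply: le_trans (E_markov k0 (iu N) (u0 N)) _.
by rewrite lee_fin ler_pM2r ?invr_gt0.
Qed.

End lower_integral.

Section energy_of_martingales.
Context d (Omega : measurableType d) (R : realType) (P : probability Omega R).
Variable F : nat -> set (set Omega).
Hypothesis sF : forall k, sub_algebra (F k).
Hypothesis FS : forall k, F k `<=` F k.+1.
Variables (a b : R).
Hypothesis ab : a < b.

Lemma energy_measurable N (g : R -> Omega -> R) :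
  (forall z, measurable_fun setT (g z)) ->
  measurable_fun setT (fun w => energy a b N (g ^~ w)).
Proof.
move=> mg; apply: measurable_funD; first exact: measurable_funX.
apply: measurable_sum => i; apply: measurable_funM => //.
by apply: measurable_funX; exact: measurable_funB.
Qed.

Variables (rho : nat -> R -> Omega -> R) (n : nat).
Hypothesis mrho : forall k z, (1 <= k <= n)%N -> sub_measurable (F k) (rho k z).
Hypothesis rho0 : forall k z, (1 <= k <= n)%N -> is_cond_exp P (F k.-1) (rho k z) (cst 0).
Hypothesis irho : forall k N, (1 <= k <= n)%N -> L1 P (fun w => energy a b N (rho k ^~ w)).

Let md k N i : (1 <= k <= n)%N -> (i <= 2 ^ N)%N -> mdiff P F k (rho k (grid a b N i)).
Proof.
move=> kn iN; split; [exact: mrho| |exact: rho0].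
apply: (L1_le (g := fun w => 2 * (1 + (b - a)) * energy a b N (rho k ^~ w))).
- by apply: measurable_funX; exact: sub_measurable_fun (mrho _ kn).
- by apply: L1Z; exact: irho.
- by move=> w; rewrite ger0_norm ?sqr_ge0//; exact: (grid_le_energy ab (fun z => rho k z w)).
Qed.

(** The energy is a combination of squares of values and increments at fixed points. At fixed points
    the cross terms of martingale differences integrate to 0. *)
Lemma energy_mdiff_sum N :
  L1 P (fun w => energy a b N (fun z => \sum_(1 <= k < n.+1) rho k z w)) /\
  \int[P]_w energy a b N (fun z => \sum_(1 <= k < n.+1) rho k z w) =
  \sum_(1 <= k < n.+1) \int[P]_w energy a b N (rho k ^~ w).
Proof.
have ha : a = grid a b N 0 by rewrite grid0.
have mda k : (1 <= k <= n)%N -> mdiff P F k (rho k a) by move=> kn; rewrite ha; exact: md.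
have mdD k (i : 'I_(2 ^ N)) : (1 <= k <= n)%N ->
    mdiff P F k (fun w => rho k (grid a b N i.+1) w - rho k (grid a b N i) w).
  move=> kn; have h := @mdiffD _ _ _ P F sF k _ _ (md kn (ltn_ord i))
    (mdiffZ sF (-1) (md kn (ltnW (ltn_ord i)))).
  by move: h; congr (mdiff _ _ _ _); apply/funext => w; rewrite mulN1r.
have [ia Ea] := mdiff_sum_L2 sF FS mda.
have hD i := mdiff_sum_L2 sF FS (fun k => @mdD k i).
have sD (i : 'I_(2 ^ N)) w : \sum_(1 <= k < n.+1) rho k (grid a b N i.+1) w -
    \sum_(1 <= k < n.+1) rho k (grid a b N i) w =
    \sum_(1 <= k < n.+1) (rho k (grid a b N i.+1) w - rho k (grid a b N i) w).
  by rewrite sumrB.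
have iD (i : 'I_(2 ^ N)) : L1 P (fun w => (\sum_(1 <= k < n.+1) rho k (grid a b N i.+1) w -
    \sum_(1 <= k < n.+1) rho k (grid a b N i) w) ^+ 2 / mesh a b N).
  under eq_fun do rewrite sD mulrC.
  by apply: L1Z; case: (hD i).
have is_ : L1 P (fun w => \sum_(i < 2 ^ N) (\sum_(1 <= k < n.+1) rho k (grid a b N i.+1) w -
    \sum_(1 <= k < n.+1) rho k (grid a b N i) w) ^+ 2 / mesh a b N).
  by apply: L1_sum => i _; exact: iD.
split; first exact: L1D.
have [mdai mdDi] : (forall k, (1 <= k <= n)%N -> L1 P (fun w => rho k a w ^+ 2)) /\
   (forall k (i : 'I_(2 ^ N)), (1 <= k <= n)%N -> L1 P (fun w => (mesh a b N)^-1 *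
      (rho k (grid a b N i.+1) w - rho k (grid a b N i) w) ^+ 2)).
  split; first by move=> k /mda[].
  by move=> k i kn; apply: L1Z; case: (mdD k i kn).
rewrite E_D// Ea E_sum//.
have Ek k : (1 <= k <= n)%N -> \int[P]_w energy a b N (rho k ^~ w) =
  \int[P]_w (rho k a w ^+ 2) +
    \sum_(i < 2 ^ N) (mesh a b N)^-1 * \int[P]_w ((rho k (grid a b N i.+1) w - rho k (grid a b N i) w) ^+ 2).
  move=> kn; rewrite /energy E_D; [|exact: mdai|].
    congr (_ + _); rewrite E_sum.
      by apply: eq_bigr => i _; rewrite -E_Z; [apply: E_ext => w;
        rewrite mulrC|case: (mdD k i kn)].
    by move=> i _; under eq_fun do rewrite mulrC; exact: mdDi.
  by apply: L1_sum => i _; under eq_fun do rewrite mulrC; exact: mdDi.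
rewrite [RHS]big_nat (eq_bigr _ Ek) -big_nat big_split/=; congr (_ + _).
rewrite exchange_big/=; apply: eq_bigr => i _.
rewrite -mulr_sumr -(proj2 (hD i)) -E_Z; last by case: (hD i).
by apply: E_ext => w; rewrite sD mulrC.
Qed.

End energy_of_martingales.

Section continuity_within.
Context (R : realType) (A : set R).
Implicit Types f g : R -> R.

Lemma within_cst (c : R) : {within A, continuous (fun=> c)}.
Proof. by move=> x; exact: cvg_cst. Qed.

Lemma within_continuousMr f g : {within A, continuous f} -> {within A, continuous g} ->
  {within A, continuous (fun x => f x * g x)}.
Proof. by move=> cf cg x; apply: cvgM; [exact: cf|exact: cg]. Qed.

Lemma within_continuousDr f g : {within A, continuous f} -> {within A, continuous g} ->
  {within A, continuous (fun x => f x + g x)}.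
Proof. by move=> cf cg x; apply: cvgD; [exact: cf|exact: cg]. Qed.

Lemma within_continuousBr f g : {within A, continuous f} -> {within A, continuous g} ->
  {within A, continuous (fun x => f x - g x)}.
Proof. by move=> cf cg x; apply: cvgB; [exact: cf|exact: cg]. Qed.

Lemma within_continuousX f n : {within A, continuous f} ->
  {within A, continuous (fun x => f x ^+ n)}.
Proof.
move=> cf; elim: n => [|n IH]; first exact: within_cst.
by under eq_fun do rewrite exprS; exact: within_continuousMr.
Qed.

Lemma within_continuous_sum (f : nat -> R -> R) n :
  (forall k, (1 <= k <= n)%N -> {within A, continuous (f k)}) ->
  {within A, continuous (fun x => \sum_(1 <= k < n.+1) f k x)}.
Proof.
elim: n => [|n IH] h.
  by under eq_fun do rewrite big_geq//; exact: within_cst.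
under eq_fun do rewrite big_nat_recr//=; move=> x; apply: cvgD; last by apply: h;
  rewrite /= leqnn.
by apply: IH => k /andP[k1 kn]; apply: h; rewrite k1 ltnW.
Qed.

End continuity_within.

Section sobolev_remainder.
Context d (Omega : measurableType d) (R : realType).
Variable P : nat -> probability Omega R.
Variable F : nat -> set (set Omega).
Hypothesis sF : forall k, sub_algebra (F k).
Hypothesis FS : forall k, F k `<=` F k.+1.
Variables (a b : R).
Hypothesis ab : a < b.
Variables (delta : nat -> R) (rho : nat -> nat -> R -> Omega -> R)
  (rem : nat -> nat -> R -> Omega -> R) (B : R).
Hypothesis B0 : 0 < B.
Hypothesis delta_bound : \forall n \near \oo, delta n ^+ 2 * n%:R <= B.
Hypothesis mrho : forall n k z, (1 <= k <= n)%N -> sub_measurable (F k) (rho n k z).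
Hypothesis rho0 : forall n k z, (1 <= k <= n)%N ->
  is_cond_exp (P n) (F k.-1) (rho n k z) (cst 0).
Hypothesis rho_rem : \forall n \near \oo, forall k, (1 <= k <= n)%N ->
  {ae P n, forall w, (forall z, z \in `[a, b] -> rho n k z w = rem n k z w) /\
     W12 a b (fun z => rem n k z w)}.
Hypothesis rem_cvg0 : (fun n : nat => ((n%:R^-1 : R)%:E * \sum_(1 <= k < n.+1)
   \int[P n]_w W12_normsq a b (fun z => rem n k z w))%E) @ \oo --> 0%E.

Let W n k w := W12_normsq a b (fun z => rem n k z w).
Let C := sobolev_const a b.

Let W0 n k w : (0 <= W n k w)%E.
Proof. by apply: adde_ge0; apply: integral_ge0 => x _; rewrite lee_fin sqr_ge0. Qed.

Let C0 : 0 < C.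
Proof.
have ba : 0 < b - a by rewrite subr_gt0.
by rewrite /C /sobolev_const !addr_gt0// ?divr_gt0// mulr_gt0.
Qed.

Let energy_rho n k N w : (forall z, z \in `[a, b] -> rho n k z w = rem n k z w) ->
  energy a b N (rho n k ^~ w) = energy a b N (rem n k ^~ w).
Proof.
move=> h; have g i : (i <= 2 ^ N)%N -> rho n k (grid a b N i) w = rem n k (grid a b N i) w.
  by move=> iN; apply: h; rewrite in_itv/=; exact: grid_itv.
rewrite /energy h ?in_itv/= ?lexx ?ltW//; congr (_ + _); apply: eq_bigr => i _.
by rewrite !g// ltnW.
Qed.

Let sum_bound e : 0 < e -> \forall n \near \oo, [/\
  forall k, (1 <= k <= n)%N -> (\int[P n]_w W n k w < +oo)%E &
  \sum_(1 <= k < n.+1) fine (\int[P n]_w W n k w) <= e * n%:R].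
Proof.
move=> e0; have /fine_cvgP[fin] := rem_cvg0; move=> /cvgr0Pnorm_le/(_ _ e0) h.
near=> n.
have n0 : (0 < n)%N by near: n; exact: nbhs_infty_gt.
have nR : 0 < n%:R :> R by rewrite ltr0n.
have fS : ((n%:R^-1 : R)%:E * \sum_(1 <= k < n.+1) \int[P n]_w W n k w)%E \is a fin_num.
  by near: n; exact: fin.
have hn : `|fine ((n%:R^-1 : R)%:E * \sum_(1 <= k < n.+1) \int[P n]_w W n k w)%E| <= e.
  by near: n; exact: h.
set S := (\sum_(1 <= k < n.+1) \int[P n]_w W n k w)%E in fS hn.
have S0 : (0 <= S)%E by apply: sume_ge0 => k _; apply: integral_ge0 => w _; exact: W0.
have Sfin : S \is a fin_num.
  move: fS S0; case: (S) => //; rewrite gt0_muley//.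
  by rewrite lte_fin invr_gt0.
have Slt : (S < +oo)%E by rewrite ltey_eq Sfin.
have hk k : (1 <= k <= n)%N -> (\int[P n]_w W n k w < +oo)%E.
  move=> kn; apply: le_lt_trans Slt; rewrite /S (big_rem k) ?mem_index_iota//=.
  rewrite leeDl//; apply: sume_ge0 => j _; apply: integral_ge0 => w _; exact: W0.
split=> //.
have -> : \sum_(1 <= k < n.+1) fine (\int[P n]_w W n k w) = fine S.
  rewrite /S !big_nat sum_fine// => k kn.
  by rewrite ge0_fin_numE; [exact: hk|apply: integral_ge0 => w _; exact: W0].
rewrite -ler_pdivrMr// mulrC; apply: le_trans hn.
by rewrite fineM// ler_norm.
Unshelve. all: by end_near. Qed.

(** The sum of the energies and the energy of the sum have the same mean, by orthogonality.
    Multiplied by [delta n ^+ 2] it is at most [B * C * e], since [delta n ^+ 2 * n%:R <= B] absorbs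
    the number of terms. *)
Lemma sobolev_remainder_small kappa : 0 < kappa ->
  whp P (fun n => [set w |
    (forall k, (1 <= k <= n)%N -> {within `[a, b], continuous (rho n k ^~ w)}) /\
    (forall z, z \in `[a, b] ->
      delta n ^+ 2 * \sum_(1 <= k < n.+1) rho n k z w ^+ 2 <= kappa /\
      (delta n * \sum_(1 <= k < n.+1) rho n k z w) ^+ 2 <= kappa)]).
Proof.
move=> kappa0.
have c0 : 0 < 2 * (1 + (b - a)) by rewrite mulr_gt0// addr_gt0// subr_gt0.
set c := 2 * (1 + (b - a)) in c0.
have kc0 : 0 < kappa / c by rewrite divr_gt0.
apply: (@whp_sub _ _ _ _ (fun n => [set w | forall k, (1 <= k <= n)%N ->
    {within `[a, b], continuous (rho n k ^~ w)}] `&`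
   ([set w | forall N, delta n ^+ 2 * \sum_(1 <= k < n.+1) energy a b N (rho n k ^~ w) <=
     kappa / c] `&`
    [set w | forall N, delta n ^+ 2 * energy a b N (fun z => \sum_(1 <=
      k < n.+1) rho n k z w) <= kappa / c]))).
  apply: nearW => n w [/= h1 [h2 h3]]; split=> // z zab; split.
  - apply: (grid_dense ab (f := fun z => delta n ^+ 2 * \sum_(1 <=
    k < n.+1) rho n k z w ^+ 2)) => //.
      by apply: within_continuousMr; [exact: within_cst|apply: within_continuous_sum =>
        k kn; apply: within_continuousX; exact: h1].
    move=> N i iN; apply: le_trans (_ : c * (delta n ^+ 2 * \sum_(1 <=
      k < n.+1) energy a b N (rho n k ^~ w)) <= _).
      rewrite [leRHS]mulrCA ler_wpM2l ?sqr_ge0// mulr_sumr; apply: ler_sum => k _.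
      exact: (grid_le_energy ab (rho n k ^~ w)).
    by rewrite mulrC -ler_pdivlMr.
  - apply: (grid_dense ab (f := fun z => (delta n * \sum_(1 <=
    k < n.+1) rho n k z w) ^+ 2)) => //.
      by apply: within_continuousX; apply: within_continuousMr;
        [exact: within_cst|apply: within_continuous_sum => k kn; exact: h1].
    move=> N i iN; apply: le_trans (_ : c * (delta n ^+ 2 * energy a b N (fun z =>
      \sum_(1 <= k < n.+1) rho n k z w)) <= _).
      rewrite exprMn [leRHS]mulrCA; apply: ler_wpM2l; first exact: sqr_ge0.
      exact: (grid_le_energy ab (fun z => \sum_(1 <= k < n.+1) rho n k z w)).
    by rewrite mulrC -ler_pdivlMr.
apply: whpI.
  apply: whp_ae; apply: filterS rho_rem => n h.
  have : {ae P n, forall w, forall k, (1 <= k <= n)%N ->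
      (forall z, z \in `[a, b] -> rho n k z w = rem n k z w) /\ W12 a b (fun z => rem n k z w)}.
    apply/ae_foralln => k; have [kn|kn] := boolP (1 <= k <= n)%N.
      by apply: filterS (h k kn) => w hw _.
    by apply: nearW => w.
  apply: filterS => w hw k kn; have [h1 [h2 _]] := hw k kn.
  apply: subspace_eq_continuous h2 => z zab; symmetry; apply: h1; exact: set_mem.
(* With this [e], Markov's inequality at level [kappa / c] costs [eps / 2] for each of the two
   energies. *)
move=> eps eps0; pose e := eps / 2 * (kappa / c) / (B * C).
have e0 : 0 < e by apply: divr_gt0; [apply: mulr_gt0; rewrite ?divr_gt0|apply: mulr_gt0].
near=> n.
have dB : delta n ^+ 2 * n%:R <= B by near: n.
have aern k : (1 <= k <= n)%N -> {ae P n, forall w,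
    (forall z, z \in `[a, b] -> rho n k z w = rem n k z w) /\
     W12 a b (fun z => rem n k z w)}.
  by move: k; near: n.
have [fW sW] : [/\ forall k, (1 <= k <= n)%N -> (\int[P n]_w W n k w < +oo)%E &
  \sum_(1 <= k < n.+1) fine (\int[P n]_w W n k w) <= e * n%:R].
  by near: n; exact: sum_bound.
have hE k N : (1 <= k <= n)%N -> L1 (P n) (fun w => energy a b N (rho n k ^~ w)) /\
    \int[P n]_w energy a b N (rho n k ^~ w) <= C * fine (\int[P n]_w W n k w).
  move=> kn; apply: L1_le_lower => //.
  - by apply: energy_measurable => z; exact: sub_measurable_fun (mrho z kn).
  - by move=> w; exact: energy_ge0.
  - by apply: filterS (aern k kn) => w [h hW]; rewrite energy_rho//; exact: energy_le_W12.
  - exact: fW.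
have ibig (I : nat -> Omega -> R) : (forall k, (1 <= k <= n)%N -> L1 (P n) (I k)) ->
    L1 (P n) (fun w => \sum_(1 <= k < n.+1) I k w).
  by move=> h; under eq_fun do rewrite big_nat; exact: L1_sum.
have sE N : delta n ^+ 2 * \sum_(1 <= k < n.+1) \int[P n]_w energy a b N (rho n k ^~ w) <=
  B * C * e.
  apply: le_trans (_ : delta n ^+ 2 * (C * (e * n%:R)) <= _).
    rewrite ler_wpM2l ?sqr_ge0//; apply: le_trans (_ : C * \sum_(1 <=
      k < n.+1) fine (\int[P n]_w W n k w) <= _).
      rewrite mulr_sumr !big_nat; apply: ler_sum => k kn; exact: (hE k N kn).2.
    by rewrite ler_pM2l.
  have -> : delta n ^+ 2 * (C * (e * n%:R)) = delta n ^+ 2 * n%:R * (C * e) by ring.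
  by rewrite -[leRHS]mulrA ler_wpM2r// mulr_ge0// ltW.
have BCe : B * C * e / (kappa / c) = eps / 2.
  have BC0 : B * C != 0 by apply: lt0r_neq0; exact: mulr_gt0.
  have kc1 : kappa / c != 0 by exact: lt0r_neq0.
  by rewrite /e [B * C * _]mulrC divfK// mulfK.
have ie k N (kn : (1 <= k <= n)%N) := proj1 (hE k N kn).
have hs N := energy_mdiff_sum sF FS ab (fun k z => mrho (n := n) z) (fun k z => rho0 (n :=
  n) z) ie N.
have [A1 [mA1 hA1 PA1]] : exists A, [/\ measurable A, forall w, ~ A w -> forall N,
    delta n ^+ 2 * \sum_(1 <= k < n.+1) energy a b N (rho n k ^~ w) <= kappa / c &
    (P n A <= (B * C * e / (kappa / c))%:E)%E].
  apply: (@monotone_markov _ _ _ (P n)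
    (fun N w => delta n ^+ 2 * \sum_(1 <= k < n.+1) energy a b N (rho n k ^~ w))) => //.
  - by move=> N w; rewrite mulr_ge0 ?sqr_ge0// sumr_ge0// => k _; exact: energy_ge0.
  - move=> N w; rewrite ler_wpM2l ?sqr_ge0//; apply: ler_sum => k _; exact: energy_mono.
  - by move=> N; apply: L1Z; apply: ibig => k kn; exact: ie.
  - move=> N; rewrite E_Z; last by apply: ibig => k kn; exact: ie.
    under E_ext do rewrite big_nat.
    rewrite E_sum; last by move=> k kn; exact: ie.
    by rewrite -big_nat.
have [A2 [mA2 hA2 PA2]] : exists A, [/\ measurable A, forall w, ~ A w -> forall N,
    delta n ^+ 2 * energy a b N (fun z => \sum_(1 <= k < n.+1) rho n k z w) <= kappa / c &
    (P n A <= (B * C * e / (kappa / c))%:E)%E].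
  apply: (@monotone_markov _ _ _ (P n)
    (fun N w => delta n ^+ 2 * energy a b N (fun z => \sum_(1 <= k < n.+1) rho n k z w))) => //.
  - by move=> N w; rewrite mulr_ge0 ?sqr_ge0//; exact: energy_ge0.
  - move=> N w; rewrite ler_wpM2l ?sqr_ge0//; exact: energy_mono.
  - by move=> N; apply: L1Z; exact: (hs N).1.
  - by move=> N; rewrite E_Z; [rewrite (hs N).2|exact: (hs N).1].
exists (A1 `|` A2); split.
- exact: measurableU.
- move=> w /= hw; apply: contrapT => nA; apply: hw; split=> N.
    by apply: hA1 => h; apply: nA; left.
  by apply: hA2 => h; apply: nA; right.
- apply: le_trans (measureU2 _ mA1 mA2) _.
  by rewrite [eps]splitr EFinD -BCe leeD.
Unshelve. all: by end_near. Qed.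

End sobolev_remainder.

(** * Expansion of the log-likelihood *)

Section logarithmic_expansion.
Context (R : realType).
Implicit Types (x y : nat -> R).

(** The error has derivative [t ^+ 2 / (1 + t)], at most [2 t ^+ 2] for [|t| <= 1 / 2]; the mean
    value theorem is applied between 0 and [u]. *)
Lemma ln1D_taylor (u : R) : `|u| <= 2^-1 -> `|ln (1 + u) - u + u ^+ 2 / 2| <= 2 * `|u| ^+ 3.
Proof.
move=> hu; pose f (t : R) := ln (1 + t) - t + t ^+ 2 / 2.
have df (t : R) : - 2^-1 <= t -> is_derive t 1 f (t ^+ 2 / (1 + t)).
  move=> ht; have t1 : 0 < 1 + t by lra.
  have h1 : is_derive t 1 (fun t : R => 1 + t) 1.
    by apply: (is_derive_eq (is_deriveD _ _)); rewrite add0r.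
  have h := is_derive1_comp (is_derive1_ln t1) h1.
  apply: (is_derive_eq (is_deriveD (is_deriveB h _) _)).
  rewrite /GRing.scale/=.
  by field; rewrite gt_eqF.
have cf (s t : R) : - 2^-1 <= s -> {within `[s, t], continuous f}.
  move=> hs; apply: continuous_in_subspaceT => z; rewrite inE/= in_itv/= => /andP[sz _].
  apply: differentiable_continuous; apply/derivable1_diffP.
  by apply: (@ex_derive _ _ _ _ _ _ _ (df z (le_trans hs sz))).
have f0 : f 0 = 0 by rewrite /f addr0 ln1 expr0n/= mul0r subr0 addr0.
have key (s t : R) : - 2^-1 <= s -> s <= t -> exists2 c, s <= c <= t & f t - f s =
  c ^+ 2 / (1 + c) * (t - s).
  move=> hs st; have := @MVT_segment _ f (fun c => c ^+ 2 / (1 + c)) _ _ st _ (cf _ _ hs).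
  case; first by move=> c; rewrite in_itv/= => /andP[sc _]; apply: df;
    apply: le_trans hs (ltW sc).
  by move=> c; rewrite in_itv/=; exists c.
have bnd (c : R) : `|c| <= `|u| -> `|c ^+ 2 / (1 + c)| <= 2 * `|u| ^+ 2.
  move=> cu; have h : `|c| <= 2^-1 := le_trans cu hu.
  move: (h); rewrite ler_norml => /andP[c1 c2].
  have c3 : 0 < 1 + c by lra.
  rewrite ger0_norm; last by rewrite divr_ge0 ?sqr_ge0// ltW.
  rewrite ler_pdivrMr//.
  have : c ^+ 2 <= `|u| ^+ 2 by rewrite -[c ^+ 2]real_normK ?num_real// ler_sqr ?nnegrE.
  by have := sqr_ge0 `|u|; nra.
move: (hu); rewrite ler_norml => /andP[u1 u2]; rewrite -/(f u).
have -> : 2 * `|u| ^+ 3 = 2 * `|u| ^+ 2 * `|u| by ring.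
have [u0|u0] := leP 0 u.
  have [c /andP[c1 c2]] := key 0 u (ltac:(lra)) u0.
  rewrite f0 !subr0 => ->; rewrite normrM ler_wpM2r// bnd// !ger0_norm//.
have [c /andP[c1 c2]] := key u 0 u1 (ltW u0).
rewrite f0 !sub0r => /(congr1 Num.norm); rewrite normrN => ->.
rewrite normrM normrN ler_wpM2r// bnd// (ltr0_norm u0) ler0_norm//; lra.
Qed.

(** [x] carries the jets and [y] the remainder. Cross terms are split with weight [q],
    [|x y| <= q x^2 / 2 + y^2 / (2 q)], so that the bound [q ^+ 2] on the sum of the [y^2] makes
    both halves of order [q]. The linear sum of the [y] has a hypothesis of its own, as their
    squares do not control it uniformly in [n]. *)
Lemma log_sum_expansion x y n q S : 0 < q -> q <= 4^-1 ->
  (forall k, (1 <= k <= n)%N -> `|x k| <= q) ->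
  \sum_(1 <= k < n.+1) x k ^+ 2 <= S ->
  \sum_(1 <= k < n.+1) y k ^+ 2 <= q ^+ 2 ->
  (\sum_(1 <= k < n.+1) y k) ^+ 2 <= q ^+ 2 ->
  (forall k, (1 <= k <= n)%N -> 0 < 1 + (x k + y k)) /\
  `|\sum_(1 <= k < n.+1) ln (1 + (x k + y k)) -
    (\sum_(1 <= k < n.+1) x k - (\sum_(1 <= k < n.+1) x k ^+ 2) / 2)| <= 9 * q * (S + 1).
Proof.
move=> q0 q4 hx hS hy hsy.
have yq k : (1 <= k <= n)%N -> `|y k| <= q.
  move=> kn; rewrite -ler_sqr ?nnegrE ?(ltW q0)// real_normK ?num_real//; apply: le_trans hy.
  rewrite (big_rem k) ?mem_index_iota//= lerDl; apply: sumr_ge0 => j _; exact: sqr_ge0.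
have uq k : (1 <= k <= n)%N -> `|x k + y k| <= 2 * q.
  move=> kn; apply: le_trans (ler_normD _ _) _.
  by have := hx _ kn; have := yq _ kn; move: `|x k| `|y k| => *; lra.
have uh k : (1 <= k <= n)%N -> `|x k + y k| <= 2^-1.
  by move=> kn; apply: le_trans (uq _ kn) _; lra.
split=> [k kn|]; first by have := uh k kn; rewrite ler_norml => /andP[] *; lra.
have sy : `|\sum_(1 <= k < n.+1) y k| <= q.
  by rewrite -ler_sqr ?nnegrE ?(ltW q0)// real_normK ?num_real.
rewrite (_ : _ - _ = \sum_(1 <= k < n.+1) (ln (1 + (x k + y k)) - (x k + y k) + (x k +
  y k) ^+ 2 / 2 -
   (x k * y k + y k ^+ 2 / 2)) + \sum_(1 <= k < n.+1) y k); last first.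
  rewrite mulr_suml -sumrB -sumrB -big_split/=; apply: eq_bigr => k _.
  by move: (ln _) => l; field.
apply: le_trans (ler_normD _ _) _.
have S0 : 0 <= S by apply: le_trans hS; apply: sumr_ge0 => k _; exact: sqr_ge0.
apply: (@le_trans _ _ (\sum_(1 <= k < n.+1) (17 / 2 * q * x k ^+ 2 +
   (8 * q + q^-1 / 2 + 2^-1) * y k ^+ 2) + q)).
  apply: lerD => //; apply: le_trans (ler_norm_sum _ _ _) _.
  rewrite !big_nat; apply: ler_sum => k kn.
  have h1 := ln1D_taylor (uh k kn).
  have h2 : `|x k + y k| ^+ 3 <= 2 * q * (2 * (x k ^+ 2 + y k ^+ 2)).
    rewrite exprS; apply: ler_pM => //; first exact: uq.
    by rewrite real_normK ?num_real//; have := sqr_ge0 (x k - y k); lra.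
  have h3 : `|x k * y k| <= q / 2 * x k ^+ 2 + q^-1 / 2 * y k ^+ 2.
    have e (s : R) : 0 <= (q * x k + s * y k) ^+ 2 / q -> - s * (x k * y k) <=
        q / 2 * x k ^+ 2 + s ^+ 2 * q^-1 / 2 * y k ^+ 2.
      have -> : (q * x k + s * y k) ^+ 2 / q = q * x k ^+ 2 + 2 * s * (x k * y k) +
        s ^+ 2 * q^-1 * y k ^+ 2.
        by field; rewrite gt_eqF.
      lra.
    have p s : 0 <= (q * x k + s * y k) ^+ 2 / q by rewrite divr_ge0 ?sqr_ge0 ?ltW.
    have := e _ (p 1); have := e _ (p (-1)); rewrite sqrrN expr1n opprK !mulN1r !mul1r.
    by rewrite ler_norml => h4 h5; apply/andP; split; lra.
  apply: le_trans (ler_normB _ _) _; apply: le_trans (lerD h1 (ler_normD _ _)) _.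
  rewrite (ger0_norm (x := y k ^+ 2 / 2)) ?divr_ge0 ?sqr_ge0//.
  by move: h2 h3; move: (`|_| ^+ 3) `|x k * y k| (x k ^+ 2) (y k ^+ 2) (q^-1) => *; lra.
rewrite big_split/= -!mulr_sumr.
have h1 : 17 / 2 * q * \sum_(1 <= k < n.+1) x k ^+ 2 <= 17 / 2 * q * S.
  by rewrite ler_wpM2l// mulr_ge0 ?ltW.
have h2 : (8 * q + q^-1 / 2 + 2^-1) * \sum_(1 <= k < n.+1) y k ^+ 2 <= (8 * q + q^-1 / 2 +
  2^-1) * q ^+ 2.
  by rewrite ler_wpM2l// !addr_ge0 ?divr_ge0 ?mulr_ge0 ?invr_ge0// ltW.
have h3 : (8 * q + q^-1 / 2 + 2^-1) * q ^+ 2 = 8 * q ^+ 3 + q / 2 + q ^+ 2 / 2.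
  by field; rewrite gt_eqF.
have h4 : q ^+ 3 <= q / 16.
  have -> : q ^+ 3 = q * (q * q) by ring.
  rewrite ler_pM2l//; nra.
have h5 : q ^+ 2 <= q / 4 by rewrite expr2 ler_pM2l//; lra.
have h6 : 0 <= q * S by rewrite mulr_ge0// ltW.
by move: h1 h2 h3 h4 h5 h6; move: (\sum_(1 <= k < n.+1) _) (\sum_(1 <=
  k < n.+1) _) (q * S) => *; nra.
Qed.

(* [s] stands for sqrt n * delta_n, and [v] and [y] for the normalised jets and
   the remainder of one likelihood ratio. *)
Lemma likelihood_expansion (G : 'M[R]_2) tau M beta e : 0 < tau -> 0 <= M -> 0 <= beta ->
  0 < e ->
  exists2 eta : R, 0 < eta & forall (n : nat) (s b0 b1 : R) (v0 v1 y : nat -> R),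
  `|b0| <= beta -> `|b1| <= beta -> `|s - tau| <= eta ->
  (forall k, (1 <= k <= n)%N -> `|v0 k| <= eta /\ `|v1 k| <= eta) ->
  `|\sum_(1 <= k < n.+1) v0 k| <= M -> `|\sum_(1 <= k < n.+1) v1 k| <= M ->
  `|\sum_(1 <= k < n.+1) v0 k ^+ 2 - pred_normsq G (jet_vector 1 0)| <= eta ->
  `|\sum_(1 <= k < n.+1) v1 k ^+ 2 - pred_normsq G (jet_vector 0 1)| <= eta ->
  `|\sum_(1 <= k < n.+1) (v0 k + v1 k) ^+ 2 - pred_normsq G (jet_vector 1 1)| <= eta ->
  \sum_(1 <= k < n.+1) y k ^+ 2 <= eta ^+ 2 ->
  (\sum_(1 <= k < n.+1) y k) ^+ 2 <= eta ^+ 2 ->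
  (forall k, (1 <= k <= n)%N -> 0 < 1 + (s * (b0 * v0 k + b1 * v1 k) + y k)) /\
  `|\sum_(1 <= k < n.+1) ln (1 + (s * (b0 * v0 k + b1 * v1 k) + y k)) -
    (tau * (b0 * \sum_(1 <= k < n.+1) v0 k + b1 * \sum_(1 <= k < n.+1) v1 k) -
     tau ^+ 2 / 2 * pred_normsq G (jet_vector b0 b1))| <= e.
Proof.
move=> tau0 M0 beta0 e0.
pose g0 := pred_normsq G (jet_vector 1 0); pose g1 := pred_normsq G (jet_vector 0 1).
pose g := pred_normsq G (jet_vector 1 1).
pose Ga := beta ^+ 2 * (`|g| + 2 * `|g0| + 2 * `|g1|).
have Ga0 : 0 <= Ga by rewrite /Ga mulr_ge0 ?sqr_ge0 ?addr_ge0 ?mulr_ge0.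
pose t := tau + 1; have t0 : 0 < t by rewrite /t; lra.
pose S := t ^+ 2 * (Ga + 5 * beta ^+ 2).
have S0 : 0 <= S by rewrite /S mulr_ge0 ?sqr_ge0 ?addr_ge0 ?mulr_ge0 ?sqr_ge0.
pose c := 2 * beta * t + 1; have c1 : 1 <= c by rewrite /c lerDr !mulr_ge0// ltW.
have c0 : 0 < c by lra.
(* [K] collects the coefficients of [eta] in the final estimate: the expansion of the logarithm, the
   replacement of [s] by [tau] in the linear part, and the two replacements in the quadratic
   part. *)
pose K := 9 * c * (S + 1) + 2 * beta * M + (t ^+ 2 * (5 * beta ^+ 2) + (2 * tau + 1) * Ga) / 2.
have K0 : 0 < K.
  rewrite /K -addrA ltr_wpDr//; last by rewrite !mulr_gt0// ltr_wpDl.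
  have tau2 : 0 <= 2 * tau + 1 by lra.
  have p1 : 0 <= 2 * beta * M by rewrite !mulr_ge0.
  have p2 : 0 <= t ^+ 2 * (5 * beta ^+ 2) by rewrite mulr_ge0 ?sqr_ge0// mulr_ge0 ?sqr_ge0.
  have p3 : 0 <= (2 * tau + 1) * Ga by rewrite mulr_ge0.
  by apply: addr_ge0 => //; apply: divr_ge0 => //; exact: addr_ge0.
pose eta := Num.min 1 (Num.min (4^-1 / c) (e / K)).
have eta0 : 0 < eta by rewrite /eta !lt_min ltr01 /= !divr_gt0.
have eta1 : eta <= 1 by rewrite /eta ge_min lexx.
have etac : c * eta <= 4^-1.
  by rewrite mulrC -ler_pdivlMr// /eta !ge_min lexx orbT.
have etaK : K * eta <= e.
  by rewrite mulrC -ler_pdivlMr// /eta !ge_min lexx !orbT.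
exists eta => // n s b0 b1 v0 v1 y hb0 hb1 hs hv hW0 hW1 hQ0 hQ1 hQ hy hsy.
have st : `|s| <= t.
  have -> : s = tau + (s - tau) by ring.
  by apply: le_trans (ler_normD _ _) _; rewrite gtr0_norm// /t; lra.
pose x k := s * (b0 * v0 k + b1 * v1 k).
have q0 : 0 < c * eta by rewrite mulr_gt0.
have hx k : (1 <= k <= n)%N -> `|x k| <= c * eta.
  move=> kn; have [h0 h1] := hv k kn; rewrite /x normrM.
  apply: (@le_trans _ _ (t * (beta * eta + beta * eta))).
    apply: ler_pM => //; apply: le_trans (ler_normD _ _) _.
    by rewrite !normrM; apply: lerD; exact: ler_pM.
  have -> : t * (beta * eta + beta * eta) = 2 * beta * t * eta by ring.
  have -> : c * eta = 2 * beta * t * eta + eta by rewrite /c; ring.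
  by rewrite lerDl ltW.
have le1 : eta <= c * eta by rewrite ler_peMl// ltW.
have hy' : \sum_(1 <= k < n.+1) y k ^+ 2 <= (c * eta) ^+ 2.
  by apply: le_trans hy _; rewrite ler_sqr ?nnegrE// ltW.
have hsy' : (\sum_(1 <= k < n.+1) y k) ^+ 2 <= (c * eta) ^+ 2.
  by apply: le_trans hsy _; rewrite ler_sqr ?nnegrE// ltW.
pose D0 := \sum_(1 <= k < n.+1) v0 k ^+ 2 - g0.
pose D1 := \sum_(1 <= k < n.+1) v1 k ^+ 2 - g1.
pose D := \sum_(1 <= k < n.+1) (v0 k + v1 k) ^+ 2 - g.
pose E := b0 ^+ 2 * D0 + b0 * b1 * (D - D0 - D1) + b1 ^+ 2 * D1.
have bsq (b : R) : `|b| <= beta -> `|b ^+ 2| <= beta ^+ 2.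
  by move=> hb; rewrite normrX ler_sqr ?nnegrE.
have b01 : `|b0 * b1| <= beta ^+ 2 by rewrite normrM expr2 ler_pM.
(* Polarization: the values in the directions (1, 0), (0, 1) and (1, 1) determine the quadratic form
   at every [(b0, b1)], so three quadratic variations suffice uniformly in the coefficients. *)
have form (p0 p1 p A0 A1 AA : R) : `|p0| <= A0 -> `|p1| <= A1 -> `|p| <= AA ->
    `|b0 ^+ 2 * p0 + b0 * b1 * (p - p0 - p1) + b1 ^+ 2 * p1| <= beta ^+ 2 * (AA + 2 * A0 +
      2 * A1).
  move=> h0 h1 h2.
  have -> : beta ^+ 2 * (AA + 2 * A0 + 2 * A1) = beta ^+ 2 * A0 + beta ^+ 2 * (AA + A0 +
    A1) + beta ^+ 2 * A1 by ring.
  apply: le_trans (ler_normD _ _) _; apply: lerD; last by rewrite normrM; apply: ler_pM =>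
    //; exact: bsq.
  apply: le_trans (ler_normD _ _) _; apply: lerD; first by rewrite normrM;
    apply: ler_pM => //; exact: bsq.
  rewrite normrM; apply: ler_pM => //.
  apply: le_trans (ler_normB _ _) _; apply: lerD => //.
  by apply: le_trans (ler_normB _ _) _; exact: lerD.
have hE : `|E| <= 5 * beta ^+ 2 * eta.
  by apply: le_trans (form _ _ _ eta eta eta hQ0 hQ1 hQ) _; rewrite le_eqVlt; apply/orP;
    left; apply/eqP; ring.
pose pn := pred_normsq G (jet_vector b0 b1).
have pnE : pn = b0 ^+ 2 * g0 + b0 * b1 * (g - g0 - g1) + b1 ^+ 2 * g1.
  by rewrite /pn /g0 /g1 /g !pred_normsq_jet_vector; ring.
have hpn : `|pn| <= Ga.
  by rewrite pnE; apply: form.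
have sx : \sum_(1 <= k < n.+1) x k ^+ 2 = s ^+ 2 * (pn + E).
  rewrite pnE /E /D /D0 /D1 -[RHS]addr0.
  have -> : \sum_(1 <= k < n.+1) x k ^+ 2 = s ^+ 2 * (b0 ^+ 2 * (\sum_(1 <=
    k < n.+1) v0 k ^+ 2) +
     b0 * b1 * (\sum_(1 <= k < n.+1) (v0 k + v1 k) ^+ 2 - \sum_(1 <= k < n.+1) v0 k ^+ 2 -
       \sum_(1 <= k < n.+1) v1 k ^+ 2) + b1 ^+ 2 * (\sum_(1 <= k < n.+1) v1 k ^+ 2)).
    rewrite -!sumrB !mulr_sumr -!big_split/= mulr_sumr; apply: eq_bigr => k _; rewrite /x; ring.
  by ring.
have s2 : s ^+ 2 <= t ^+ 2 by rewrite -[s ^+ 2]real_normK ?num_real// ler_sqr ?nnegrE// ltW.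
have hS : \sum_(1 <= k < n.+1) x k ^+ 2 <= S.
  rewrite sx /S; apply: (@le_trans _ _ (s ^+ 2 * (Ga + 5 * beta ^+ 2))).
    apply: ler_wpM2l; first exact: sqr_ge0.
    apply: lerD; first exact: le_trans (ler_norm _) hpn.
    apply: le_trans (ler_norm _) _; apply: le_trans hE _.
    by rewrite ler_piMr// mulr_ge0// sqr_ge0.
  by apply: ler_wpM2r => //; rewrite addr_ge0// mulr_ge0// sqr_ge0.
have [pos hlog] := log_sum_expansion q0 etac hx hS hy' hsy'.
split=> //; apply: le_trans etaK.
have sumx : \sum_(1 <= k < n.+1) x k = s * (b0 * \sum_(1 <= k < n.+1) v0 k +
  b1 * \sum_(1 <= k < n.+1) v1 k).
  by rewrite !mulr_sumr -big_split/= mulr_sumr.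
set L := b0 * \sum_(1 <= k < n.+1) v0 k + b1 * \sum_(1 <= k < n.+1) v1 k in sumx *.
have hL : `|L| <= 2 * beta * M.
  apply: le_trans (ler_normD _ _) _; rewrite !normrM.
  have -> : 2 * beta * M = beta * M + beta * M by ring.
  by apply: lerD; exact: ler_pM.
have h1 : `|(s - tau) * L| <= eta * (2 * beta * M) by rewrite normrM; exact: ler_pM.
have h2 : `|s ^+ 2 * E| <= t ^+ 2 * (5 * beta ^+ 2 * eta).
  by rewrite normrM; apply: ler_pM => //; rewrite ger0_norm ?sqr_ge0.
have h3 : `|(s ^+ 2 - tau ^+ 2) * pn| <= eta * (2 * tau + 1) * Ga.
  rewrite normrM; apply: ler_pM => //.
  have -> : s ^+ 2 - tau ^+ 2 = (s - tau) * (s + tau) by ring.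
  rewrite normrM; apply: ler_pM => //; apply: le_trans (ler_normD _ _) _.
  by rewrite (gtr0_norm tau0); move: st; rewrite /t; clear; lra.
rewrite -/pn; rewrite (_ : _ - _ = (\sum_(1 <= k < n.+1) ln (1 + (s * (b0 * v0 k +
  b1 * v1 k) + y k)) -
   (\sum_(1 <= k < n.+1) x k - (\sum_(1 <= k < n.+1) x k ^+ 2) / 2)) + ((s - tau) * L -
     (s ^+ 2 * E + (s ^+ 2 - tau ^+ 2) * pn) / 2)); last first.
  by rewrite sumx sx; move: (\sum_(_ <= _ < _) ln _) => l; field.
apply: le_trans (ler_normD _ _) _; apply: le_trans (lerD hlog (ler_normB _ _)) _.
rewrite [`|_ / 2|]normrM (ger0_norm (x := 2^-1))//.
have h4 := ler_normD (s ^+ 2 * E) ((s ^+ 2 - tau ^+ 2) * pn).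
move: h1 h2 h3 h4; rewrite /K; move: (`|_ * L|) (`|s ^+ 2 * E|) (`|_ * pn|) (`|_ + _|) =>
  x1 x2 x3 x4 h1 h2 h3 h4.
have -> : (9 * c * (S + 1) + 2 * beta * M + (t ^+ 2 * (5 * beta ^+ 2) + (2 * tau +
  1) * Ga) / 2) * eta =
  9 * (c * eta) * (S + 1) + (eta * (2 * beta * M) + (t ^+ 2 * (5 * beta ^+ 2 * eta) +
    eta * (2 * tau + 1) * Ga) / 2) by field.
by move: h1 h2 h3 h4; clear; lra.
Qed.

End logarithmic_expansion.

Lemma itv_norm_le (R : realType) (a b z : R) : z \in `[a, b] -> `|z| <= `|a| + `|b|.
Proof.
rewrite in_itv/= => /andP[az zb]; rewrite ler_norml.
have := ler_norm b; have := ler_norm (- a); rewrite normrN.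
have := normr_ge0 a; have := normr_ge0 b.
by move: `|a| `|b| => x y *; apply/andP; split; lra.
Qed.

(** * The log-likelihood process is close to a random parabola *)

Section likelihood_process.
Context d (Omega : measurableType d) (R : realType).
Variable P : nat -> probability Omega R.
Variable F : nat -> set (set Omega).
Hypothesis sF : forall k, sub_algebra (F k).
Hypothesis FS : forall k, F k `<=` F k.+1.
Variables (V : nat -> nat -> Omega -> 'cV[R]_2) (G : 'M[R]_2).
Hypothesis V_md : forall n k, (1 <= k <= n)%N ->
  sq_integrable_martingale_difference (P n) F k (V n k).
Hypothesis lindeberg : conditional_lindeberg P F V.
Hypothesis gram_cvg : gram_cvg_in_prob P F V G.
Hypothesis posG : positive_definite G.
Variables (delta : nat -> R) (tau : R).
Hypothesis tau0 : 0 < tau.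
Hypothesis delta_cvg : (fun n : nat => Num.sqrt (n%:R : R) * delta n) @ \oo --> tau.
Variable ratio : nat -> nat -> R -> Omega -> R.
Hypothesis ratio_measurable : forall n k z, (1 <= k <= n)%N ->
  sub_measurable (F k) (ratio n k z).
Hypothesis ratio_L1 : forall n k z, (1 <= k <= n)%N -> L1 (P n) (ratio n k z).
Hypothesis ratio_normalized : forall n k z, (1 <= k <= n)%N ->
  is_cond_exp (P n) (F k.-1) (ratio n k z) (cst 1).
Variables (a b : R).
Hypothesis ab : a < b.
Variable rem : nat -> nat -> R -> Omega -> R.
Hypothesis expansion : forall n k, (1 <= k <= n)%N ->
  {ae P n, forall w, (forall z, z \in `[a, b] ->
     ratio n k z w = 1 + delta n * jet_parabola z (V n k w) + delta n * rem n k z w) /\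
   W12 a b (fun z => rem n k z w)}.
Hypothesis rem_cvg0 : (fun n : nat => ((n%:R^-1 : R)%:E * \sum_(1 <= k < n.+1)
   \int[P n]_w W12_normsq a b (fun z => rem n k z w))%E) @ \oo --> 0%E.

Definition normalised_sum n w (i : 'I_2) : R :=
  \sum_(1 <= k < n.+1) (Num.sqrt n%:R)^-1 * V n k w i 0.

(* The remainder is redefined from the ratio, so that it is adapted. *)
Let rho n k z w := (delta n)^-1 * (ratio n k z w - 1) - jet_parabola z (V n k w).

Let delta_neq0 : \forall n \near \oo, (0 < n)%N /\ delta n != 0.
Proof.
have t2 : 0 < tau / 2 by rewrite divr_gt0.
move/cvgrPdist_le : delta_cvg => /(_ _ t2) h; near=> n; split; first by near: n;
  exact: nbhs_infty_gt.
apply/eqP => d0; have : `|tau - Num.sqrt n%:R * delta n| <= tau / 2 by near: n; exact: h.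
by rewrite d0 mulr0 subr0 gtr0_norm//; lra.
Unshelve. all: by end_near. Qed.

Let delta_bound : \forall n \near \oo, delta n ^+ 2 * n%:R <= (tau + 1) ^+ 2.
Proof.
move/cvgrPdist_le : delta_cvg => /(_ _ (@ltr01 R)); apply: filterS => n h.
have -> : delta n ^+ 2 * n%:R = (Num.sqrt n%:R * delta n) ^+ 2.
  by rewrite exprMn sqr_sqrtr// mulrC.
rewrite -[X in X <= _]real_normK ?num_real// ler_sqr ?nnegrE//; last by rewrite addr_ge0// ltW.
move: h; set x := _ * delta n => h.
have -> : x = tau - (tau - x) by ring.
by apply: le_trans (ler_normB _ _) _; rewrite gtr0_norm// lerD2l.
Qed.

Let mdV n k i : (1 <= k <= n)%N -> mdiff (P n) F k (fun w => V n k w i 0).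
Proof. by move=> kn; have := V_md kn i. Qed.

Let mrho n k z : (1 <= k <= n)%N -> sub_measurable (F k) (rho n k z).
Proof.
move=> kn; apply: sub_measurableB => //.
  apply: sub_measurableZ => //; apply: sub_measurableB => //; first exact: ratio_measurable.
  exact: sub_measurable_cst.
by apply: sub_measurableD => //; apply: sub_measurableZ => //;
  [case: (mdV 0 kn)|case: (mdV 1 kn)].
Qed.

Let rho0 n k z : (1 <= k <= n)%N -> is_cond_exp (P n) (F k.-1) (rho n k z) (cst 0).
Proof.
move=> kn.
have iV i : L1 (P n) (fun w => V n k w i 0) := mdiff_L1 sF (mdV i kn).
have cV i : is_cond_exp (P n) (F k.-1) (fun w => V n k w i 0) (cst 0) by case: (mdV i kn).
have c1 : is_cond_exp (P n) (F k.-1) (cst (-1) : Omega -> R) (cst (-1)).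
  split=> //; [exact: sub_measurable_cst|exact: L1_cst].
have h := is_cond_expD (sF k.-1)
  (L1Z (delta n)^-1 (L1D (ratio_L1 z kn) (L1_cst _ _)))
  (L1D (L1Z (- z) (iV 0)) (L1Z (- (z ^+ 2 / 2)) (iV 1)))
  (is_cond_expZ (delta n)^-1 (sF k.-1) (L1D (ratio_L1 z kn) (L1_cst _ _))
    (is_cond_expD (sF k.-1) (ratio_L1 z kn) (L1_cst _ _) (ratio_normalized z kn) c1))
  (is_cond_expD (sF k.-1) (L1Z (- z) (iV 0)) (L1Z (- (z ^+ 2 / 2)) (iV 1))
    (is_cond_expZ (- z) (sF k.-1) (iV 0) (cV 0)) (is_cond_expZ (- (z ^+ 2 / 2)) (sF k.-1) (iV 1) (cV 1))).
move: h; congr is_cond_exp; apply/funext => w.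
  by rewrite /rho /jet_parabola /=; ring.
by rewrite /=; ring.
Qed.

Let rho_rem : \forall n \near \oo, forall k, (1 <= k <= n)%N ->
  {ae P n, forall w, (forall z, z \in `[a, b] -> rho n k z w = rem n k z w) /\
     W12 a b (fun z => rem n k z w)}.
Proof.
apply: filterS delta_neq0 => n [_ dn] k kn; apply: filterS (expansion kn) => w [h hW].
split=> // z zab; rewrite /rho h//.
by move: (jet_parabola _ _) (rem _ _ _ _) => J r; field.
Qed.

Let Lambda n w z := \sum_(1 <= k < n.+1) ln (ratio n k z w).

(** All randomness is confined to finitely many events, none depending on [z]: bounds on the
    increments, sums and quadratic variations of the jets, and smallness of the remainder. On their
    intersection [likelihood_expansion] is deterministic, with one [eta] for all [z]. *)
Lemma likelihood_approx e : 0 < e ->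
  whp P (fun n => [set w | {within `[a, b], continuous (Lambda n w)} /\
    forall z, z \in `[a, b] -> `|Lambda n w z -
      (tau * (z * normalised_sum n w 0 + z ^+ 2 / 2 * normalised_sum n w 1) -
       tau ^+ 2 / 2 * pred_normsq G (parabola_coord z))| <= e]).
Proof.
move=> e0 eps eps0.
have eps4 : 0 < eps / 4 by rewrite divr_gt0.
have eps2 : 0 < eps / 2 by rewrite divr_gt0.
have [M1 M10 t1] := jet_array_tight sF FS V_md gram_cvg posG 1 0 eps4.
have [M2 M20 t2] := jet_array_tight sF FS V_md gram_cvg posG 0 1 eps4.
pose M := Num.max M1 M2.
have M0 : 0 <= M by rewrite /M le_max (ltW M10).
pose c := `|a| + `|b|; pose beta := Num.max c (c ^+ 2 / 2).
have c0 : 0 <= c by rewrite addr_ge0.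
have beta0 : 0 <= beta by rewrite le_max c0.
have [eta eta0 H] := likelihood_expansion G tau0 M0 beta0 e0.
have h0 := jet_array_max sF FS V_md lindeberg gram_cvg posG 1 0 eta0.
have h1 := jet_array_max sF FS V_md lindeberg gram_cvg posG 0 1 eta0.
have q0 := jet_array_quadratic_variation sF FS V_md lindeberg gram_cvg posG 1 0 eta0.
have q1 := jet_array_quadratic_variation sF FS V_md lindeberg gram_cvg posG 0 1 eta0.
have q2 := jet_array_quadratic_variation sF FS V_md lindeberg gram_cvg posG 1 1 eta0.
have tau1 : 0 < (tau + 1) ^+ 2 by rewrite exprn_gt0// addr_gt0.
have r := sobolev_remainder_small sF FS ab tau1 delta_bound mrho rho0 rho_rem rem_cvg0
  (exprn_gt0 2 eta0).
have := whpI (whpI (whpI h0 h1) (whpI q0 (whpI q1 q2))) r.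
set good := (X in whp P X) => /(_ _ eps2) hgood.
move/cvgrPdist_le : delta_cvg => /(_ _ eta0) hs.
near=> n.
have [n0 dn] : (0 < n)%N /\ delta n != 0 by near: n.
have hsn : `|tau - Num.sqrt n%:R * delta n| <= eta by near: n; exact: hs.
have [A [mA sA PA]] : exists A, [/\ measurable A, ~` [set w |
    `|\sum_(1 <= k < n.+1) (Num.sqrt n%:R)^-1 * (1 * V n k w 0 0 + 0 * V n k w 1 0)| <=
      M1] `<=` A &
     (P n A <= (eps / 4)%:E)%E].
  by near: n; exact: t1.
have [A' [mA' sA' PA']] : exists A, [/\ measurable A, ~` [set w |
    `|\sum_(1 <= k < n.+1) (Num.sqrt n%:R)^-1 * (0 * V n k w 0 0 + 1 * V n k w 1 0)| <=
      M2] `<=` A &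
     (P n A <= (eps / 4)%:E)%E].
  by near: n; exact: t2.
have [B [mB sB PB]] : exists A, [/\ measurable A, ~` good n `<=` A & (P n A <= (eps / 2)%:E)%E].
  by near: n; exact: hgood.
exists (A `|` A' `|` B); split.
- by apply: measurableU => //; exact: measurableU.
- move=> w /= hw; apply: contrapT => nA; apply: hw.
  have wA : `|normalised_sum n w 0| <= M.
    apply: contrapT => hn; apply: nA; left; left; apply: sA => /= hn'; apply: hn.
    rewrite /M le_max; apply/orP; left; move: hn'; congr (`|_| <= _).
    by apply: eq_bigr => k _; rewrite mul1r mul0r addr0.
  have wA' : `|normalised_sum n w 1| <= M.
    apply: contrapT => hn; apply: nA; left; right; apply: sA' => /= hn'; apply: hn.
    rewrite /M le_max; apply/orP; right; move: hn'; congr (`|_| <= _).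
    by apply: eq_bigr => k _; rewrite mul1r mul0r add0r.
  have : good n w by apply: contrapT => hn; apply: nA; right; exact: sB.
  rewrite /good => -[[[/= g0 g1] [/= g2 [/= g3 g4]]] [g5 g6]].
  pose s := Num.sqrt n%:R * delta n; pose q := (Num.sqrt n%:R : R)^-1.
  have sn0 : Num.sqrt n%:R != 0 :> R by rewrite gt_eqF// sqrtr_gt0 ltr0n.
  have ratioE k z : ratio n k z w = 1 + (s * (z * (q * V n k w 0 0) +
    z ^+ 2 / 2 * (q * V n k w 1 0)) +
      delta n * rho n k z w).
    rewrite /rho /jet_parabola /s /q.
    by move: (ratio _ _ _ _) (V n k w 0 0) (V n k w 1 0) => r0 x y; field; rewrite sn0 dn.
  have Hz z : z \in `[a, b] -> (forall k, (1 <= k <= n)%N -> 0 < ratio n k z w) /\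
      `|Lambda n w z - (tau * (z * normalised_sum n w 0 + z ^+ 2 / 2 * normalised_sum n w 1) -
       tau ^+ 2 / 2 * pred_normsq G (parabola_coord z))| <= e.
    move=> zab; have [r1 r2] := g6 z zab.
    have zc : `|z| <= c := itv_norm_le zab.
    have [|||||||||||k1 k2] := H n s z (z ^+ 2 / 2) (fun k => q * V n k w 0 0)
      (fun k => q * V n k w 1 0) (fun k => delta n * rho n k z w).
    - by rewrite /beta le_max zc.
    - rewrite /beta le_max; apply/orP; right.
      by rewrite normrM normrX (ger0_norm (x := 2^-1))// ler_pM2r// ler_sqr ?nnegrE.
    - by rewrite distrC.
    - move=> k kn; split; [move: (g0 k kn)|move: (g1 k kn)].
        by rewrite mul1r mul0r addr0.
      by rewrite mul1r mul0r add0r.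
    - exact: wA.
    - exact: wA'.
    - by move: g2; congr (`|_ - _| <= _); apply: eq_bigr => k _; rewrite mul1r mul0r addr0.
    - by move: g3; congr (`|_ - _| <= _); apply: eq_bigr => k _; rewrite mul1r mul0r add0r.
    - by move: g4; congr (`|_ - _| <= _); apply: eq_bigr => k _; rewrite !mul1r mulrDr.
    - by move: r1; congr (_ <= _); rewrite mulr_sumr; apply: eq_bigr => k _; rewrite exprMn.
    - by move: r2; rewrite mulr_sumr.
    split; first by move=> k kn; rewrite ratioE; exact: k1.
    move: k2; congr (`|_ - _| <= _); by apply: eq_bigr => k _; rewrite ratioE.
  split; last by move=> z /Hz[].
  apply: within_continuous_sum => k kn.
  rewrite continuous_subspace_in => z zab.
  have zab' : z \in `[a, b] by exact: set_mem.
  (* The ratios are positive on the good event, a by-product of the expansion, so their logarithms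
     are continuous in [z]. *)
  apply: (@continuous_comp (subspace `[a, b]) R R (fun z => ratio n k z w) (@ln R)); last first.
    by apply: continuous_ln; exact: (Hz z zab').1.
  suff : {within `[a, b], continuous (fun z => ratio n k z w)} by exact.
  apply: (@subspace_eq_continuous _ _ _ (fun z' : R => 1 + (s * (z' * (q * V n k w 0 0) +
    z' ^+ 2 / 2 * (q * V n k w 1 0)) + delta n * rho n k z' w) : R)).
    by move=> z' _; symmetry; exact: ratioE.
  have cid : {within `[a, b], continuous (fun z : R => z)}.
    by apply: continuous_subspaceT => x; exact: cvg_id.
  apply: within_continuousDr; first exact: within_cst.
  apply: within_continuousDr; last by apply: within_continuousMr; [exact: within_cst|exact: g5].
  apply: within_continuousMr; first exact: within_cst.
  apply: within_continuousDr; first by apply: within_continuousMr;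
    [exact: cid|exact: within_cst].
  apply: within_continuousMr; last exact: within_cst.
  by apply: within_continuousMr; [exact: within_continuousX|exact: within_cst].
- apply: le_trans (measureU2 _ _ mB) _; first exact: measurableU.
  apply: le_trans (leeD (measureU2 _ mA mA') (lexx _)) _.
  have -> : eps = eps / 4 + eps / 4 + eps / 2 by field.
  by rewrite !EFinD !leeD.
Unshelve. all: by end_near. Qed.

End likelihood_process.

(** * Weak convergence in C([a, b]) *)

Section outer_expectation_bounds.
Context d (Omega : measurableType d) (R : realType) (P : probability Omega R).

(** [X] lies between [h] minus and plus [e + 2 M 1_A]. The upper function is an integrable majorant,
    so it competes in the infimum; the lower one is below every majorant. *)
Lemma outer_expectation_sandwich (X h : Omega -> R) (A : set Omega) (M e p : R) :
  L1 P h -> measurable A -> (P A <= p%:E)%E -> 0 <= e -> 0 <= M ->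
  (forall w, `|X w| <= M) -> (forall w, `|h w| <= M) ->
  (forall w, ~ A w -> `|X w - h w| <= e) ->
  ((\int[P]_w h w - (e + 2 * M * p))%:E <= outer_expectation P X)%E /\
  (outer_expectation P X <= (\int[P]_w h w + (e + 2 * M * p))%:E)%E.
Proof.
move=> ih mA PA e0 M0 bX bh Xh.
have iA : L1 P \1_A by exact: integrable_indic.
have close w : `|X w - h w| <= e + 2 * M * \1_A w.
  rewrite indicE; have [_|/negP nA] := boolP (w \in A).
    rewrite mulr1; apply: le_trans (ler_normB _ _) _.
    by have := bX w; have := bh w; lra.
  by rewrite mulr0 addr0; apply: Xh => Aw; apply: nA; exact/mem_set.
have ig : L1 P (fun w => e + 2 * M * \1_A w) by apply: L1D; [exact: L1_cst|exact: L1Z].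
have Eg : \int[P]_w (e + 2 * M * \1_A w) <= e + 2 * M * p.
  rewrite E_D; [|exact: L1_cst|exact: L1Z].
  rewrite (E_cst P e) E_Z// lerD2l ler_wpM2l//; first by rewrite mulr_ge0.
  by rewrite -lee_fin E_indic.
split.
- apply/le_ereal_inf_tmp => _ [U [mU iU XU] <-].
  rewrite unlock E_fin// lee_fin; apply: (@le_trans _ _ (\int[P]_w (h w - (e +
    2 * M * \1_A w)))).
    by rewrite E_B// lerD2l lerN2.
  apply: E_le => //; first exact: L1B.
  move=> w; apply: le_trans (XU w); have := close w.
  by rewrite ler_norml => /andP[+ _]; move: (e + _) => y; lra.
- apply: (@le_trans _ _ (\int[P]_w (h w + (e + 2 * M * \1_A w)))%:E).
    apply: ereal_inf_lbound; exists (fun w => h w + (e + 2 * M * \1_A w)).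
      split; [exact: L1_measurable (L1D ih ig)|exact: L1D|].
      move=> w; have := close w.
      by rewrite ler_norml => /andP[_ +]; move: (e + _) => y; lra.
    by rewrite unlock E_fin//; exact: L1D.
  by rewrite lee_fin E_D// lerD2l.
Qed.

Lemma mu_ext_le_cover (B A : set Omega) : measurable A -> B `<=` A -> (mu_ext P B <= P A)%E.
Proof. by move=> mA BA; rewrite -(measurable_mu_extE P mA); exact: le_mu_ext. Qed.

End outer_expectation_bounds.

Lemma cvg_ereal_sandwich (R : realType) (u : nat -> \bar R) (l : R) :
  (forall e, 0 < e -> \forall n \near \oo, ((l - e)%:E <= u n)%E /\ (u n <= (l + e)%:E)%E) ->
  u @ \oo --> l%:E.
Proof.
move=> h; apply/fine_cvgP; split.
  apply: filterS (h 1 ltr01) => n [h1 h2].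
  by rewrite fin_real// (lt_le_trans _ h1) ?ltNyr//= (le_lt_trans h2)// ltry.
apply/cvgrPdist_le => e e0; apply: filterS (h e e0) => n [] /=.
case: (u n) => [x||]/=; rewrite ?leye_eq ?leeNy_eq// !lee_fin ler_norml => *.
by apply/andP; split; lra.
Qed.

(** * Continuous functionals near a compact family of parabolas *)

Section functionals_of_parabolas.
Context (R : realType) (a b : R) (tau : R) (c : R -> R).
Hypothesis c_continuous : {within `[a, b], continuous c}.

Let Phi (x y : R) : {uniform` `[a, b] -> R} := fun z => tau * (z * x + z ^+ 2 / 2 * y) - c z.

Lemma parabola_Cab x y : Cab a b (Phi x y).
Proof.
have cid : {within `[a, b], continuous (fun z : R => z)}.
  by apply: continuous_subspaceT => z; exact: cvg_id.
suff : {within `[a, b], continuous (fun z => tau * (z * x + z ^+ 2 / 2 * y) - c z)} by [].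
apply: within_continuousBr c_continuous.
apply: within_continuousMr; first exact: within_cst.
apply: within_continuousDr; first by apply: within_continuousMr; [exact: cid|exact: within_cst].
apply: within_continuousMr; last exact: within_cst.
by apply: within_continuousMr; [exact: within_continuousX|exact: within_cst].
Qed.

Let C := `|tau| * (`|a| + `|b|) + `|tau| * ((`|a| + `|b|) ^+ 2 / 2) + 1.

Let lip_gt0 : 0 < C.
Proof. by rewrite ltr_wpDl// addr_ge0 ?mulr_ge0 ?divr_ge0 ?sqr_ge0 ?addr_ge0. Qed.

Let PhiB x y x' y' z q : `|x - x'| <= q -> `|y - y'| <= q -> z \in `[a, b] ->
  `|Phi x y z - Phi x' y' z| <= C * q.
Proof.
move=> hx hy zab; have zc := itv_norm_le zab.
have q0 : 0 <= q by exact: le_trans hx.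
have -> : Phi x y z - Phi x' y' z = tau * z * (x - x') + tau * (z ^+ 2 / 2) * (y - y').
  by rewrite /Phi; move: (c z) => cz; ring.
apply: le_trans (ler_normD _ _) _; rewrite /C mulrDl mul1r mulrDl -addrA.
apply: lerD; first by rewrite !normrM; apply: ler_pM => //; apply: ler_wpM2l.
apply: (@le_trans _ _ (`|tau| * ((`|a| + `|b|) ^+ 2 / 2) * q)); last by rewrite lerDl.
rewrite normrM; apply: ler_pM => //; rewrite normrM; apply: ler_wpM2l => //.
rewrite normrM normrX (ger0_norm (x := 2^-1))// ler_pM2r// ler_sqr ?nnegrE// addr_ge0//.
Qed.

Variable f : {uniform` `[a, b] -> R} -> R.
Hypothesis cf : {within Cab a b, continuous f}.

(** Continuity of [f] at each parabola becomes uniform over the compact square of coefficients, with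
    [g] still ranging over all of [Cab a b]: close coefficients give uniformly close parabolas by
    [PhiB], so one radius serves a neighbourhood of each point of the square. *)
Lemma functional_modulus M e : 0 < e -> exists2 r, 0 < r & forall x y, `|x| <= M -> `|y| <= M ->
  forall g, Cab a b g -> (forall z, z \in `[a, b] -> `|g z - Phi x y z| <= r) ->
  `|f g - f (Phi x y)| <= e.
Proof.
move=> e0; have e2 : 0 < e / 2 by rewrite divr_gt0.
have C0 := lip_gt0.
have cpt : compact (`[-M, M] `*` `[-M, M]).
  by apply: compact_setX; exact: segment_compact.
move/compact_near_coveringP : cpt => /(_ R (0^'+)
  (fun r v => forall g, Cab a b g -> (forall z, z \in `[a, b] -> `|g z - Phi v.1 v.2 z| <= r) ->
  `|f g - f (Phi v.1 v.2)| <= e)) []; last first.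
  move=> r /= r0 h; exists (r / 2); first by rewrite divr_gt0.
  move=> x y hx hy; apply: (h (r / 2) _ _ (x, y)).
  - by rewrite /= sub0r normrN gtr0_norm ?divr_gt0// ltr_pdivrMr//; lra.
  - by rewrite divr_gt0.
  - by split; rewrite /= in_itv/= -ler_norml.
move=> [x y] _ /=.
have [r0 r00 hr0] : exists2 r0, 0 < r0 & forall g, Cab a b g ->
    (forall z, z \in `[a, b] -> `|Phi x y z - g z| < r0) -> `|f (Phi x y) - f g| <= e / 2.
  have Pxy : Cab a b (Phi x y) by exact: parabola_Cab.
  move: cf => /subspace_continuousP/(_ _ Pxy).
  move=> /cvgrPdist_le/(_ _ e2); rewrite near_withinE => /uniform_nbhs[E [+ hE]].
  rewrite -entourage_ballE => -[r /= r1 hr]; exists r => // g cg hg.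
  apply: hE => // z zab; apply: hr; rewrite /ball/=; exact: hg.
(* Half of [r0] is kept for the distance between two parabolas, half for the distance from the
   second one to [g]. *)
pose q := r0 / (2 * C).
have q0 : 0 < q by rewrite divr_gt0// mulr_gt0.
have Cq : C * q = r0 / 2 by rewrite /q; field; rewrite gt_eqF.
exists ([set v : R * R | `|x - v.1| < q /\ `|y - v.2| < q], [set r | r < r0 / 2]).
  split=> /=.
    exists (ball x q, ball y q); first by split; exact: nbhsx_ballx.
    by move=> [u v] [/= h1 h2]; split.
  exists (r0 / 2); first by rewrite /= divr_gt0.
  by move=> r; rewrite /= sub0r normrN => /(le_lt_trans (ler_norm _)).
move=> [[x' y'] r] [/= [hx hy] hr] g cg hg.
have hP z : z \in `[a, b] -> `|Phi x y z - Phi x' y' z| <= r0 / 2.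
  by rewrite -Cq; apply: PhiB; exact: ltW.
have h1 : `|f (Phi x y) - f g| <= e / 2.
  apply: hr0 => // z zab.
  have -> : Phi x y z - g z = Phi x y z - Phi x' y' z - (g z - Phi x' y' z).
    by move: (Phi x y z) (Phi x' y' z) (g z) => u v t; ring.
  apply: le_lt_trans (ler_normB _ _) _; rewrite [r0]splitr; apply: ler_ltD; first exact: hP.
  exact: le_lt_trans (hg z zab) hr.
have h2 : `|f (Phi x y) - f (Phi x' y')| <= e / 2.
  apply: hr0 => [|z zab]; first exact: parabola_Cab.
  by apply: le_lt_trans (hP z zab) _; rewrite ltr_pdivrMr//; lra.
rewrite (_ : f g - _ = f (Phi x y) - f (Phi x' y') - (f (Phi x y) - f g)); last first.
  by move: (f g) (f (Phi x y)) (f (Phi x' y')) => u v w; ring.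
by apply: le_trans (ler_normB _ _) _; rewrite [e]splitr; exact: lerD.
Qed.

Lemma functional_luc : locally_unif_cont (fun x y => f (Phi x y)).
Proof.
move=> M e M0 e0; have [r r0 hr] := @functional_modulus M e e0.
have rC : 0 < r / C by rewrite divr_gt0.
exists (r / C) => // x y x' y' hx hy hx' hy' hxx hyy.
rewrite distrC; apply: hr => //; first exact: parabola_Cab.
move=> z zab; rewrite distrC; apply: le_trans (PhiB (ltW hxx) (ltW hyy) zab) _.
by rewrite mulrC divfK// gt_eqF.
Qed.

End functionals_of_parabolas.

(** * From approximation by parabolas to weak convergence *)

Section weak_convergence.
Context d (Omega : measurableType d) (R : realType) (P : nat -> probability Omega R).
Context d' (Omega' : measurableType d') (P' : probability Omega' R).
Variables (a b tau : R) (c : R -> R).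
Hypothesis c_continuous : {within `[a, b], continuous c}.
Variables (X : nat -> Omega -> R -> R) (W0 W1 : nat -> Omega -> R) (Z0 Z1 : Omega' -> R).
Hypothesis mW0 : forall n, measurable_fun setT (W0 n).
Hypothesis mW1 : forall n, measurable_fun setT (W1 n).
Hypothesis mZ0 : measurable_fun setT Z0.
Hypothesis mZ1 : measurable_fun setT Z1.
Hypothesis tight0 : tight P W0.
Hypothesis tight1 : tight P W1.
Hypothesis waves : forall al be phi : R,
  (fun n => \int[P n]_w cos (al * W0 n w + be * W1 n w + phi)) @ \oo -->
  \int[P']_w cos (al * Z0 w + be * Z1 w + phi).

Let Phi (x y : R) : {uniform` `[a, b] -> R} := fun z => tau * (z * x + z ^+ 2 / 2 * y) - c z.

Hypothesis approx : forall e, 0 < e -> whp P (fun n => [set w |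
  {within `[a, b], continuous (X n w)} /\
  forall z, z \in `[a, b] -> `|X n w z - Phi (W0 n w) (W1 n w) z| <= e]).

(** [f (X n w)] is close to [f] at the approximating parabola by [functional_modulus], on a square
    of coefficients supplied by tightness. The latter is a bounded, locally uniformly continuous
    function of [W0] and [W1], to which [cvg_of_waves] applies. *)
Lemma weak_cvg_of_approx : weak_cvg_C a b P X P' (fun w => Phi (Z0 w) (Z1 w)).
Proof.
split=> [|w|f cf [M hM]].
- apply: (@cvg_ereal_sandwich R _ 0) => e e0.
  apply: filterS (approx ltr01 e0) => n [A [mA sA PA]]; rewrite sub0r add0r; split.
    apply: (@le_trans _ _ 0%E); last exact: mu_ext_ge0.
    by rewrite lee_fin oppr_le0 ltW.
  apply: le_trans (mu_ext_le_cover (P n) mA _) PA => w /= h.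
  by apply: sA => -[h' _]; exact: h.
- exact: parabola_Cab.
have M0 : 0 <= M by apply: le_trans (hM (Phi 0 0)).
have luc := functional_luc tau c_continuous cf.
have bh x y : `|f (Phi x y)| <= M by exact: hM.
have mh := measurable2_luc mW0 mW1 mZ0 mZ1 waves bh luc.
have hcvg := cvg_of_waves mW0 mW1 mZ0 mZ1 waves bh luc tight0 tight1.
rewrite unlock E_fin; last by apply: (L1_bounded P' (M := M)) => //; exact: mh.
apply: cvg_ereal_sandwich => e e0.
have e4 : 0 < e / 4 by rewrite divr_gt0.
pose p := e / 4 / (2 * M + 1).
have M1 : 0 < 2 * M + 1 by lra.
have p0 : 0 < p by rewrite divr_gt0.
have pe : 2 * M * p <= e / 4.
  have <- : (2 * M + 1) * p = e / 4 by rewrite /p [LHS]mulrC divfK// gt_eqF.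
  by rewrite ler_wpM2r ?(ltW p0)// lerDl.
have [t0 t00 ht0] := tight0 (divr_gt0 p0 (ltr0n R 4)).
have [t1 t10 ht1] := tight1 (divr_gt0 p0 (ltr0n R 4)).
pose T := Num.max t0 t1.
have [r r0 hr] := functional_modulus tau c_continuous cf T e4.
have hap := approx r0 (divr_gt0 p0 (ltr0n R 2)).
move/cvgrPdist_le : hcvg => /(_ _ e4) hcvg.
near=> n.
have hn : `|\int[P']_w f (Phi (Z0 w) (Z1 w)) - \int[P n]_w f (Phi (W0 n w) (W1 n w))| <= e / 4.
  by near: n; exact: hcvg.
have [A [mA sA PA]] : exists A, [/\ measurable A, ~` [set w | `|W0 n w| <= t0] `<=` A &
  (P n A <= (p / 4)%:E)%E].
  by near: n; exact: ht0.
have [A' [mA' sA' PA']] : exists A, [/\ measurable A, ~` [set w | `|W1 n w| <= t1] `<=` A &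
  (P n A <= (p / 4)%:E)%E].
  by near: n; exact: ht1.
have [B [mB sB PB]] : exists A, [/\ measurable A, ~` [set w |
  {within `[a, b], continuous (X n w)} /\
  forall z, z \in `[a, b] -> `|X n w z - Phi (W0 n w) (W1 n w) z| <= r] `<=` A & (P n A <=
    (p / 2)%:E)%E].
  by near: n; exact: hap.
have PAB : (P n (A `|` A' `|` B) <= p%:E)%E.
  apply: le_trans (measureU2 _ _ mB) _; first exact: measurableU.
  apply: le_trans (leeD (measureU2 _ mA mA') (lexx _)) _.
  have -> : p = p / 4 + p / 4 + p / 2 by field.
  by rewrite !EFinD !leeD.
have mAB : measurable (A `|` A' `|` B) by apply: measurableU => //; exact: measurableU.
have ih : L1 (P n) (fun w => f (Phi (W0 n w) (W1 n w))).
  by apply: (L1_bounded (P n) (M := M)) => //; exact: mh.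
have [||l1 l2] := outer_expectation_sandwich (X := fun w =>
  f (X n w)) ih mAB PAB (ltW e4) M0 _ (fun w => bh _ _).
- by move=> w; exact: hM.
- move=> w nA.
  have [h1 h2] : {within `[a, b], continuous (X n w)} /\
      forall z, z \in `[a, b] -> `|X n w z - Phi (W0 n w) (W1 n w) z| <= r.
    by apply: contrapT => h; apply: nA; right; exact: sB.
  apply: hr => //.
    rewrite /T le_max; apply/orP; left; apply: contrapT => h; apply: nA; left; left; exact: sA.
  rewrite /T le_max; apply/orP; right; apply: contrapT => h; apply: nA; left; right; exact: sA'.
move: hn; rewrite ler_norml => /andP[h1 h2]; split.
- by apply: le_trans l1; rewrite lee_fin; move: pe h1 h2; lra.
- by apply: le_trans l2 _; rewrite lee_fin; move: pe h1 h2; lra.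
Unshelve. all: by end_near. Qed.

End weak_convergence.

(** * The natural filtration of the observations *)

Section natural_filtration.
Context d dT (Omega : measurableType d) (T : measurableType dT).
Variable Y : nat -> Omega -> T.
Hypothesis mY : forall k, measurable_fun setT (Y k).

Lemma natural_filtration_sub_algebra k : sub_algebra (natural_filtration Y k).
Proof.
split; first exact: smallest_sigma_algebra.
apply: smallest_sub; first exact: sigma_algebra_measurable.
by move=> A [j _ [B mB <-]]; exact: mY.
Qed.

Lemma natural_filtrationS k : natural_filtration Y k `<=` natural_filtration Y k.+1.
Proof.
apply: smallest_sub; first exact: smallest_sigma_algebra.
move=> A [j /= jk h]; apply: sub_sigma_algebra; exists j => //=.
exact: leq_trans jk _.
Qed.

Lemma natural_filtration_coord j k (B : set T) : (j <= k)%N -> measurable B ->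
  natural_filtration Y k (Y j @^-1` B).
Proof.
move=> jk mB; apply: sub_sigma_algebra; exists j => //; exists B => //.
by rewrite setTI.
Qed.

Lemma sub_measurable_past (R : realType) k (q : k.-tuple T * T -> R) :
  measurable_fun setT q ->
  sub_measurable (natural_filtration Y k) (fun w => q (past Y k w, Y k w)).
Proof.
move=> mq; pose G := g_sigma_algebraType (natural_filtration Y k).
have sG := natural_filtration_sub_algebra k.
apply/sub_measurableP; first by case: sG.
have mYj j : (j <= k)%N -> measurable_fun [set: G] (Y j : G -> T).
  move=> jk _ B mB; rewrite setTI; apply: sub_sigma_algebra.
  exact: natural_filtration_coord.
apply: (measurableT_comp mq); apply: measurable_fun_pair => /=; last exact: mYj.
apply/measurable_fun_tnthP => i /=.
apply: (eq_measurable_fun (Y i : G -> T)) => [w _|]; first by rewrite /= tnth_mktuple.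
by apply: mYj; exact: ltnW.
Qed.

End natural_filtration.

(** * Passage from the hypotheses of the theorem *)

Section theorem_inputs.
Context (R : realType).

Lemma within_continuous_pred_normsq (G : 'M[R]_2) (A : set R) :
  {within A, continuous (fun z => pred_normsq G (parabola_coord z))}.
Proof.
have cid : {within A, continuous (fun z : R => z)}.
  by apply: continuous_subspaceT => z; exact: cvg_id.
have c2 : {within A, continuous (fun z : R => z ^+ 2 / 2)}.
  by apply: within_continuousMr; [exact: within_continuousX|exact: within_cst].
rewrite /parabola_coord; under eq_fun do rewrite pred_normsq_jet_vector.
apply: within_continuousDr; apply: within_continuousDr; apply: within_continuousMr;
  do ?[exact: within_cst|exact: within_continuousX|exact: within_continuousMr].
Qed.

Lemma parabola_nondegenerate (G : 'M[R]_2) (tau : R) : positive_definite G -> 0 < tau ->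
  nondegenerate_parabola G (fun z => tau *: parabola_coord z).
Proof.
move=> [_ posG] tau0; exists 0, (jet_vector tau 0), (jet_vector 0 (tau / 2)); split.
  move=> z; rewrite add0r; apply/colP => i; rewrite !mxE; case: ifP => _.
    by rewrite mulr0 addr0 mulrC.
  by rewrite mulr0 add0r; field.
move=> s t h; have : s *: jet_vector tau 0 + t *: jet_vector 0 (tau / 2) = 0.
  by apply/eqP; apply: contraPT h => /posG; rewrite lt0r => /andP[/eqP].
move=> /colP hv; have := hv 0; have := hv 1; rewrite !mxE /= !mulr0 addr0 add0r.
move=> /eqP; rewrite !mulf_eq0 invr_eq0 pnatr_eq0 (gt_eqF tau0) !orbF => /eqP ->.
by move=> /eqP; rewrite mulf_eq0 (gt_eqF tau0) orbF => /eqP ->.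
Qed.

(** [is_cond_exp] says nothing about the integrability of [X]; evaluated on the whole space it gives
    [X >= 0] the integral 1. *)
Lemma L1_of_cond_exp1 d (Omega : measurableType d) (P : probability Omega R)
    (H : set (set Omega)) (X : Omega -> R) : sub_algebra H -> measurable_fun setT X ->
  (forall w, 0 <= X w) -> is_cond_exp P H X (cst 1) -> L1 P X.
Proof.
move=> [sH _] mX X0 [_ _ h]; apply/integrableP; split; first exact/measurable_EFinP.
have HT : H setT by case: sH => H0 HC _; rewrite -(setD0 setT); exact: HC.
under eq_integral do rewrite /= ger0_norm//.
rewrite -(h _ HT) (E_fin (f := cst 1)) ?ltry//; exact: L1_cst.
Qed.

End theorem_inputs.

Theorem theorem6p1 (R : realType)
  (dT d : measure_display) (T : measurableType dT) (Omega : measurableType d)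
  (Y : nat -> Omega -> T)
  (measurable_Y : forall k, measurable_fun [set: Omega] (Y k))
  (* nuisance parameter in R^m; no nuisance if m = 0 *)
  (m : nat)
  (law : R -> R -> 'cV[R]_m -> probability Omega R)
  (mu : {sigma_finite_measure set T -> \bar R})
  (dens : R -> R -> 'cV[R]_m -> forall k : nat, k.-tuple T * T -> R)
  (eps delta : nat -> R) (tau : R)
  (eps_decr : nonincreasing_seq eps)
  (eps_cvg0 : eps @ \oo --> (0 : R))
  (delta_def : forall n, delta n = eps n ^+ 2)
  (tau_gt0 : 0 < tau)
  (delta_cvg : (fun n : nat => Num.sqrt (n%:R : R) * delta n) @ \oo --> tau)
  (th0 : 'cV[R]_m) (path : nat -> R -> 'cV[R]_m)
  (path0 : forall n, path n 0 = th0) :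
  let P0 := fun n => law (eps n) 0 th0 in
  let F := natural_filtration Y in
  let ratio := fun n k z =>
    predictive_ratio dens Y (eps n) z th0 (path n z) k in
  let Lambda := fun n =>
    log_likelihood_ratio dens Y (eps n) th0 (path n) n in
  forall
  (Y_stationary : forall n z,
    stationary (law (eps n) (eps n * z) (path n z)) Y)
  (Y_density : forall n z k, (0 < k)%N ->
    predictive_density (law (eps n) (eps n * z) (path n z)) Y mu
      (dens (eps n) (eps n * z) (path n z) k))
  (ratio_normalized : forall n z k, (0 < k)%N ->
    is_cond_exp (P0 n) (F k.-1) (ratio n k z) (cst 1))
  (Jm Jp : nat -> nat -> Omega -> R)
  (Q : nat -> nat -> Omega -> 'cV[R]_m)
  (A : nat -> nat -> Omega -> 'M[R]_(2, m))
  (G : 'M[R]_(2 + m)),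
  let V := fun n k w => jet_vector (Jm n k w) (Jp n k w) in
  let Veff := fun n k w => efficient_increment (V n k w) (A n k w) (Q n k w) in
  let Geff := schur_complement G in
  forall
  (V_md : forall n k, (1 <= k <= n)%N ->
    sq_integrable_martingale_difference (P0 n) F k (V n k))
  (Q_md : forall n k, (1 <= k <= n)%N ->
    sq_integrable_martingale_difference (P0 n) F k (Q n k))
  (A_predictable : forall n k, (1 <= k <= n)%N ->
    predictable_matrix F k (A n k))
  (Veff_md : forall n k, (1 <= k <= n)%N ->
    sq_integrable_martingale_difference (P0 n) F k (Veff n k))
  (joint_gram_cvg :
    gram_cvg_in_prob P0 F (fun n k w => col_mx (V n k w) (Q n k w)) G)
  (GQQ_unit : drsubmx G \in unitmx)
  (expansion : forall a b : R, a < b ->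
    exists rem : nat -> nat -> R -> Omega -> R,
      (forall n k, (1 <= k <= n)%N ->
        {ae P0 n, forall w,
          (forall z, z \in `[a, b] ->
            ratio n k z w =
            1 + delta n * jet_parabola z (Veff n k w)
              + delta n * rem n k z w) /\
          W12 a b (fun z => rem n k z w)}) /\
      (fun n : nat => ((n%:R^-1 : R)%:E * \sum_(1 <= k < n.+1)
         \int[P0 n]_w W12_normsq a b (fun z => rem n k z w))%E)
        @ \oo --> 0%E)
  (lindeberg : conditional_lindeberg P0 F Veff)
  (eff_gram_cvg : gram_cvg_in_prob P0 F Veff Geff)
  (Geff_posdef : positive_definite Geff)
  (d' : measure_display) (Omega' : measurableType d')
  (P' : probability Omega' R) (Z : Omega' -> 'cV[R]_2)
  (Z_gaussian : gaussian_vector P' Z Geff),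
  (forall a b : R, a < b ->
     weak_cvg_C a b P0 Lambda P' (limit_process tau Geff Z)) /\
  nondegenerate_parabola Geff (fun z => tau *: parabola_coord z).
Proof.
move=> P0 F ratio Lambda Y_stationary Y_density ratio_normalized Jm Jp Q A G V Veff Geff
  V_md Q_md A_predictable Veff_md joint_gram_cvg GQQ_unit expansion lindeberg
  eff_gram_cvg Geff_posdef d' Omega' P' Z Z_gaussian.
split; last exact: parabola_nondegenerate.
move=> a b ab.
have sF k : sub_algebra (F k) by exact: natural_filtration_sub_algebra.
have FS k : F k `<=` F k.+1 by exact: natural_filtrationS.
(* The denominator is the numerator at [z = 0], where [eps n * 0 = 0] and the path is at [th0]. *)
have dens0 n k : (0 < k)%N -> measurable_fun setT (dens (eps n) 0 th0 k) /\
    (forall x, 0 <= dens (eps n) 0 th0 k x).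
  by move=> k0; have [] := Y_density n 0 k k0; rewrite mulr0 path0.
have ratio_ge0 n k z w : (0 < k)%N -> 0 <= ratio n k z w.
  move=> k0; rewrite /ratio /predictive_ratio divr_ge0//; last exact: (dens0 n k k0).2.
  by have [_ h _] := Y_density n z k k0.
have ratio_measurable n k z : (1 <= k <= n)%N -> sub_measurable (F k) (ratio n k z).
  move=> /andP[k0 _]; have [m0 ge0] := dens0 n k k0.
  (* The inverse is written as the power [- 1], equal to it on nonnegative reals and measurable on
     the whole line. *)
  rewrite (_ : ratio n k z = fun w => dens (eps n) (eps n * z) (path n z) k (past Y k w,
    Y k w) *
      dens (eps n) 0 th0 k (past Y k w, Y k w) `^ (- 1)); last first.
    by apply/funext => w; rewrite powR_inv1.
  apply: sub_measurableM => //.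
    by apply: sub_measurable_past => //; have [] := Y_density n z k k0.
  apply: (sub_measurable_comp (phi := fun x => x `^ (- 1))); first exact: measurable_powR.
  exact: sub_measurable_past.
have ratio_ce n k z : (1 <= k <= n)%N -> is_cond_exp (P0 n) (F k.-1) (ratio n k z) (cst 1).
  by move=> /andP[k0 _]; exact: ratio_normalized.
have ratio_L1 n k z : (1 <= k <= n)%N -> L1 (P0 n) (ratio n k z).
  move=> kn; apply: (L1_of_cond_exp1 (sF k.-1)) (ratio_ce n k z kn).
    exact: sub_measurable_fun (ratio_measurable n k z kn).
  by move=> w; apply: ratio_ge0; case/andP: kn.
have [rem [rem_exp rem_cvg]] := expansion a b ab.
(* The approximation is applied to the efficient increments [Veff], whose Gram matrices converge to
   the Schur complement [Geff]. *)
have approx := likelihood_approx sF FS Veff_md lindeberg eff_gram_cvg Geff_posdef tau_gt0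
  delta_cvg ratio_measurable ratio_L1 ratio_ce ab rem_exp rem_cvg.
pose W i n w := normalised_sum Veff n w i.
have mW i n : measurable_fun setT (W i n).
  rewrite /W /normalised_sum; under eq_fun do rewrite big_nat.
  apply: (L1_measurable (P := P0 n)); apply: L1_sum => k kn; apply: L1Z.
  by apply: (mdiff_L1 sF (k := k)); have := Veff_md n k kn i.
have [mZ _] := Z_gaussian.
have tightW i : tight P0 (W i).
  have [->|->] : i = 0 \/ i = 1.
    by case: i => [[|[|]]] // h; [left|right]; exact: val_inj.
  - have := jet_array_tight sF FS Veff_md eff_gram_cvg Geff_posdef 1 0.
    congr tight; apply/funext => n; apply/funext => w; apply: eq_bigr => k _.
    by rewrite mul1r mul0r addr0.
  - have := jet_array_tight sF FS Veff_md eff_gram_cvg Geff_posdef 0 1.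
    congr tight; apply/funext => n; apply/funext => w; apply: eq_bigr => k _.
    by rewrite mul1r mul0r add0r.
have waves al be phi :
    (fun n => \int[P0 n]_w cos (al * W 0 n w + be * W 1 n w + phi)) @ \oo -->
    \int[P']_w cos (al * Z w 0 0 + be * Z w 1 0 + phi).
  rewrite (gaussian_vector_cos al be phi Geff_posdef Z_gaussian).
  exact: jet_array_clt.
have := weak_cvg_of_approx (within_continuousMr (@within_cst R `[a, b] (tau ^+ 2 / 2))
  (@within_continuous_pred_normsq R Geff `[a,
    b])) (mW 0) (mW 1) (mZ 0) (mZ 1) (tightW 0) (tightW 1) waves approx.
congr weak_cvg_C; apply/funext => w; apply/funext => z.
by rewrite /limit_process /isonormal dotp_jet_vector.
Qed.
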